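(* Let $\beta_1\ge 0$, $B_1,\beta_2,B_2>0$ and $d\in\mathbb{N}$ with $d\ge 2$. Put $\rho:=\frac{d-1}{\beta_2}$, $\kappa:=1+\beta_1$ and $\mathcal{F}:=\mathcal{F}_{\beta_2,B_2,d-1}$. Let $\mathfrak{Q}$ be a class of probability distributions $\mathbb{Q}$ of $(X,Y)$ on $[0,1]^d\times\{0,1\}$ such that: (a) There is a constant $M>1$ such that for all $\mathbb{Q}\in\mathfrak{Q}$ the marginal distribution $\mathbb{Q}_X$ has a Lebesgue density bounded by $M$. (b) There are constants $r\in\mathbb{N}$ and $\epsilon_1,\epsilon_2>0$ such that for all $\mathbb{Q}\in\mathfrak{Q}$ the Bayes rule satisfies $G^*_{\mathbb{Q}}\in\mathcal{K}^{\mathcal{F}}_{\mathbb{Q},\beta_1,B_1,\epsilon_1,\epsilon_2,r,d}$. (c) There is a constant $c_1>0$ such that $d_{f_{\mathbb{Q}}}(G,G^*_{\mathbb{Q}})\ge c_1 d_\Delta^{\kappa}(G,G^*_{\mathbb{Q}})$ for all $G\in\mathcal{N}:=\bigcup_{n\in\mathbb{N}}\mathcal{N}_{n,n,n}$ and all $\mathbb{Q}\in\mathfrak{Q}$. Let $$\tau_n:=\frac{n^{\frac{1}{2\kappa+\rho-1}}}{\log^{\frac{2}{\rho}}(n)}.$$ Let $L_0(\epsilon)=a_1\lceil\log(\epsilon^{-1})\rceil$, $s_0(\epsilon)=a_2\epsilon^{-\rho}\log(\epsilon^{-1})$, $c_0(\epsilon)=a_3+a_4\lceil\log(\epsilon^{-1})\rceil$,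 where $a_1,a_2>0$, $a_3,a_4\in\mathbb{N}$ are constants (which exist) such that for some $\epsilon_0>0$ every $\gamma\in\mathcal{F}_{\beta_2,B_2,d-1}$ can, for every $\epsilon\in(0,\epsilon_0)$, be approximated as $\|R(\Phi)-\gamma\|_\infty\le\epsilon$ by a ReLU network $\Phi$ with at most $L_0(\epsilon)$ layers, sparsity at most $s_0(\epsilon)$ and weights in $\mathcal{W}_{c_0(\epsilon)}$. Then there exist constants $C_1',C_2'>0$ and $C_3'\in\mathbb{N}$ such that for all $p\ge 1$ $$\limsup_{n\to\infty}\ \sup_{\mathbb{Q}\in\mathfrak{Q}}\ \tau_n^{p\kappa}\,\mathbb{E}\big[d^p_{f_{\mathbb{Q}}}(\hat G_n,G^*_{\mathbb{Q}})\big]<\infty,\qquad \limsup_{n\to\infty}\ \sup_{\mathbb{Q}\in\mathfrak{Q}}\ \tau_n^{p}\,\mathbb{E}\big[d^p_{\Delta}(\hat G_n,G^*_{\mathbb{Q}})\big]<\infty,$$ where $\hat G_n:=\arg\min_{G\in\mathcal{N}_n}R_n(G)$ with $\mathcal{N}_n=\mathcal{N}_{C_1'L_0(\tau_n^{-1}),\,C_2's_0(\tau_n^{-1}),\,C_3'c_0(\tau_n^{-1})}$.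
   Context: **Classification setup.** $(X_i,Y_i)_{i=1}^n$ are i.i.d. with distribution $\mathbb{Q}$ on $\mathbb{R}^d\times\{0,1\}$ (here supported on $[0,1]^d\times\{0,1\}$); $\mathbb{E}$ is expectation under this sampling. $\mathbb{Q}_X$ is the marginal of $X$, $f_{\mathbb{Q}}(x):=\mathbb{Q}(Y=1\mid X=x)$ (a fixed version), and the Bayes rule is $G^*_{\mathbb{Q}}:=\{x : f_{\mathbb{Q}}(x)\ge \tfrac12\}$. For measurable sets $G_1,G_2$, $d_{f_{\mathbb{Q}}}(G_1,G_2):=\int_{G_1\Delta G_2}|2f_{\mathbb{Q}}(x)-1|\,\mathbb{Q}_X(\mathrm{d}x)$ and $d_\Delta(G_1,G_2):=\mathbb{Q}_X(G_1\Delta G_2)$; powers are $d^p(\cdot,\cdot)=(d(\cdot,\cdot))^p$. The empirical risk is $R_n(G):=\frac1n\sum_{i=1}^n \mathbf{1}\big(Y_i\ne \mathbf{1}(X_i\in G)\big)$; $\arg\min$ denotes a minimizer over the finite class. **Neural networks.** A ReLU network with $L$ (hidden) layers and dimensions $m_0,\dots,m_{L+1}$ is a sequence $\Phi=(W_1,b_1,\dots,W_L,b_L,W_{L+1})$ with $W_s\in\mathbb{R}^{m_s\times m_{s-1}}$, $b_s\in\mathbb{R}^{m_s}$. Its realization is $R(\Phi)(x)=W_{L+1}\sigma_{b_L}W_L\cdots W_2\sigma_{b_1}W_1x$, where $\sigma_b(y)=(\sigma(y_1-b_1),\dots,\sigma(y_k-b_k))$ and $\sigma(t)=\max\{t,0\}$;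 for $L=0$, $R(\Phi)(x)=W_1x$. The domain is $[0,1]^{m_0}$. The weights of $\Phi$ are all entries of the $W_s$ and $b_s$; the sparsity is the number of nonzero weights. For $c\in\mathbb{N}$, $\mathcal{W}_c:=\{k2^{-c} : k\in\{-2^c,-2^c+1,\dots,2^c\}\}$. $\mathcal{N}_{L_0,s_0,c}$ is the collection of all sets $\{x\in[0,1]^d : R(\Phi)(x)=1\}$ where $\Phi$ is a ReLU network with input dimension $d$, output dimension $1$, at most $L_0$ layers, sparsity at most $s_0$, and all weights in $\mathcal{W}_c$ (hidden dimensions arbitrary; $L_0$, $s_0$ may be real numbers). **Hölder classes.** For $\beta>0$ let $m$ be the largest integer $k\ge0$ with $k<\beta$ and $\omega:=\beta-m$. For continuous $f:[0,1]^s\to\mathbb{R}$, $\|f\|_{\mathcal{C}^\beta}:=\sum_{|\alpha|\le m}\|\partial^\alpha f\|_\infty+\sum_{|\alpha|=m}\sup_{x\ne y}\frac{|\partial^\alpha f(x)-\partial^\alpha f(y)|}{\|x-y\|_\infty^\omega}$, and $\mathcal{F}_{\beta,B,s}:=\{f : \|f\|_{\mathcal{C}^\beta}\le B\}$. For $\beta>0$, $\mathcal{H}_{\beta,B}:=\{g\in\mathcal{F}_{\beta,B,1} : \partial^\alpha g(0)=0 \text{ for all integers } 0\le\alpha<\beta\}$. **The class $\mathcal{K}^{\mathcal{F}}_{\mathbb{Q},\beta,B,\epsilon_1,\epsilon_2,r,d}$.** For $x\in\mathbb{R}^d$, $x_{-j}$ denotes $x$ with the $j$-th coordinate removed; $\lambda$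 is Lebesgue measure. Given $\beta\ge0$, $B>0$, $d\ge2$, $r\in\mathbb{N}$, $\epsilon_1,\epsilon_2>0$, a probability measure $\mathbb{Q}$ on $[0,1]^d\times\{0,1\}$, and a class $\mathcal{F}$ of functions $[0,1]^{d-1}\to\mathbb{R}$, it is the class of all $H=H_1\cup\dots\cup H_u\subseteq[0,1]^d$ with $u\in\{0,\dots,r\}$ such that for $\nu=1,\dots,u$ there exist $(j_\nu,\iota_\nu)\in\{1,\dots,d\}\times\{-1,1\}$, $\gamma_\nu\in\mathcal{F}$ and $D_\nu=\prod_{i=1}^d[a_i^\nu,b_i^\nu]$ with $0\le a_i^\nu<b_i^\nu\le1$ satisfying: 1. $H_\nu=D_\nu\cap\{x\in[0,1]^d : \iota_\nu x_{j_\nu}\le\gamma_\nu(x_{-j_\nu})\}$ for all $\nu$. 2. $\lambda(D_{\nu_1}\cap D_{\nu_2})=0$ for $\nu_1\ne\nu_2$. 3. If $\beta>0$: for every $\nu$ and every $x\in D_\nu\cap\partial H$ (with $\partial H$ the topological boundary of $H$ as a subset of $[0,1]^d$) there is $g_{\nu,x}\in\mathcal{H}_{\beta,B}$ such that for all $y_{j_\nu}\in[\max\{0,x_{j_\nu}-\epsilon_1\},\min\{1,x_{j_\nu}+\epsilon_1\}]$, with $y=(x_1,\dots,x_{j_\nu-1},y_{j_\nu},x_{j_\nu+1},\dots,x_d)$, one has $|2f_{\mathbb{Q}}(y)-1|\le g_{\nu,x}(|y_{j_\nu}-x_{j_\nu}|)$. 4. $b^\nu_{j_\nu}-a^\nu_{j_\nu}\ge\epsilon_2$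 for all $\nu$. *)

(* Defs.v *)
From HB Require Import structures.
From mathcomp Require Import all_boot all_order all_algebra.
From mathcomp Require Import all_classical all_reals all_analysis.

Set Implicit Arguments.
Unset Strict Implicit.
Unset Printing Implicit Defensive.

Import Order.TTheory GRing.Theory Num.Theory.
Import numFieldNormedType.Exports.

Local Open Scope classical_set_scope.
Local Open Scope ring_scope.

(* Points of R^n are column vectors 'cV[R]_n, so that weight matrices act by
   [*m]; the library norm on them is the maximum norm.  The library has no
   sigma-algebra on matrices: we use the one generated by the coordinates. *)

Definition cV_display : measure_display.
Proof. exact: default_measure_display. Qed.

Section measurable_cV.
Variables (R : realType) (n : nat).

Let coors : 'I_n -> 'cV[R]_n -> measurableTypeR R := fun i x => x i 0.

Let cV_set0 : g_sigma_preimage coors set0.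
Proof. exact: sigma_algebra0. Qed.

Let cV_setC A : g_sigma_preimage coors A -> g_sigma_preimage coors (~` A).
Proof. exact: sigma_algebraC. Qed.

Let cV_bigcup (F : (set 'cV[R]_n)^nat) :
  (forall i, g_sigma_preimage coors (F i)) ->
  g_sigma_preimage coors (\bigcup_i (F i)).
Proof. exact: sigma_algebra_bigcup. Qed.

HB.instance Definition _ := @isMeasurable.Build cV_display
  'cV[R]_n (g_sigma_preimage coors) cV_set0 cV_setC cV_bigcup.

End measurable_cV.

Lemma measurable_coord (R : realType) n (i : 'I_n) :
  measurable_fun [set: 'cV[R]_n] (fun x => x i 0 : measurableTypeR R).
Proof.
move=> _ Y mY; rewrite setTI; apply: sub_sigma_algebra => /=.
rewrite -bigcup_seq/=; exists i => /=; first by rewrite mem_index_enum.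
by exists Y => //; rewrite setTI.
Qed.

Lemma measurable_fun_cVP d (T : measurableType d) (R : realType) n
    (f : T -> 'cV[R]_n) :
  (forall i, measurable_fun [set: T] (fun t => f t i 0 : measurableTypeR R)) ->
  measurable_fun [set: T] f.
Proof.
move=> mf _ A mA; rewrite setTI.
suff: preimage_set_system [set: T] f (@measurable _ 'cV[R]_n) `<=` measurable.
  by apply; exists A => //; rewrite setTI.
rewrite [X in preimage_set_system _ _ X]/(measurable) /=.
rewrite -(@g_sigma_preimage_comp _ _ _ _
  (fun i (x : 'cV[R]_n) => x i 0 : measurableTypeR R)).
apply: smallest_sub; first exact: sigma_algebra_measurable.
rewrite -bigcup_seq; apply: bigcup_sub => i _ _ [B mB <-].
exact: mf.
Qed.

Section lebesgue_cV.
Variable R : realType.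

Definition cV_cons n (p : measurableTypeR R * 'cV[R]_n) : 'cV[R]_n.+1 :=
  col_mx (p.1)%:M p.2.

Definition cV_uncons n (x : 'cV[R]_n.+1) : measurableTypeR R * 'cV[R]_n :=
  (x 0 0, dsubmx (x : 'cV[R]_(1 + n))).

Lemma cV_cons0 n p : @cV_cons n p 0 0 = p.1.
Proof.
rewrite /cV_cons mxE; case: splitP => // j _.
by rewrite ord1 mxE mulr1n.
Qed.

Lemma cV_consS n p i : @cV_cons n p (lift ord0 i) 0 = p.2 i 0.
Proof.
rewrite /cV_cons mxE; case: splitP => [[[]]//|k] /= [] ik.
by congr (_ _ _); apply/val_inj.
Qed.

Lemma cV_consK n : cancel (@cV_cons n) (@cV_uncons n).
Proof.
by move=> [a y]; rewrite /cV_uncons cV_cons0 /cV_cons /= col_mxKd.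
Qed.

Lemma measurable_cV_cons n : measurable_fun [set: _] (@cV_cons n).
Proof.
apply: measurable_fun_cVP => i; case: (unliftP ord0 i) => [j ->|->].
  rewrite (_ : (fun t => _) = (fun x : 'cV[R]_n => x j 0) \o snd); last first.
    by apply/funext => p; rewrite cV_consS.
  by apply: measurableT_comp; [exact: measurable_coord|exact: measurable_snd].
rewrite (_ : (fun t => _) = fst); first exact: measurable_fst.
by apply/funext => p; exact: cV_cons0.
Qed.

Lemma measurable_cV_uncons n : measurable_fun [set: _] (@cV_uncons n).
Proof.
apply: measurable_fun_pair; first exact: measurable_coord.
apply: measurable_fun_cVP => i.
rewrite (_ : (fun t => _) = fun x : 'cV[R]_n.+1 => x (rshift 1 i) 0).
  exact: measurable_coord.
by apply/funext => x; rewrite mxE.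
Qed.

Section lebesgue_cV_step.
Variables (n : nat) (mu : {sigma_finite_measure set 'cV[R]_n -> \bar R}).

Definition lebesgue_step : set 'cV[R]_n.+1 -> \bar R :=
  pushforward (@lebesgue_measure R \x mu)%E (@cV_cons n).

Let step0 : lebesgue_step set0 = 0%E.
Proof. by rewrite /lebesgue_step /pushforward preimage_set0 measure0. Qed.

Let step_ge0 A : (0 <= lebesgue_step A)%E.
Proof. by rewrite /lebesgue_step /pushforward measure_ge0. Qed.

Let step_sigma_additive : semi_sigma_additive lebesgue_step.
Proof.
move=> F mF tF mUF; rewrite /lebesgue_step /pushforward preimage_bigcup.
apply: measure_semi_sigma_additive.
- by move=> k; rewrite -[X in measurable X]setTI; exact: measurable_cV_cons.
- apply/trivIsetP => /= i j _ _ ij; rewrite -preimage_setI.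
  by move/trivIsetP : tF => /(_ _ _ _ _ ij) ->//; rewrite preimage_set0.
- rewrite -preimage_bigcup -[X in measurable X]setTI.
  exact: measurable_cV_cons.
Qed.

HB.instance Definition _ := isMeasure.Build _ _ _ lebesgue_step
  step0 step_ge0 step_sigma_additive.

Let step_sigma_finite : sigma_finite setT lebesgue_step.
Proof.
have /sigma_finiteP[F [TF ndF Foo]] := sigma_finiteT (@lebesgue_measure R).
have /sigma_finiteP[G [TG ndG Goo]] := sigma_finiteT mu.
exists (fun k => @cV_uncons n @^-1` (F k `*` G k)).
  rewrite -preimage_bigcup (_ : \bigcup_i _ = setT) ?preimage_setT//.
  rewrite -setXTT TF TG predeqE => -[x y]; split.
    by move=> [k _ []/= ? ?]; split; exists k.
  move=> [/= [i _ Fix] [k _ Gky]]; exists (maxn i k) => //; split.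
  - by move: x Fix; exact/subsetPset/ndF/leq_maxl.
  - by move: y Gky; exact/subsetPset/ndG/leq_maxr.
move=> k; have [mF Fk] := Foo k; have [mG Gk] := Goo k; split.
  rewrite -[X in measurable X]setTI; apply: measurable_cV_uncons => //.
  exact: measurableX.
rewrite /lebesgue_step /pushforward -comp_preimage.
rewrite (_ : _ \o _ = idfun) ?preimage_id; last first.
  by apply/funext => p /=; rewrite cV_consK.
by rewrite product_measure1E// lte_mul_pinfty// ge0_fin_numE.
Qed.

HB.instance Definition _ := Measure_isSigmaFinite.Build _ _ _ lebesgue_step
  step_sigma_finite.

End lebesgue_cV_step.

(* Lebesgue measure on R^n as the n-fold product of Lebesgue measure on R. *)
Fixpoint lebesgue_cV n : {sigma_finite_measure set 'cV[R]_n -> \bar R} :=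
  match n return {sigma_finite_measure set 'cV[R]_n -> \bar R} with
  | 0%N => \d_ (0 : 'cV[R]_0)
  | n'.+1 => lebesgue_step (lebesgue_cV n')
  end.

(* Sanity check: the measure of a box is the product of its side lengths. *)
Lemma lebesgue_cV_box n (a b : 'I_n -> R) : (forall i, a i <= b i) ->
  lebesgue_cV n [set x : 'cV[R]_n | forall i, a i <= x i 0 <= b i] =
  (\prod_(i < n) (b i - a i))%:E.
Proof.
elim: n a b => [|n IH] a b ab /=.
  rewrite big_ord0 /dirac /= indicE.
  by rewrite mem_set// => -[].
rewrite /lebesgue_step /pushforward.
have -> : @cV_cons n @^-1` [set x : 'cV[R]_n.+1 | forall i, a i <= x i 0 <= b i] =
    `[a ord0, b ord0] `*`
    [set x : 'cV[R]_n | forall i, a (lift ord0 i) <= x i 0 <= b (lift ord0 i)].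
  apply/seteqP; split => [p h|p [h0 h1] i] /=.
    split=> [|i]; first by rewrite /= in_itv /= -cV_cons0; exact: h.
    by rewrite -cV_consS; exact: h.
  case: (unliftP ord0 i) => [j ->|->]; first by rewrite cV_consS; exact: h1.
  by rewrite cV_cons0; move: h0; rewrite /= in_itv.
rewrite product_measure1E//.
  rewrite IH//.
  rewrite big_ord_recl EFinM; congr (_ * _)%E.
  apply: (etrans (lebesgue_measure_itv `[a ord0, b ord0])).
  rewrite /= lte_fin EFinB.
  by have := ab ord0; case: ltgtP => // -> _; rewrite subee.
rewrite (_ : [set x | _] = \bigcap_(i in [set: 'I_n])
    ((fun x : 'cV[R]_n => x i 0 : measurableTypeR R) @^-1`
      `[a (lift ord0 i), b (lift ord0 i)])); last first.
  apply/seteqP; split => [x h i _|x h i] /=; first by rewrite in_itv; exact: h.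
  by have := h i I; rewrite /= in_itv.
apply: fin_bigcap_measurable => // i _.
by rewrite -[X in measurable X]setTI; exact: measurable_coord.
Qed.

End lebesgue_cV.

(* Law of an i.i.d. sample of size n drawn from P. *)
Section iid_sample.
Context d (T : measurableType d) (R : realType).

Definition tuple_cons n (p : T * n.-tuple T) : n.+1.-tuple T :=
  [the n.+1.-tuple T of p.1 :: p.2].

Lemma measurable_tuple_cons n : measurable_fun [set: _] (@tuple_cons n).
Proof.
by apply: measurable_cons; [exact: measurable_fst|exact: measurable_snd].
Qed.

HB.instance Definition _ n := isMeasurableFun.Build _ _ _ _ (@tuple_cons n)
  (@measurable_tuple_cons n).

Fixpoint iid (P : probability T R) n : probability (n.-tuple T) R :=
  match n return probability (n.-tuple T) R with
  | 0%N => \d_ ([tuple] : 0.-tuple T)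
  | n'.+1 => distribution (P \x iid P n')%E (@tuple_cons n')
  end.

End iid_sample.

Section defs.
Variable R : realType.

Definition cube n : set 'cV[R]_n := [set x | forall i, 0 <= x i 0 <= 1].

Section networks.

(* [relu_net m k] : networks with input dimension m and output dimension k;
   [ReluLayer W_1 b_1 (... (ReluOut W_(L+1)))] encodes (W_1,b_1,...,W_(L+1)). *)
Inductive relu_net (k : nat) : nat -> Type :=
| ReluOut m of 'M[R]_(k, m) : relu_net k m
| ReluLayer m m' of 'M[R]_(m', m) & 'cV[R]_m' & relu_net k m' : relu_net k m.

Fixpoint realization k m (Phi : relu_net k m) : 'cV[R]_m -> 'cV[R]_k :=
  match Phi with
  | ReluOut _ W => fun x => W *m x
  | ReluLayer _ _ W b Psi => fun x =>
      realization Psi (map_mx (Num.max 0) (W *m x - b))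
  end.

Fixpoint nlayers k m (Phi : relu_net k m) : nat :=
  if Phi is ReluLayer _ _ _ _ Psi then (nlayers Psi).+1 else 0%N.

Definition nnz m n (A : 'M[R]_(m, n)) : nat :=
  #|[set ij : 'I_m * 'I_n | A ij.1 ij.2 != 0]|.

Fixpoint sparsity k m (Phi : relu_net k m) : nat :=
  match Phi with
  | ReluOut _ W => nnz W
  | ReluLayer _ _ W b Psi => (nnz W + nnz b + sparsity Psi)%N
  end.

Fixpoint weights_in (S : set R) k m (Phi : relu_net k m) : Prop :=
  match Phi with
  | ReluOut _ W => forall i j, S (W i j)
  | ReluLayer _ _ W b Psi =>
      [/\ forall i j, S (W i j), forall i j, S (b i j) & weights_in S Psi]
  end.

Definition weight_grid (c : nat) : set R :=
  [set w | exists2 k : int, `|k| <= 2 ^+ c & w = k%:~R / 2 ^+ c].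

Definition net_sets d (L0 s0 : R) (c : nat) : set (set 'cV[R]_d) :=
  [set G | exists Phi : relu_net 1 d,
    [/\ (nlayers Phi)%:R <= L0, (sparsity Phi)%:R <= s0,
        weights_in (weight_grid c) Phi &
        G = [set x | cube x /\ realization Phi x 0 0 = 1]]].

End networks.

Section holder.
Variable s : nat.
Implicit Types f : 'cV[R]_s -> R.

(* Difference quotients in direction i restricted to increments h <> 0 that
   stay in the cube: derivatives are one-sided on the boundary, and only the
   values of f on the cube matter. *)
Definition pdiffq (i : 'I_s) f (x : 'cV[R]_s) : set_system R :=
  (fun h : R => h^-1 * (f (x + h *: delta_mx i 0) - f x)) @
    within [set h | cube (x + h *: delta_mx i 0)] 0^'.

Definition pderiv (i : 'I_s) f (x : 'cV[R]_s) : R := lim (pdiffq i f x).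

Definition smooth_cube (m : nat) f : Prop := forall w : seq 'I_s,
  let g := foldr pderiv f w in
  ((size w <= m)%N -> {within @cube s, continuous g}) /\
  ((size w < m)%N -> forall i x, cube x -> cvg (pdiffq i g x)).

Definition multi_deriv (alpha : 'I_s -> nat) f : 'cV[R]_s -> R :=
  foldr (fun i g => iter (alpha i) (pderiv i) g) f (enum 'I_s).

Definition sup_norm f : \bar R := ereal_sup [set `|f x|%:E | x in @cube s].

Definition holder_seminorm (omega : R) f : \bar R :=
  ereal_sup [set (`|f xy.1 - f xy.2| / `|xy.1 - xy.2| `^ omega)%:E
    | xy in [set xy | [/\ cube xy.1, cube xy.2 & xy.1 != xy.2]]].

(* For beta > 0, the largest integer k >= 0 with k < beta. *)
Definition holder_order (beta : R) : nat := (`|Num.ceil beta|%N).-1.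

(* Every multi-index of order at most m has entries below m.+1. *)
Definition holder_norm (beta : R) f : \bar R :=
  let m := holder_order beta in
  (\sum_(alpha : {ffun 'I_s -> 'I_m.+1} | (\sum_i alpha i <= m)%N)
     sup_norm (multi_deriv (fun i => alpha i) f) +
   \sum_(alpha : {ffun 'I_s -> 'I_m.+1} | (\sum_i alpha i == m)%N)
     holder_seminorm (beta - m%:R) (multi_deriv (fun i => alpha i) f))%E.

Definition holder_class (beta B : R) : set ('cV[R]_s -> R) :=
  [set f | smooth_cube (holder_order beta) f /\
           (holder_norm beta f <= B%:E)%E].

End holder.

Definition holder_class0 (beta B : R) : set ('cV[R]_1 -> R) :=
  [set g | holder_class beta B g /\
    forall k : nat, k%:R < beta -> iter k (pderiv 0) g 0 = 0].

HB.instance Definition _ d1 d2 (T1 : measurableType d1)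
    (T2 : measurableType d2) :=
  isMeasurableFun.Build _ _ _ _ (@fst T1 T2) measurable_fst.

Section setting.
Variable d : nat.
Local Notation point := 'cV[R]_d.
Local Notation obs := ('cV[R]_d * bool)%type.
Implicit Types (G H : set point) (f : point -> R) (Q : probability obs R).

Definition set_coord (j : 'I_d) (x : point) (t : R) : point :=
  \col_i (if i == j then t else x i 0).

(* Topological boundary of H relative to the cube. *)
Definition cube_boundary H : set point :=
  @cube d `&` closure (@cube d `&` H) `&` closure (@cube d `\` H).

Definition box (a b : 'I_d -> R) : set point :=
  [set x | forall i, a i <= x i 0 <= b i].

(* iota and the index nu range over {-1,1} and 'I_u; x_{-j} is [row' j x]. *)
Definition piecewise_class f (beta B eps1 eps2 : R) (r : nat)
    (F : set ('cV[R]_d.-1 -> R)) : set (set point) :=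
  [set H | exists (u : nat) (j : 'I_u -> 'I_d) (iota : 'I_u -> R)
      (gamma : 'I_u -> 'cV[R]_d.-1 -> R) (a b : 'I_u -> 'I_d -> R)
      (Hnu : 'I_u -> set point),
    [/\ (u <= r)%N,
        forall nu, [/\ iota nu = 1 \/ iota nu = -1, F (gamma nu) &
          forall i, [/\ 0 <= a nu i, a nu i < b nu i & b nu i <= 1]],
        H = \bigcup_nu Hnu nu &
        [/\
          forall nu, Hnu nu = box (a nu) (b nu) `&`
            [set x | cube x /\
               iota nu * x (j nu) 0 <= gamma nu (row' (j nu) x)],
          forall nu1 nu2, nu1 != nu2 ->
            lebesgue_cV R d (box (a nu1) (b nu1) `&` box (a nu2) (b nu2)) = 0%E,
          0 < beta -> forall nu x,
            (box (a nu) (b nu) `&` cube_boundary H) x ->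
            exists2 g, holder_class0 beta B g &
              forall t : R,
                Num.max 0 (x (j nu) 0 - eps1) <= t
                  <= Num.min 1 (x (j nu) 0 + eps1) ->
                `|2 * f (set_coord (j nu) x t) - 1| <=
                  g (const_mx `|t - x (j nu) 0|) &
          forall nu, eps2 <= b nu (j nu) - a nu (j nu)]]].

Definition marginalX Q : probability point R :=
  distribution Q (@fst point bool).

(* f is a version of x |-> Q(Y = 1 | X = x). *)
Definition is_regression Q f : Prop :=
  (marginalX Q).-integrable setT (EFin \o f) /\
  forall A : set point, measurable A ->
    (\int[marginalX Q]_(x in A) (f x)%:E)%E = Q (A `*` [set true]).

Definition density_bounded Q (M : R) : Prop :=
  exists h : point -> R, [/\ measurable_fun setT h,
    forall x, 0 <= h x <= M &
    forall A : set point, measurable A ->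
      marginalX Q A = (\int[lebesgue_cV R d]_(x in A) (h x)%:E)%E].

Definition bayes_rule f : set point := [set x | cube x /\ 2^-1 <= f x].

Definition d_f Q f G1 G2 : R :=
  \int[marginalX Q]_(x in G1 `+` G2) `|2 * f x - 1|.

Definition d_Delta Q G1 G2 : R := fine (marginalX Q (G1 `+` G2)).

Definition empirical_risk n (z : n.-tuple obs) G : R :=
  n%:R^-1 * \sum_(i < n) ((tnth z i).2 != ((tnth z i).1 \in G))%:R.

Definition is_argmin (NN : set (set point)) (risk : set point -> R) G : Prop :=
  NN G /\ forall G', NN G' -> risk G <= risk G'.

End setting.

Definition L0 (a1 eps : R) : R := a1 * (Num.ceil (ln eps^-1))%:~R.

Definition s0 (a2 rho eps : R) : R := a2 * eps `^ (- rho) * ln eps^-1.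

(* For 0 < eps <= 1 the ceiling is a nonnegative integer, so that [absz] is
   only a coercion to nat. *)
Definition c0 (a3 a4 : nat) (eps : R) : nat :=
  (a3 + a4 * `|Num.ceil (ln eps^-1)|)%N.

Definition tau (kappa rho : R) (n : nat) : R :=
  n%:R `^ (2 * kappa + rho - 1)^-1 / (ln n%:R) `^ (2 / rho).

End defs.

(* Main.v *)
(** Put [eps := 1 / tau n].
    Approximation: after rounding the boxes and replacing each boundary function
    by an [eps]-accurate network, the union of the pieces is again a network set
    [G'], realized as the level set [1 - min_nu e_nu = 1], where [e_nu >= 0] sums
    the violations of the constraints of piece [nu].  Up to thin strips around
    the faces of the boxes, [G'] and the Bayes rule differ only at distance
    [O(eps)] from the boundary of the latter, along the distinguished coordinate;
    there the margin is [O(eps ^ beta1)], so [d_f (G', G* ) = O(eps ^ kappa)].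
    Entropy: a network with [L] layers and [s] nonzero weights on the grid is a
    program of [s + L] instructions over an alphabet polynomial in [s] and in
    the size of the grid, so the class contains at most
    [exp (O(n * eps ^ (2 kappa - 1)))] sets.
    Concentration: if [D = d_f (G, G* )] exceeds a large multiple of
    [eps ^ kappa], then [G] beats [G'] empirically with probability at most
    [exp (- c * n * D ^ 2 / V)], where by (c) the variance [V] of the loss
    difference is [O(D ^ (1 / kappa))].  A union bound shows that the minimizer
    is within [O(eps ^ kappa)] of [G*] outside an event of probability
    [exp (- n ^ delta)], which no power of [tau n] compensates. *)

Require Import Defs.
From mathcomp Require Import all_boot all_order all_algebra.
From mathcomp Require Import all_classical all_reals all_analysis.
From mathcomp Require Import measurable_realfun.
From mathcomp Require Import zify ring lra.
Import Order.TTheory GRing.Theory Num.Theory.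
Import numFieldNormedType.Exports.
Local Open Scope classical_set_scope.
Local Open Scope ring_scope.
Set Implicit Arguments.
Unset Strict Implicit.
Unset Printing Implicit Defensive.

(** * Lebesgue measure and fibres *)

(** The exponents of [tau] come from one balance. Put [theta = 1/(2 kappa + rho - 1)]. A program has
    [O(eps^-rho log n)] instructions, each contributing [O(log n)] to the log-cardinality, which is
    therefore [O(eps^-rho log^2 n)]. The logarithm in [tau] turns this into [O(n^(theta rho))], and
    [n^(theta rho)] is at most [n eps^(2 kappa - 1)], the order of the Chernoff exponent when [D] is
    of order [eps^kappa]. A large constant in front of [eps^kappa] then wins the union bound, and
    this constant does not involve [p]. Two obstacles shape the construction. Grid weights lie in
    [[-1, 1]], so constants must come from biases and a threshold test may be contracted but not
    stretched. And the margin condition speaks only about lines through boundary points of the Bayes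
    rule, so every misclassified point away from the faces has to be traced back to a threshold
    lying strictly inside its box. *)

Lemma measurable_box (R : realType) n (a b : 'I_n -> R) :
  measurable (box a b).
Proof.
rewrite (_ : box a b = \bigcap_(i in [set: 'I_n])
    ((fun x : 'cV[R]_n => x i 0 : measurableTypeR R) @^-1` `[a i, b i])).
  apply: fin_bigcap_measurable => // i _.
  by rewrite -[X in measurable X]setTI; exact: measurable_coord.
apply/seteqP; split => [x h i _|x h i] /=; first by rewrite in_itv; exact: h.
by have := h i I; rewrite /= in_itv.
Qed.

Lemma cubeE (R : realType) n :
  @cube R n = box (fun=> 0) (fun=> 1).
Proof. by []. Qed.

Lemma measurable_cube (R : realType) n : measurable (@cube R n).
Proof. by rewrite cubeE; exact: measurable_box. Qed.

Lemma lebesgue_cube (R : realType) n : lebesgue_cV R n (@cube R n) = 1%E.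
Proof.
rewrite cubeE lebesgue_cV_box // big1 // => i _.
by rewrite subr0.
Qed.

Lemma product_measure12 d1 d2 (T1 : measurableType d1) (T2 : measurableType d2)
    (R : realType) (m1 : {sigma_finite_measure set T1 -> \bar R})
    (m2 : {sigma_finite_measure set T2 -> \bar R}) (X : set (T1 * T2)) :
  measurable X -> (m1 \x m2)%E X = (m1 \x^ m2)%E X.
Proof.
move=> mX; apply: (product_measure_unique (m' := (m1 \x^ m2)%E)) => // A B mA mB.
exact: product_measure2E.
Qed.

Lemma set_coord_cons0 (R : realType) n (p : measurableTypeR R * 'cV[R]_n) t :
  set_coord ord0 (cV_cons p) t = cV_cons (t, p.2).
Proof.
apply/matrixP => i k; rewrite ord1 mxE; case: (unliftP ord0 i) => [l|] ->.
  by rewrite !cV_consS.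
by rewrite eqxx cV_cons0.
Qed.

Lemma set_coord_consS (R : realType) n (p : measurableTypeR R * 'cV[R]_n) i t :
  set_coord (lift ord0 i) (cV_cons p) t = cV_cons (p.1, set_coord i p.2 t).
Proof.
apply/matrixP => l k; rewrite ord1 mxE; case: (unliftP ord0 l) => [l'|] ->.
  by rewrite !cV_consS mxE (inj_eq (@lift_inj _ _)).
by rewrite !cV_cons0.
Qed.

Lemma cube_cons (R : realType) n (p : measurableTypeR R * 'cV[R]_n) :
  cube (cV_cons p) -> 0 <= (p.1 : R) <= 1 /\ cube p.2.
Proof.
move=> h; split; first by rewrite -(cV_cons0 p).
by move=> i; rewrite -(cV_consS p).
Qed.

(** Cavalieri's principle. [lebesgue_cV] splits off the first coordinate: if [j] lies in the tail,
    the induction hypothesis applies to each section; if [j] is the first coordinate, the order of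
    integration is swapped. The remaining coordinates contribute a factor 1 because [A] lies in the
    cube. *)
Lemma lebesgue_cV_fibre_le (R : realType) n (j : 'I_n) (A : set 'cV[R]_n) (w : R) :
  measurable A -> A `<=` @cube R n ->
  (forall y, (lebesgue_measure [set t : R | A (set_coord j y t)] <= w%:E)%E) ->
  (lebesgue_cV R n A <= w%:E)%E.
Proof.
elim: n j A => [[]//|n IH] j A mA Acube Aw.
have w0 : 0 <= w by have := le_trans (measure_ge0 _ _) (Aw 0); rewrite lee_fin.
have mA' : measurable (@cV_cons R n @^-1` A).
  by rewrite -[X in measurable X]setTI; exact: measurable_cV_cons.
rewrite [leLHS]/= /lebesgue_step /pushforward.
case: (unliftP ord0 j) => [i|] jE.
  rewrite /product_measure1.
  apply: (@le_trans _ _ (\int[@lebesgue_measure R]_t (w%:E * (\1_(`[0, 1]%classic : set R) t)%:E))%E).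
    apply: ge0_le_integral => //=.
    - exact: measurable_fun_xsection.
    - apply: measurable_funeM; apply/measurable_EFinP.
      exact: measurable_indic.
    move=> t _; rewrite indicE; case: (boolP (_ \in _)) => tI /=; last first.
      rewrite mule0; suff -> : xsection (@cV_cons R n @^-1` A) t = set0 by rewrite measure0.
      apply/seteqP; split => // y /=; rewrite /xsection/= inE => /Acube/cube_cons[/=].
      by move: tI; rewrite notin_setE/= in_itv/= => h1 h2 _; apply: h1.
    rewrite mule1; apply: (IH i).
    - exact: measurable_xsection.
    - by move=> y /=; rewrite /xsection/= inE => /Acube/cube_cons[/=].
    move=> y; apply: le_trans (Aw (cV_cons (t : measurableTypeR R, y))).
    rewrite jE le_eqVlt; apply/orP; left; apply/eqP; congr (_ _).
    by apply/seteqP; split => s; rewrite /xsection /= inE /= set_coord_consS.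
  rewrite ge0_integralZl//=; last first.
      by apply/measurable_EFinP; exact: measurable_indic.
  by rewrite integral_indic// setIT/= lebesgue_measure_itv/= lte_fin ltr01 oppr0 adde0 mule1.
rewrite product_measure12 // /product_measure2.
apply: (@le_trans _ _ (\int[lebesgue_cV R n]_t (w%:E * (\1_(@cube R n) t)%:E))%E).
  apply: ge0_le_integral => //=.
  - exact: measurable_fun_ysection.
  - apply: measurable_funeM; apply/measurable_EFinP.
    apply: measurable_indic; exact: measurable_cube.
  move=> y _; rewrite indicE; case: (boolP (_ \in _)) => yI /=; last first.
    rewrite mule0; suff -> : ysection (@cV_cons R n @^-1` A) y = set0 by rewrite measure0.
    apply/seteqP; split => // t /=; rewrite /ysection/= inE => /Acube/cube_cons[/=].
    by move: yI; rewrite notin_setE/= => h1 _ h2; apply: h1.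
  rewrite mule1; apply: le_trans (Aw (cV_cons (0 : measurableTypeR R, y))).
  rewrite jE le_eqVlt; apply/orP; left; apply/eqP; congr (_ _).
  by apply/seteqP; split => s; rewrite /ysection /= inE /= set_coord_cons0.
rewrite ge0_integralZl//=; last first.
    apply/measurable_EFinP; apply: measurable_indic; exact: measurable_cube.
rewrite integral_indic // ?setIT; [|exact: measurable_cube..].
rewrite [X in (_ * X)%E](_ : _ = 1%E) ?mule1 //; exact: lebesgue_cube.
Qed.

(** * A Chernoff bound for i.i.d. samples *)

(* The integrand need not be measurable: its integral is a lower integral. *)
Lemma ge0_le_integral_nomeas d (T : measurableType d) (R : realType)
    (mu : {measure set T -> \bar R}) (f g : T -> \bar R) :
  (forall x, 0 <= f x)%E -> (forall x, f x <= g x)%E ->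
  (\int[mu]_x f x <= \int[mu]_x g x)%E.
Proof.
move=> f0 fg; rewrite !ge0_integralTE //; last first.
  by move=> x; exact: le_trans (fg x).
by apply: ereal_sup_le => _ [h hf <-]; exists h => // x; exact: le_trans (fg x).
Qed.

Section iid_chernoff.
Context d (T : measurableType d) (R : realType) (P : probability T R).

(** Independence for product functionals: [iid] is an iterated product, so Tonelli peels off one
    factor at a time. *)
Lemma integral_iid_prod n (phi : T -> R) (I : R) :
  measurable_fun setT phi -> (forall x, 0 <= phi x) ->
  (\int[P]_x (phi x)%:E = I%:E)%E ->
  (\int[iid P n]_z (\prod_(i < n) phi (tnth z i))%:E = (I ^+ n)%:E)%E.
Proof.
move=> mphi phi0 PI.
have mprod k : measurable_fun [set: k.-tuple T]
    (fun z => (\prod_(i < k) phi (tnth z i))%:E).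
  apply/measurable_EFinP; apply: measurable_prod => i _.
  apply: measurableT_comp => //; exact: measurable_tnth.
have prod0 k (z : k.-tuple T) : 0 <= \prod_(i < k) phi (tnth z i).
  by apply: prodr_ge0 => i _.
elim: n => [|n IH].
  rewrite /= integral_dirac //=; last exact: mprod.
  by rewrite /dirac indicT mul1e big_ord0 expr0.
etransitivity.
  apply: (ge0_integral_pushforward (@measurable_tuple_cons _ T n)) => //.
    exact: mprod.
  by move=> z _; rewrite lee_fin.
rewrite preimage_setT.
pose h (p : T * n.-tuple T) : \bar R :=
  ((phi p.1)%:E * (\prod_(i < n) phi (tnth p.2 i))%:E)%E.
rewrite (_ : _ \o _ = h); last first.
  apply/funext => -[x z]; rewrite /h /= big_ord_recl EFinM tnth0; congr (_ * (_)%:E)%E.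
  by apply: eq_bigr => i _; rewrite tnthS.
have mh : measurable_fun setT h.
  apply: emeasurable_funM.
    by apply/measurable_EFinP; exact: (measurableT_comp mphi measurable_fst).
  exact: (measurableT_comp (mprod n) measurable_snd).
rewrite (@fubini_tonelli1 _ _ _ _ _ P (iid P n) h) //; last first.
  move=> [x z]; rewrite /h /= -EFinM lee_fin. exact: mulr_ge0 (phi0 x) (prod0 n z).
rewrite (eq_integral (fun x => (I ^+ n)%:E * (phi x)%:E)%E); last first.
  move=> x _; rewrite /fubini_F /h /= ge0_integralZl //.
  - by rewrite IH muleC.
  - exact: mprod.
  - by move=> z _; rewrite lee_fin prod0.
  - by rewrite lee_fin.
rewrite ge0_integralZl //.
- by rewrite PI -EFinM exprSr.
- exact/measurable_EFinP.
- by move=> x _; rewrite lee_fin.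
- by rewrite lee_fin exprn_ge0 // -lee_fin -PI integral_ge0 // => x _; rewrite lee_fin.
Qed.

(** From [1 - x <= expR (- x)] one gets [expR x <= 1 / (1 - x)], and the quadratic times [1 - x]
    equals [1 + x^2 (1 - 2 x)], which is at least 1 for [x <= 1/2]. *)
Lemma expR_le_quad (x : R) : x <= 2^-1 -> expR x <= 1 + x + 2 * x ^+ 2.
Proof.
move=> x2.
have h : 1 - x <= expR (- x) by exact: expR_ge1Dx.
rewrite -[x in expR x]opprK expRN.
have q : 1 <= (1 + x + 2 * x ^+ 2) * (1 - x) by have := sqr_ge0 x; nra.
apply: (@le_trans _ _ (1 - x)^-1).
  by rewrite lef_pV2 // posrE ?expR_gt0 //; lra.
rewrite -[leLHS]mul1r ler_pdivrMr //; lra.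
Qed.

Lemma bounded_integrable (xi : T -> R) (b : R) : measurable_fun setT xi ->
  (forall x, `|xi x| <= b) -> P.-integrable setT (EFin \o xi).
Proof.
move=> mxi xib; apply: measurable_bounded_integrable => //.
  exact: le_lt_trans (probability_le1 P measurableT) (ltry _).
exists b; split; first exact: num_real.
by move=> r br x _; apply: le_trans (xib x) (ltW br).
Qed.

Lemma iid_mean_ge0_le n (xi : T -> R) (D V : R) :
  measurable_fun setT xi -> (forall x, `|xi x| <= 1) ->
  \int[P]_x xi x <= - (D / 2) -> \int[P]_x (xi x ^+ 2) <= V ->
  0 < D <= 4 * V ->
  (iid P n [set z | (0 <= \sum_(i < n) xi (tnth z i))%R] <=
    (expR (- (n%:R * (D ^+ 2 / (32 * V))))%R)%:E)%E.
Proof.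
move=> mxi xi1 xiD xiV /andP[D0 DV].
have V0 : 0 < V by lra.
(* This minimizes [- la D / 2 + 2 la^2 V], with minimum [- D^2 / (32 V)]. The hypothesis
   [D <= 4 * V] says that [la <= 1/2], the range of [expR_le_quad]. *)
pose la := D / (8 * V).
have la0 : 0 < la by rewrite divr_gt0 //; lra.
have la2 : la <= 2^-1 by rewrite ler_pdivrMr; lra.
pose phi x := expR (la * xi x).
have mphi : measurable_fun setT phi.
  by apply: measurableT_comp => //; exact: measurable_funM.
have phi0 x : 0 <= phi x by exact: expR_ge0.
have laxi x : la * xi x <= 2^-1.
  have : xi x <= 1 by apply: le_trans (ler_norm _) (xi1 x).
  by move=> ?; nra.
have phib x : `|phi x| <= expR (2^-1).
  by rewrite ger0_norm // ler_expR.
have ixi : P.-integrable setT (EFin \o xi) by exact: bounded_integrable mxi xi1.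
have ixi2 : P.-integrable setT (EFin \o (fun x => xi x ^+ 2)).
  apply: (@bounded_integrable _ 1); first exact: measurable_funX.
  by move=> x; rewrite normrX expr_le1.
have iphi : P.-integrable setT (EFin \o phi) by exact: bounded_integrable phib.
pose q x := 1 + la * xi x + 2 * la ^+ 2 * xi x ^+ 2.
have i1 : P.-integrable setT (EFin \o cst (1 : R)).
  by apply: (@bounded_integrable _ 1) => // x; rewrite normr1.
have i2 : P.-integrable setT (EFin \o (fun x => la * xi x)).
  apply: (@bounded_integrable _ la); first exact: measurable_funM.
  by move=> x; rewrite normrM gtr0_norm // -[leRHS]mulr1 ler_wpM2l // ltW.
have i3 : P.-integrable setT (EFin \o (fun x => 2 * la ^+ 2 * xi x ^+ 2)).
  apply: (@bounded_integrable _ (2 * la ^+ 2)).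
    by apply: measurable_funM => //; exact: measurable_funX.
  move=> x; rewrite normrM [`|2 * _|]ger0_norm; last by have := sqr_ge0 la; lra.
  rewrite -[leRHS]mulr1 ler_wpM2l //; first by have := sqr_ge0 la; lra.
  by rewrite normrX expr_le1.
have i12 : P.-integrable setT (EFin \o (fun x => 1 + la * xi x)).
  by rewrite (_ : _ \o _ = (fun x => (1%:E + (la * xi x)%:E))%E) //; exact: integrableD.
have iq : P.-integrable setT (EFin \o q).
  by rewrite (_ : _ \o _ = (fun x => ((1 + la * xi x)%:E + (2 * la ^+ 2 * xi x ^+ 2)%:E))%E) //; exact: integrableD.
have Iphi : \int[P]_x phi x <= expR (- (D ^+ 2 / (32 * V))).
  apply: (@le_trans _ _ (\int[P]_x q x)).
    apply: le_Rintegral => // x _.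
    by rewrite (le_trans (expR_le_quad _)) // /q exprMn mulrA.
  rewrite /q RintegralD // RintegralD // !RintegralZl // Rintegral_cst //.
  rewrite (_ : fine _ = 1) ?mulr1; last by rewrite -[RHS]/(fine 1%:E); congr fine; exact: probability_setT.
  apply: le_trans (expR_ge1Dx _).
  have e1 : la * \int[P]_x xi x <= la * - (D / 2) by rewrite ler_wpM2l // ltW.
  have e2 : 2 * la ^+ 2 * \int[P]_x (xi x ^+ 2) <= 2 * la ^+ 2 * V.
    by rewrite ler_wpM2l //; have := sqr_ge0 la; lra.
  have e3 : la * - (D / 2) + 2 * la ^+ 2 * V = - (D ^+ 2 / (32 * V)).
    by rewrite /la; field; lra.
  lra.
have EI : (\int[P]_x (phi x)%:E = (\int[P]_x phi x)%:E)%E.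
  by rewrite /Rintegral fineK // integrable_fin_num.
set A := [set z | _].
have mS : measurable_fun [set: n.-tuple T] (fun z => \sum_(i < n) xi (tnth z i)).
  apply: measurable_sum => i; apply: measurableT_comp => //; exact: measurable_tnth.
have mA : measurable A.
  rewrite (_ : A = (fun z => \sum_(i < n) xi (tnth z i)) @^-1` `[0, +oo[).
    by rewrite -[X in measurable X]setTI; exact: mS.
  by apply/seteqP; split => z; rewrite /= in_itv /= andbT.
rewrite -[A]setIT -integral_indic //.
apply: (@le_trans _ _ (\int[iid P n]_z (\prod_(i < n) phi (tnth z i))%:E)%E).
  apply: ge0_le_integral_nomeas => z; first by rewrite lee_fin.
  rewrite lee_fin indicE; case: (boolP (_ \in _)); last by rewrite prodr_ge0.
  rewrite inE /A /= /phi => s0; rewrite -expR_sum -mulr_sumr.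
  by rewrite -expR0 ler_expR mulr_ge0 // ltW.
rewrite (integral_iid_prod n mphi phi0 EI) lee_fin -mulrN expRM_natl.
apply: lerXn2r => //; rewrite nnegrE ?expR_ge0 //.
by apply: Rintegral_ge0.
Qed.

End iid_chernoff.

(** * Excess risk *)

Section excess_risk.
Variables (R : realType) (d : nat).
Local Notation point := 'cV[R]_d.
Local Notation obs := ('cV[R]_d * bool)%type.
Variables (Q : probability obs R) (f : point -> R).

Definition loss (G : set point) (p : obs) : R := (p.2 != (p.1 \in G))%:R.

Let mu := marginalX Q.
Let q0 A := fine (mu A).
Let q1 (A : set point) := fine (Q (A `*` [set true])).
Let g x := 2 * f x - 1.
(** The signed measure with density [2 f - 1] with respect to [mu], expressed through [Q] alone;
    [int_g] identifies it. *)
Let s A := 2 * q1 A - q0 A.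

Lemma marginalXE A : marginalX Q A = Q (A `*` setT).
Proof. by rewrite setXT. Qed.

Let q1D A B : measurable A -> measurable B ->
  q1 A = q1 (A `\` B) + q1 (A `&` B).
Proof.
move=> mA mB; rewrite /q1 -fineD ?fin_num_measure //; last 2 first.
- by apply: measurableX => //; exact: measurableD.
- by apply: measurableX => //; exact: measurableI.
rewrite -measureU; last 3 first.
- by apply: measurableX => //; exact: measurableD.
- by apply: measurableX => //; exact: measurableI.
- by apply/seteqP; split => // -[x y] [[[_ nBx] _] [[_ Bx] _]].
congr (fine (Q _)); apply/seteqP; split => [[x y] [Ax yt]|[x y]].
  by have [Bx|nBx] := pselect (B x); [right|left].
by move=> [|] [[]].
Qed.

Let q0D A B : measurable A -> measurable B ->
  q0 A = q0 (A `\` B) + q0 (A `&` B).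
Proof.
move=> mA mB; rewrite /q0 -fineD ?fin_num_measure //; last 2 first.
- exact: measurableD.
- exact: measurableI.
rewrite -measureU; last 3 first.
- exact: measurableD.
- exact: measurableI.
- by apply/seteqP; split => // x [[_ nBx] [_ Bx]].
congr (fine (mu _)); apply/seteqP; split => [x Ax|x].
  by have [Bx|nBx] := pselect (B x); [right|left].
by move=> [|] [].
Qed.

Let q1_ge0 A : 0 <= q1 A. Proof. by rewrite fine_ge0. Qed.

Let q1_le A : measurable A -> q1 A <= q0 A.
Proof.
move=> mA; rewrite /q1 /q0 /mu marginalXE fine_le ?fin_num_measure //.
- exact: measurableX.
- exact: measurableX.
apply: le_measure; rewrite ?inE; try exact: measurableX.
by move=> [x y] [].
Qed.

Let sD A B : measurable A -> measurable B -> s A = s (A `\` B) + s (A `&` B).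
Proof. by move=> mA mB; rewrite /s (q1D mA mB) (q0D mA mB); ring. Qed.

Lemma loss_indicE G : loss G = fun p => \1_(setT `*` [set true]) p +
   (\1_(G `*` setT) p + (-2) * \1_(G `*` [set true]) p).
Proof.
apply/funext => -[x y]; rewrite /loss !indicE /=.
have -> : ((x, y) \in [set: point] `*` [set true]) = y.
  by apply/idP/idP => [|yt]; rewrite inE => //= -[].
have -> : ((x, y) \in G `*` [set: bool]) = (x \in G).
  by apply/idP/idP; rewrite !inE => // -[].
have -> : ((x, y) \in G `*` [set true]) = (x \in G) && y.
  by apply/idP/andP; rewrite !inE /= => -[].
by case: y (x \in G) => -[] /=; ring.
Qed.

Lemma measurable_loss G : measurable G -> measurable_fun setT (loss G).
Proof.
move=> mG; rewrite loss_indicE.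
apply: measurable_funD; first by apply: measurable_indic; exact: measurableX.
apply: measurable_funD; first by apply: measurable_indic; exact: measurableX.
by apply: measurable_funM => //; apply: measurable_indic; exact: measurableX.
Qed.

Lemma integrable_loss G : measurable G -> Q.-integrable setT (EFin \o loss G).
Proof.
move=> mG; apply: (@bounded_integrable _ _ _ _ _ 1).
  exact: measurable_loss.
by move=> p; rewrite /loss; case: (_ != _); rewrite ?normr1 ?normr0.
Qed.

Let Rintegral_indic (A : set obs) : measurable A ->
  \int[Q]_p (\1_A p) = fine (Q A).
Proof. by move=> mA; rewrite /Rintegral integral_indic // setIT. Qed.

Let integral_loss G : measurable G -> \int[Q]_p loss G p = q1 setT - s G.
Proof.
move=> mG.
have mT : measurable ([set: point] `*` [set true]) by exact: measurableX.
have mGT : measurable (G `*` [set: bool]) by exact: measurableX.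
have mG1 : measurable (G `*` [set true]) by exact: measurableX.
have i1 := integrable_indic Q mT.
have i2 := integrable_indic Q mGT.
have i3 := integrable_indic Q mG1.
rewrite loss_indicE.
have i4 : Q.-integrable setT (EFin \o (fun p => (-2) * \1_(G `*` [set true]) p)).
  exact: (integrableZl measurableT _ i3).
rewrite RintegralD //; last exact: (integrableD measurableT i2 i4).
rewrite RintegralD // RintegralZl // !Rintegral_indic // /s /q1 /q0 /mu marginalXE.
ring.
Qed.

Hypothesis fQ : is_regression Q f.

Let mf : measurable_fun setT f.
Proof. by have [/integrableP[/measurable_EFinP]] := fQ. Qed.

Lemma measurable_bayes_rule : measurable (bayes_rule f).
Proof.
rewrite (_ : bayes_rule f = @cube R d `&` f @^-1` `[2^-1, +oo[).
  by apply: measurableI; [exact: measurable_cube|rewrite -[X in measurable X]setTI; exact: mf].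
by apply/seteqP; split => x [cx fx]; split => //=; move: fx; rewrite /= in_itv /= andbT.
Qed.

Let ig A : measurable A -> mu.-integrable A (EFin \o g).
Proof.
move=> mA; have [fi _] := fQ.
apply: (integrableS measurableT) => //.
have -> : EFin \o g = (fun x => (2%:E * (EFin \o f) x - (cst 1%:E) x)%E) by [].
apply: integrableB => //; first exact: (integrableZl measurableT _ fi).
exact: finite_measure_integrable_cst measurableT.
Qed.

Let int_g A : measurable A -> \int[mu]_(x in A) g x = s A.
Proof.
move=> mA; have [fi fE] := fQ.
have fiA : mu.-integrable A (EFin \o f) by apply: (integrableS measurableT).
rewrite /g RintegralB //; last 2 first.
- exact: (integrableZl mA _ fiA).
- exact: finite_measure_integrable_cst.
rewrite RintegralZl // Rintegral_cst // mul1r /s /q0 /q1.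
by rewrite /Rintegral -fE.
Qed.

Let int_Ng A : measurable A -> \int[mu]_(x in A) - g x = - s A.
Proof.
move=> mA; rewrite -(int_g mA) -mulN1r -RintegralZl //; last exact: ig.
by apply: eq_Rintegral => x _; rewrite mulN1r.
Qed.

Let iag A : measurable A -> mu.-integrable A (EFin \o (fun x => `|g x|)).
Proof. by move=> mA; have /integrable_norm := ig mA. Qed.

(** As a version of the conditional probability, [f] comes with no pointwise bound, so one argues on
    integrals: on either side of the level [1/2] the integral is [s] or [- s], and [0 <= q1 <= q0]
    bounds both by [q0]. *)
Lemma Rintegral_abs_le A : measurable A ->
  \int[mu]_(x in A) `|2 * f x - 1| <= fine (mu A).
Proof.
move=> mA.
pose H := f @^-1` `[2^-1, +oo[.
have mH : measurable H by rewrite -[X in measurable X]setTI; exact: mf.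
have mD : measurable (A `\` H) by exact: measurableD.
have mI : measurable (A `&` H) by exact: measurableI.
have AE : A = (A `\` H) `|` (A `&` H) by rewrite setUC setUIDK.
rewrite {1}AE Rintegral_setU //; last 2 first.
- by rewrite -AE; exact: iag.
- by apply/disj_setPS => x [[_ nH] [_ Hx]].
rewrite (@eq_Rintegral _ _ _ mu _ (fun x => - g x)); last first.
  move=> x; rewrite inE /H /= => -[_] /negP; rewrite in_itv /= andbT -ltNge => fx.
  by rewrite ltr0_norm // /g; lra.
rewrite (@eq_Rintegral _ _ _ mu (A `&` H) g); last first.
  move=> x; rewrite inE /H /= => -[_]; rewrite in_itv /= andbT => fx.
  by rewrite ger0_norm // /g; lra.
rewrite int_g // int_Ng // -/(q0 A) (q0D mA mH) /s.
have := q1_le mD; have := q1_le mI; have := q1_ge0 (A `\` H); lra.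
Qed.

Lemma Rintegral_abs_ge0 A : 0 <= \int[mu]_(x in A) `|2 * f x - 1|.
Proof. exact: Rintegral_ge0. Qed.

(** The sign of [2 f - 1] is constant on each half of the symmetric difference. On [G] minus the
    Bayes rule this uses [G] inside the cube, since [bayes_rule] is cut off there. *)
Lemma excess_riskE G : measurable G -> G `<=` @cube R d ->
  \int[Q]_p loss G p - \int[Q]_p loss (bayes_rule f) p = d_f Q f G (bayes_rule f).
Proof.
move=> mG Gc.
have mB := measurable_bayes_rule.
rewrite !integral_loss // /d_f /setY Rintegral_setU //; last 4 first.
- exact: measurableD.
- exact: measurableD.
- by apply: iag; apply: measurableU; exact: measurableD.
- by apply/disj_setPS => x [[? ?] [? ?]].
rewrite (@eq_Rintegral _ _ _ mu _ (fun x => - g x)); last first.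
  move=> x; rewrite inE => -[Gx nBx].
  have fx : f x < 2^-1.
    by rewrite ltNge; apply/negP => ?; apply: nBx; split => //; exact: Gc.
  by rewrite ltr0_norm // /g; lra.
rewrite (@eq_Rintegral _ _ _ mu (bayes_rule f `\` G) g); last first.
  move=> x; rewrite inE => -[[_ fx] _].
  by rewrite ger0_norm // /g; lra.
rewrite int_g ?int_Ng; [|exact: measurableD..].
rewrite (sD mG mB) (sD mB mG) [bayes_rule f `&` G]setIC; ring.
Qed.

Lemma d_f_le1 G : measurable G -> d_f Q f G (bayes_rule f) <= 1.
Proof.
move=> mG; have mY : measurable (G `+` bayes_rule f).
  by apply: measurableU; apply: measurableD => //; exact: measurable_bayes_rule.
apply: le_trans (Rintegral_abs_le mY) _.
by rewrite -lee_fin fineK ?fin_num_measure // probability_le1.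
Qed.

Lemma d_Delta_triangle G1 G2 G3 : measurable G1 -> measurable G2 -> measurable G3 ->
  d_Delta Q G1 G2 <= d_Delta Q G1 G3 + d_Delta Q G2 G3.
Proof.
move=> m1 m2 m3.
have m13 : measurable (G1 `+` G3) by apply: measurableU; exact: measurableD.
have m23 : measurable (G2 `+` G3) by apply: measurableU; exact: measurableD.
have m12 : measurable (G1 `+` G2) by apply: measurableU; exact: measurableD.
rewrite /d_Delta -fineD ?fin_num_measure // fine_le ?fin_num_measure //.
  by rewrite fin_numD !fin_num_measure.
apply: le_trans (measureU2 _ _ _) => //.
apply: le_measure; rewrite ?inE //; first exact: measurableU.
move=> x [[x1 x2]|[x2 x1]]; have [x3|x3] := pselect (G3 x).
- by right; right.
- by left; left.
- by left; right.
- by right; left.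
Qed.

(** Both losses are 0 or 1 and differ exactly where the two sets classify differently; this is the
    variance term of the Chernoff bound. *)
Lemma integral_sqr_loss G1 G2 : measurable G1 -> measurable G2 ->
  \int[Q]_p ((loss G1 p - loss G2 p) ^+ 2) = d_Delta Q G1 G2.
Proof.
move=> m1 m2.
have mY : measurable (G1 `+` G2) by apply: measurableU; exact: measurableD.
rewrite (@eq_Rintegral _ _ _ Q _ (\1_((G1 `+` G2) `*` setT))).
  by rewrite Rintegral_indic; [rewrite -marginalXE|exact: measurableX].
move=> -[x y] _; rewrite /loss indicE.
have -> : ((x, y) \in (G1 `+` G2) `*` [set: bool]) = ((x \in G1) != (x \in G2)).
  apply/idP/idP; rewrite inE /=.
    move=> [[|] [/mem_set a]] b _; rewrite a.
      by rewrite memNset.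
    by rewrite memNset.
  case: (boolP (x \in G1)) => /=; case: (boolP (x \in G2)) => //=.
    by rewrite notin_setE inE => a b _; split => //; left.
  by rewrite notin_setE inE => a b _; split => //; right.
by case: y (x \in G1) (x \in G2) => -[] [] /=; ring.
Qed.

(* The comparison is made with [G'] itself rather than with the Bayes rule, so a single Bernstein bound suffices. *)
Lemma empirical_risk_le_prob n G G' (V : R) (D := d_f Q f G (bayes_rule f)) :
  measurable G -> measurable G' -> G `<=` @cube R d -> G' `<=` @cube R d ->
  d_f Q f G' (bayes_rule f) <= D / 2 -> d_Delta Q G' G <= V -> 0 < D <= 4 * V ->
  (iid Q n [set z | (empirical_risk z G <= empirical_risk z G')%R] <=
    (expR (- (n%:R * (D ^+ 2 / (32 * V))))%R)%:E)%E.
Proof.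
move=> mG mG' Gc Gc' D2 DV D4V.
pose xi p := loss G' p - loss G p.
have mxi : measurable_fun setT xi.
  by apply: measurable_funB; exact: measurable_loss.
have xi1 p : `|xi p| <= 1.
  by rewrite /xi /loss; case: (_ != _); case: (_ != _); rewrite ?subrr ?subr0 ?sub0r ?normrN ?normr1 ?normr0.
have := @iid_mean_ge0_le _ _ R Q n xi D V mxi xi1 _ _ D4V.
rewrite /xi RintegralB; [|exact: measurableT|exact: integrable_loss..].
rewrite integral_sqr_loss // => /(_ _ DV) h.
rewrite (_ : [set z | _] = [set z | 0 <= \sum_(i < n) xi (tnth z i)]).
  apply: h.
  have := excess_riskE mG Gc; have := excess_riskE mG' Gc'; rewrite -/D; lra.
apply/seteqP; split => z /=.
all: rewrite /xi big_split sumrN subr_ge0 /empirical_risk.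
all: case: n z {h} => [|n] z; first by rewrite !big_ord0.
all: by rewrite ler_pM2l // invr_gt0.
Qed.

End excess_risk.

(** * Counting networks *)

Lemma sum_pair_in (R : realType) (I J : finType) (S : {set I * J}) (F : I * J -> R) :
  \sum_(p in S) F p = \sum_i \sum_j if (i, j) \in S then F (i, j) else 0.
Proof. by rewrite big_mkcond pair_bigA; apply: eq_bigr => -[]. Qed.

Section net_words.
Variables (R : realType) (N c : nat).

Definition grid_val (k : 'I_(2 ^ c * 2).+1) : R := (k%:R - 2 ^+ c) / 2 ^+ c.

Definition grid_idx (w : R) : 'I_(2 ^ c * 2).+1 :=
  odflt ord0 [pick k | grid_val k == w].

Lemma grid_idxK w : weight_grid c w -> grid_val (grid_idx w) = w.
Proof.
move=> [k kc ->]; rewrite /grid_idx; case: pickP => [k' /eqP//|].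
have : 0 <= k + (2 ^ c)%N%:Z <= (2 ^ c * 2)%N%:Z.
  move: kc; rewrite ler_norml => /andP[k1 k2].
  have e : (2 ^ c)%N%:Z = 2 ^+ c by rewrite -natz natrX.
  by rewrite PoszM e; lra.
case E : (k + _) => [l|//] /andP[_]; rewrite lez_nat -ltnS => lc.
move=> /(_ (Ordinal lc)) /eqP [].
rewrite /grid_val /=; congr (_ / _).
have -> : l%:R = (k + (2 ^ c)%N%:Z)%:~R :> R by rewrite E.
by rewrite intrD -pmulrn natrX addrK.
Qed.

Definition grid0 : 'I_(2 ^ c * 2).+1 := grid_idx 0.

Lemma grid_val0 : grid_val grid0 = 0.
Proof. by apply: grid_idxK; exists 0; rewrite ?normr0 ?exprn_ge0 ?mul0r. Qed.

(* A network is written as a program for a machine holding the activations [v]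
   of the current layer and the accumulators [acc] of the next one:
   [Some (i, Some j, k)] adds weight [k] times [v j] to [acc i],
   [Some (i, None, k)] subtracts the bias [k], [None] ends the layer. *)
Definition token := option ('I_N.+1 * option 'I_N.+1 * 'I_(2 ^ c * 2).+1).

Definition token_val (v : 'I_N.+1 -> R) (oj : option 'I_N.+1) : R :=
  if oj is Some j then v j else -1.

Fixpoint run (w : seq token) (v acc : 'I_N.+1 -> R) : R :=
  match w with
  | [::] => acc ord0
  | None :: w' => run w' (fun i => Num.max 0 (acc i)) (fun=> 0)
  | Some (i, oj, k) :: w' =>
      run w' v (fun l => acc l + (l == i)%:R * (grid_val k * token_val v oj))
  end.

Lemma run_weights (ws : seq ('I_N.+1 * option 'I_N.+1 * 'I_(2 ^ c * 2).+1))
    rest v acc :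
  run (map some ws ++ rest) v acc =
  run rest v (fun l => acc l +
    \sum_(t <- ws) (l == t.1.1)%:R * (grid_val t.2 * token_val v t.1.2)).
Proof.
elim: ws acc => [|[[i oj] k] ws IH] acc /=.
  by congr run; apply/funext => l; rewrite big_nil addr0.
by rewrite IH; congr run; apply/funext => l; rewrite big_cons addrA.
Qed.

(** Null instructions bring all programs to one common length, so that they form a single tuple
    type. *)
Lemma run_pad n w v acc : run (nseq n (Some (ord0, None, grid0)) ++ w) v acc = run w v acc.
Proof.
elim: n acc => // n IH acc /=; rewrite IH; congr run; apply/funext => l.
by rewrite grid_val0 mul0r mulr0 addr0.
Qed.

Lemma nnzE m n (A : 'M[R]_(m, n)) :
  nnz A = #|[set p : 'I_m * 'I_n | A p.1 p.2 != 0]%SET|.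
Proof. by apply: eq_card => p; rewrite inE; apply/idP/idP; rewrite inE. Qed.

(** Each neuron counted here owns a nonzero weight or bias; every other neuron outputs
    [max(0, 0) = 0]. *)
Lemma card_nnz_active m m' (W : 'M[R]_(m', m)) (b : 'cV[R]_m') :
  (#|[set i | [exists j, W i j != 0%R] || (b i 0%R != 0%R)]%SET| <= nnz W + nnz b)%N.
Proof.
apply: (@leq_trans (#|[set i | [exists j, W i j != 0%R]]%SET| + #|[set i | b i 0%R != 0%R]%SET|)).
  apply: leq_trans (leq_card_setU _ _); apply: subset_leq_card.
  by apply/fintype.subsetP => i; rewrite !inE.
rewrite !nnzE; apply: leq_add.
  apply: leq_trans (leq_imset_card fst _); apply: subset_leq_card.
  apply/fintype.subsetP => i; rewrite inE => /existsP[j Wij].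
  by apply/imsetP; exists (i, j); rewrite ?inE.
apply: leq_trans (leq_imset_card fst _); apply: subset_leq_card.
apply/fintype.subsetP => i; rewrite inE => bi.
by apply/imsetP; exists (i, 0); rewrite ?inE.
Qed.

(* Neurons outside [A] are identically zero; pruning them bounds the number of
   registers by the sparsity, whatever the hidden dimensions. *)
Lemma net_word m (Phi : relu_net R 1 m) (A : {set 'I_m}) (e : 'I_m -> 'I_N.+1) :
  weights_in (@weight_grid R c) Phi -> (sparsity Phi <= N)%N ->
  exists2 w : seq token, (size w <= sparsity Phi + nlayers Phi)%N &
    forall (x : 'cV[R]_m) v, (forall j, j \in A -> v (e j) = x j 0) ->
      (forall j, j \notin A -> x j 0 = 0) ->
      run w v (fun=> 0) = realization Phi x 0 0.
Proof.
elim: Phi A e => [{}m W|{}m m' W b Psi IH] A e /=.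
  (* Weights that read an input outside [A] are dropped: such an input is zero and has no reliable
     register. *)
  move=> gW _; pose S := [set p : 'I_1 * 'I_m | (W p.1 p.2 != 0) && (p.2 \in A)]%SET.
  exists (map some [seq (ord0, Some (e p.2), grid_idx (W p.1 p.2)) | p <- enum S]).
    rewrite !size_map -cardE addn0 nnzE; apply: subset_leq_card.
    by apply/fintype.subsetP => p; rewrite !inE => /andP[].
  move=> x v vA xA; rewrite -[map _ _]cats0 run_weights /= add0r big_map big_enum /=.
  rewrite mxE (eq_bigr (fun p : 'I_1 * 'I_m => W p.1 p.2 * x p.2 0)); last first.
    by move=> p; rewrite inE => /andP[_ pA]; rewrite mul1r grid_idxK ?vA.
  rewrite sum_pair_in.
  rewrite big_ord1; apply: eq_bigr => j _; rewrite inE /=.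
  have [->|W0 /=] := eqVneq (W 0 j) 0; first by rewrite mul0r.
  by case: (boolP (j \in A)) => // /xA ->; rewrite mulr0.
move=> [gW gb gPsi] sN.
pose A' := [set i | [exists j, W i j != 0] || (b i 0 != 0)]%SET.
have A'N : (#|A'| <= N.+1)%N.
  by apply: leq_trans (card_nnz_active W b) _; lia.
(* An active neuron is stored at its rank in [A'], which fits because [A'] has at most [N.+1]
   elements. Inactive neurons may collide with others, so injectivity is claimed on [A'] only. *)
pose e' i : 'I_N.+1 := inord (index i (enum A')).
have e'inj i j : i \in A' -> j \in A' -> (e' i == e' j) = (i == j).
  move=> iA jA; apply/eqP/eqP => [|->//] /(congr1 val).
  have ltA k : k \in A' -> (index k (enum A') < N.+1)%N.
    by move=> kA; apply: leq_trans A'N; rewrite cardE index_mem mem_enum.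
  rewrite /= !inordK ?ltA // => /(congr1 (nth i (enum A'))).
  by rewrite !nth_index ?mem_enum.
have [w' sw' w'P] := IH A' e' gPsi (leq_trans (leq_addl _ _) sN).
pose S := [set p : 'I_m' * 'I_m | (W p.1 p.2 != 0) && (p.2 \in A)]%SET.
pose Sb := [set i : 'I_m' | b i 0 != 0]%SET.
pose ws := [seq (e' p.1, Some (e p.2), grid_idx (W p.1 p.2)) | p <- enum S] ++
  [seq (e' i, None, grid_idx (b i 0)) | i <- enum Sb].
exists (map some ws ++ None :: w').
  rewrite size_cat /= size_map size_cat !size_map -!cardE.
  have : (#|S| <= nnz W)%N.
    rewrite nnzE; apply: subset_leq_card.
    by apply/fintype.subsetP => p; rewrite !inE => /andP[].
  have : (#|Sb| <= nnz b)%N.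
    rewrite nnzE; apply: leq_trans (leq_imset_card fst _); apply: subset_leq_card.
    apply/fintype.subsetP => i; rewrite inE => bi.
    by apply/imsetP; exists (i, 0); rewrite ?inE.
  by lia.
move=> x v vA xA; rewrite run_weights /=; apply: w'P => i iA; last first.
  rewrite !mxE; move: iA; rewrite inE negb_or negb_exists negbK => /andP[/forallP W0 /eqP ->].
  rewrite big1 ?subr0 ?maxxx // => j _.
  by have := W0 j; rewrite negbK => /eqP ->; rewrite mul0r.
rewrite !mxE add0r big_cat /= !big_map !big_enum /=; congr (Num.max 0 (_ + _)).
  rewrite (eq_bigr (fun p : 'I_m' * 'I_m => (i == p.1)%:R * (W p.1 p.2 * x p.2 0))); last first.
    move=> p; rewrite inE => /andP[W0 pA]; rewrite grid_idxK ?vA // e'inj // inE.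
    by apply/orP; left; apply/existsP; exists p.2.
  rewrite sum_pair_in.
  rewrite (bigD1 i) //= [X in _ + X]big1 ?addr0; last first.
    move=> k ki; apply: big1 => j _; case: ifP => // _.
    by rewrite eq_sym (negbTE ki) mul0r.
  apply: eq_bigr => j _; rewrite inE /= eqxx mul1r.
  have [->|W0 /=] := eqVneq (W i j) 0; first by rewrite mul0r.
  by case: (boolP (j \in A)) => // /xA ->; rewrite mulr0.
rewrite (eq_bigr (fun k => (i == k)%:R * (- b k 0))); last first.
  move=> k; rewrite inE => b0; rewrite grid_idxK // e'inj ?mulrN1 // inE.
  by apply/orP; right.
rewrite big_mkcond /= (bigD1 i) //= big1 ?addr0; last first.
  by move=> k ki; case: ifP => // _; rewrite eq_sym (negbTE ki) mul0r.
by rewrite eqxx mul1r inE; have [->|] //= := eqVneq (b i 0) 0; rewrite oppr0.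
Qed.

End net_words.

(** [N] leaves room for the [d] inputs as well as for the active neurons of a layer. Many programs
    describe no network; an over-large cover is harmless for a union bound. *)
Lemma net_sets_cover (R : realType) d (L s : R) (c : nat)
    (N := maxn d (Num.truncn s)) (T := (Num.truncn s + Num.truncn L)%N) :
  exists (I : finType) (F : I -> set 'cV[R]_d),
    #|I| = (((N.+1 * N.+2) * (2 ^ c * 2).+1).+1 ^ T)%N /\
    forall G, net_sets L s c G -> exists i, G = F i.
Proof.
pose v (x : 'cV[R]_d) (i : 'I_N.+1) : R := if insub (val i) is Some j then x j 0 else 0.
exists (T.-tuple (token N c)), (fun t : T.-tuple (token N c) => [set x | cube x /\ run t (v x) (fun=> 0) = 1 :> R]).
split.
  by rewrite card_tuple /token card_option !card_prod card_option !card_ord.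
move=> G [Phi [lP sP wP ->]].
have sN : (sparsity Phi <= Num.truncn s)%N by rewrite truncn_ge_nat // (le_trans _ sP).
have lL : (nlayers Phi <= Num.truncn L)%N by rewrite truncn_ge_nat // (le_trans _ lP).
have sN' : (sparsity Phi <= N)%N by rewrite (leq_trans sN) // leq_maxr.
pose e (j : 'I_d) : 'I_N.+1 := inord j.
have [w sw wE] := net_word [set: 'I_d]%SET e wP sN'.
have szw : (size w <= T)%N by apply: leq_trans sw _; exact: leq_add.
have szp : size (nseq (T - size w) (Some (ord0, None, grid0 R c)) ++ w : seq (token N c)) == T.
  by rewrite size_cat size_nseq subnK.
have vE x j : v x (e j) = x j 0.
  rewrite /v (_ : val (e j) = val j) ?valK // /e /= inordK //.
  by rewrite (leq_trans (ltn_ord j)) // (leq_trans (leq_maxl d (Num.truncn s))).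
exists (Tuple szp); apply/seteqP; split => x [cx]; split => //=.
  by rewrite run_pad (wE x) // => j; rewrite inE.
by move: b; rewrite /= run_pad (wE x) // => j; rewrite inE.
Qed.

(** * Networks indexed by finite types *)

Section weight_grid_theory.
Variables (R : realType) (c : nat).

Lemma weight_grid0 : @weight_grid R c 0.
Proof. by exists 0; rewrite ?normr0 ?exprn_ge0 ?mul0r. Qed.

Lemma weight_grid1 : @weight_grid R c 1.
Proof.
exists (2 ^+ c); first by rewrite normrX.
by rewrite rmorphXn /= mulfV // expf_neq0.
Qed.

Lemma weight_gridN w : @weight_grid R c w -> weight_grid c (- w).
Proof. by move=> [k kc ->]; exists (- k); rewrite ?normrN // mulrNz mulNr. Qed.

Lemma weight_grid_bool (b : bool) : @weight_grid R c b%:R.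
Proof. by case: b; [exact: weight_grid1|exact: weight_grid0]. Qed.

Lemma weight_grid_le c' w : (c <= c')%N -> @weight_grid R c w -> weight_grid c' w.
Proof.
move=> cc' [k kc ->]; rewrite -(subnKC cc'); move: (c' - c)%N => e.
exists (k * 2 ^+ e).
  by rewrite normrM normrX exprD ler_wpM2r // exprn_ge0.
rewrite intrM rmorphXn /= exprD.
have -> : ((2 : int)%:~R : R) = 2 by [].
by rewrite -mulf_div mulfV ?mulr1 // expf_neq0.
Qed.

End weight_grid_theory.

Lemma weights_in_sub (R : realType) (S S' : set R) k m (Phi : relu_net R k m) :
  S `<=` S' -> weights_in S Phi -> weights_in S' Phi.
Proof.
move=> SS'; elim: Phi => [m' W|m' m'' W b Psi IH] /=; first by move=> h i j; exact/SS'/h.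
by move=> [hW hb hP]; split=> [i j|i j|]; [exact/SS'/hW|exact/SS'/hb|exact: IH].
Qed.

Lemma sumn_sumType (I J : finType) (F : I + J -> nat) :
  (\sum_i F i = \sum_i F (inl i) + \sum_j F (inr j))%N.
Proof. exact: big_sumType. Qed.

Lemma sum_sumType (V : nmodType) (I J : finType) (F : I + J -> V) :
  \sum_i F i = \sum_i F (inl i) + \sum_j F (inr j).
Proof. exact: big_sumType. Qed.

Section computable.
Variables (R : realType) (c : nat).
Local Notation grid := (@weight_grid R c).

Definition nnzf (J I : finType) (W : J -> I -> R) : nat :=
  (\sum_j \sum_i (W j i != 0)%R)%N.

Lemma nnz_sum m n (A : 'M[R]_(m, n)) : nnz A = (\sum_i \sum_j (A i j != 0)%R)%N.
Proof.
rewrite nnzE -sum1_card big_mkcond pair_bigA /=.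
by apply: eq_bigr => p _; rewrite inE; case: (_ != _).
Qed.

Lemma nnz_mx (I J : finType) (W : J -> I -> R) :
  nnz (\matrix_(j < #|J|, i < #|I|) W (enum_val j) (enum_val i)) = nnzf W.
Proof.
rewrite nnz_sum /nnzf (big_enum_val (A := J)) /=; apply: eq_bigr => j _.
rewrite (big_enum_val (A := I)) /=.
by apply: eq_bigr => i _; rewrite mxE.
Qed.

Lemma nnzf_le (J I : finType) (W : J -> I -> R) : (nnzf W <= #|J| * #|I|)%N.
Proof.
apply: (@leq_trans (\sum_(j : J) \sum_(i : I) 1)); last by rewrite !sum_nat_const muln1.
by apply: leq_sum => j _; apply: leq_sum => i _; case: (_ != _).
Qed.

Definition layer (I J : finType) (W : J -> I -> R) (b : J -> R) (x : I -> R) : J -> R :=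
  fun j => Num.max 0 (\sum_i W j i * x i - b j).

Lemma layer_ge0 (I J : finType) (W : J -> I -> R) b x j : 0 <= layer W b x j.
Proof. by rewrite /layer le_max lexx. Qed.

Definition vec (I : finType) (x : I -> R) : 'cV[R]_#|I| := \col_i x (enum_val i).

(** Agreement is asked on nonnegative inputs only. This is what every layer outputs, and there a
    ReLU neuron can act as the identity, so values can be carried past a layer unchanged. *)
Definition computable (I : finType) (L s : nat) (phi : (I -> R) -> R) : Prop :=
  exists Psi : relu_net R 1 #|I|,
    [/\ (nlayers Psi <= L)%N, (sparsity Psi <= s)%N, weights_in grid Psi &
        forall x, (forall i, 0 <= x i) -> realization Psi (vec x) 0 0 = phi x].

Lemma computable_ext (I : finType) L s phi L' s' phi' : (L <= L')%N -> (s <= s')%N ->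
  (forall x, (forall i, 0 <= x i) -> phi x = phi' x) ->
  @computable I L s phi -> computable L' s' phi'.
Proof.
move=> LL ss pp [Psi [h1 h2 h3 h4]]; exists Psi; split => //.
- exact: leq_trans LL.
- exact: leq_trans ss.
- by move=> x x0; rewrite h4 // pp.
Qed.

Lemma layer_mxE (I J : finType) (W : J -> I -> R) (b : J -> R) (x : I -> R) :
  map_mx (Num.max 0) ((\matrix_(j < #|J|, i < #|I|) W (enum_val j) (enum_val i)) *m vec x
     - vec b) = vec (layer W b x).
Proof.
apply/matrixP => j k; rewrite !mxE /layer; congr (Num.max 0 (_ - _)).
rewrite (big_enum_val (A := I)) /=.
by apply: eq_bigr => i _; rewrite !mxE.
Qed.

Lemma nnz_vec (J : finType) (b : J -> R) : (nnz (vec b) <= #|J|)%N.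
Proof.
rewrite nnz_sum; apply: (@leq_trans (\sum_(i < #|J|) 1)).
  by apply: leq_sum => j _; rewrite big_ord1; case: (_ != _).
by rewrite sum_nat_const card_ord muln1.
Qed.

Lemma computable_layer (I J : finType) (W : J -> I -> R) b L s phi :
  (forall j i, grid (W j i)) -> (forall j, grid (b j)) ->
  computable L s phi -> computable L.+1 (nnzf W + #|J| + s) (phi \o layer W b).
Proof.
move=> gW gb [Psi [h1 h2 h3 h4]].
exists (ReluLayer (\matrix_(j < #|J|, i < #|I|) W (enum_val j) (enum_val i)) (vec b) Psi).
split => //=.
- by rewrite leq_add // nnz_mx leq_add2l nnz_vec.
- by split => // i j; rewrite mxE.
- by move=> x x0; rewrite layer_mxE h4 // => i; exact: layer_ge0.
Qed.

Definition sumf (I J : finType) (x : I -> R) (y : J -> R) : I + J -> R :=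
  fun t => match t with inl i => x i | inr j => y j end.

(** Runs the hidden layers of [Phi] next to identity wires for [J], which cost [#|J|] weights per
    layer. The output matrix [W] is left unapplied: its value may be negative and would not survive
    a ReLU, so the layer that follows merges [W] into its own weights. *)
Lemma computable_net (J : finType) m (Phi : relu_net R 1 m) : weights_in grid Phi ->
  exists m' (W : 'M[R]_(1, m')) (h : 'cV[R]_m -> 'cV[R]_m'),
  [/\ forall x, realization Phi x = W *m h x, forall i j, grid (W i j),
      (nnz W <= sparsity Phi)%N &
      forall L s phi, computable L s phi ->
        computable (L + nlayers Phi) (s + sparsity Phi + nlayers Phi * #|J|)
          (fun x : 'I_m + J -> R =>
             phi (sumf (fun i => h (\col_k x (inl k)) i 0) (fun j => x (inr j))))].
Proof.
elim: Phi => [{}m W|{}m m1 W b Psi IH] /=.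
  move=> gW; exists m, W, id; split => // L s phi.
  apply: computable_ext; rewrite ?mul0n ?addn0 ?leq_addr // => x x0.
  by congr phi; apply/funext => -[i|j] //=; rewrite mxE.
move=> [gW gb /IH[m' [W' [h [hE gW' nW' hC]]]]].
exists m', W', (fun x => h (map_mx (Num.max 0) (W *m x - b))); split => //.
  by rewrite (leq_trans nW') // leq_addl.
move=> L s phi /hC.
pose W1 (t : 'I_m1 + J) (t' : 'I_m + J) : R :=
  match t, t' with
  | inl i, inl i' => W i i'
  | inr j, inr j' => (j == j')%:R
  | _, _ => 0
  end.
pose b1 (t : 'I_m1 + J) : R := if t is inl i then b i 0 else 0.
move=> [Psi' [h1 h2 h3 h4]].
exists (ReluLayer (\matrix_(j < #|{: 'I_m1 + J}|, i < #|{: 'I_m + J}|) W1 (enum_val j) (enum_val i)) (vec b1) Psi').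
split => //=.
- by rewrite addnS.
- rewrite nnz_mx.
  have -> : nnzf W1 = (nnz W + #|J|)%N.
    rewrite /nnzf sumn_sumType nnz_sum; congr (_ + _)%N.
      apply: eq_bigr => i _; rewrite sumn_sumType [X in (_ + X)%N]big1 ?addn0 //.
      by move=> j _; rewrite /= eqxx.
    rewrite -sum1_card; apply: eq_bigr => j _.
    rewrite sumn_sumType big1 ?add0n; last by move=> i _; rewrite /= eqxx.
    rewrite (bigD1 j) //= eqxx oner_eq0 big1 ?addn0 // => k kj.
    by rewrite [j == k]eq_sym (negbTE kj) eqxx.
  have -> : nnz (vec b1) = nnz b.
    rewrite !nnz_sum (eq_bigr (fun i => (b1 (enum_val i) != 0)%R : nat)); last first.
      by move=> i _; rewrite big_ord1 mxE.
    rewrite -(big_enum_val (A := {: 'I_m1 + J}) (fun i => (b1 i != 0) : nat)) /=.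
    rewrite sumn_sumType [X in (_ + X)%N]big1 ?addn0; last by move=> j _; rewrite /= eqxx.
    by apply: eq_bigr => i _; rewrite big_ord1.
  apply: leq_trans (leq_add (leqnn _) h2) _; rewrite mulSn.
  move: (nlayers Psi * _)%N => k1; move: (sparsity Psi) (nnz W) (nnz b) => k2 k3 k4.
  by move: #|J| => k5; clear; lia.
- split => // i k; rewrite mxE.
    move: (enum_val i) (enum_val k) => [i1|j1] [i2|j2] //=; try exact: weight_grid0.
    exact: weight_grid_bool.
  by case: (enum_val i) => [i1|j1] //=; exact: weight_grid0.
- move=> x x0; rewrite layer_mxE h4; last by move=> i; exact: layer_ge0.
  congr phi; apply/funext => -[i|j] /=.
    congr (h _ _ _); apply/matrixP => k l; rewrite !mxE /layer ord1 sum_sumType /=.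
    rewrite [X in _ + X - _]big1 ?addr0; last by move=> j _; rewrite mul0r.
    by congr (Num.max 0 (_ - _)); apply: eq_bigr => i' _; rewrite mxE.
  rewrite /layer sum_sumType /= big1 ?add0r ?subr0; last by move=> i _; rewrite mul0r.
  rewrite (bigD1 j) //= eqxx mul1r big1 ?addr0; last first.
    by move=> k kj; rewrite eq_sym (negbTE kj) mul0r.
  by rewrite max_r.
Qed.

End computable.

(** * A network for a union of pieces *)

Lemma sum_delta (R : realType) (I : finType) (x : I -> R) i0 :
  \sum_i (i0 == i)%:R * x i = x i0.
Proof.
rewrite (bigD1 i0) //= eqxx mul1r big1 ?addr0 // => i ii0.
by rewrite eq_sym (negbTE ii0) mul0r.
Qed.

Lemma sum_unit (R : realType) (F : unit -> R) : \sum_i F i = F tt.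
Proof. by rewrite (bigD1 tt) //= big1 ?addr0 // => -[]. Qed.

Section stage.
Variables (R : realType) (c d : nat).
Local Notation grid := (@weight_grid R c).
Local Notation computable := (@computable R c (('I_d + unit)%type : finType)).
(* Input coordinates together with the running minimum over the pieces. *)
Local Notation state := ('I_d + unit)%type.
Local Notation constr := (unit + 'I_d * bool)%type.

Variables (j : 'I_d) (Phi : relu_net R 1 d.-1) (w q : R) (a b : 'I_d -> R).
Hypotheses (gPhi : weights_in grid Phi) (gw : grid w) (gq : grid q)
  (ga : forall i, grid (a i)) (gb : forall i, grid (b i)).

Definition violation (x : 'I_d -> R) : R :=
  Num.max 0 (w * x j + q - realization Phi (\col_k x (lift j k)) 0 0) +
  \sum_(ib : 'I_d * bool)
     Num.max 0 (if ib.2 then x ib.1 - b ib.1 else a ib.1 - x ib.1).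

Lemma violation_ge0 x : 0 <= violation x.
Proof.
by apply: addr_ge0; [|apply: sumr_ge0 => i _]; rewrite le_max lexx.
Qed.

Lemma violation_eq0 x : (violation x == 0) =
  (w * x j + q <= realization Phi (\col_k x (lift j k)) 0 0) &&
  [forall i, a i <= x i <= b i].
Proof.
have max0 (y : R) : (Num.max 0 y == 0) = (y <= 0).
  by rewrite eq_le ge_max lexx le_max lexx andbT.
rewrite paddr_eq0 ?le_max ?lexx //; last first.
  by apply: sumr_ge0 => i _; rewrite le_max lexx.
rewrite max0 subr_le0; congr (_ && _).
rewrite psumr_eq0; last by move=> i _; rewrite le_max lexx.
apply/allP/forallP => [h i|h [i ib] _].
  have := h (i, true) (mem_index_enum _); have := h (i, false) (mem_index_enum _).
  by rewrite /= !max0 !subr_le0 => -> ->.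
have /andP[h1 h2] := h i.
by case: ib; rewrite /= max0 subr_le0.
Qed.

(** Copies the coordinates other than [j] as inputs for [Phi], beside the untouched state. *)
Let W1 (t : 'I_d.-1 + state) (s : state) : R :=
  match t with
  | inl k => (inl (lift j k) == s)%:R
  | inr s' => (s' == s)%:R
  end.

Let layer1 v : (forall s, 0 <= v s) ->
  layer W1 (fun=> 0) v = sumf (fun k => v (inl (lift j k))) v.
Proof.
move=> v0; apply/funext => -[k|s]; rewrite /layer /= subr0 sum_delta max_r //.
Qed.

(** With the biases [b2], this computes the positive part of each constraint violation; the output
    matrix [W] of [Phi] is absorbed here. *)
Let W2 m (W : 'M[R]_(1, m)) (t : constr + state) (u : 'I_m + state) : R :=
  match t, u with
  | inl (inl tt), inl i => - W 0 i
  | inl (inl tt), inr (inl i) => (j == i)%:R * w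
  | inl (inr (i, b)), inr (inl i') => (-1) ^+ (~~ b) * (i == i')%:R
  | inr s, inr s' => (s == s')%:R
  | _, _ => 0
  end.

Let b2 (t : constr + state) : R :=
  match t with
  | inl (inl tt) => - q
  | inl (inr (i, true)) => b i
  | inl (inr (i, false)) => - a i
  | inr _ => 0
  end.

Let gW2 m (W : 'M[R]_(1, m)) : (forall i k, grid (W i k)) -> forall t u, grid (W2 W t u).
Proof.
move=> gW [[[]|[i ib]]|s] [k|[k|[]]] /=; try exact: weight_grid0; try exact: weight_grid_bool.
- exact/weight_gridN/gW.
- by case: (_ == _); rewrite ?mul1r ?mul0r //; exact: weight_grid0.
- case: ib; rewrite /= ?expr0 ?expr1 ?mul1r ?mulN1r; first exact: weight_grid_bool.
  by apply: weight_gridN; exact: weight_grid_bool.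
Qed.

Let gb2 t : grid (b2 t).
Proof.
case: t => [[[]|[i []]]|s] //=; try exact: weight_gridN; exact: weight_grid0.
Qed.

Let nnzf_W2 m (W : 'M[R]_(1, m)) :
  (nnzf (W2 W) <= nnz W + #|{: constr + state}| * #|{: state}|)%N.
Proof.
have -> : nnz W = (\sum_(t : constr + state) \sum_i
    (match t with inl (inl tt) => (W 0 i != 0)%R : nat | _ => 0%N end))%N.
  rewrite nnz_sum big_ord1 (bigD1 (inl (inl tt))) //= [X in (_ + X)%N]big1 ?addn0 //.
  by move=> [[[]|ib]|s] // _; rewrite big1.
rewrite -sum_nat_const -big_split /=; apply: leq_sum => t _.
rewrite sumn_sumType; apply: leq_add.
  apply: leq_sum => i _; case: t => [[[]|[i' ib]]|s] //=; rewrite ?eqxx //.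
  by rewrite oppr_eq0.
apply: (@leq_trans (\sum_(s : state) 1)); last by rewrite sum_nat_const muln1.
by apply: leq_sum => s _; case: (_ != _).
Qed.

Let layer2 m (W : 'M[R]_(1, m)) h v : (forall s, 0 <= v s) ->
  layer (W2 W) b2 (sumf h v) =
  sumf (sumf (fun=> Num.max 0 (w * v (inl j) + q - \sum_i W 0 i * h i))
     (fun ib => Num.max 0 (if ib.2 then v (inl ib.1) - b ib.1 else a ib.1 - v (inl ib.1)))) v.
Proof.
move=> v0; apply/funext => -[[[]|[i ib]]|s]; rewrite /layer sum_sumType /=.
- congr (Num.max 0 _); rewrite sum_sumType /= sum_unit mul0r addr0 opprK.
  rewrite (eq_bigr (fun i => - (W 0 i * h i))) => [|i _]; last by rewrite mulNr.
  rewrite sumrN (eq_bigr (fun i => (j == i)%:R * (w * v (inl i)))) => [|i _]; last by rewrite mulrA.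
  by rewrite sum_delta; ring.
- congr (Num.max 0 _); rewrite big1 ?add0r => [|k _]; last by rewrite mul0r.
  rewrite sum_sumType /= sum_unit mul0r addr0.
  rewrite (eq_bigr (fun k => (i == k)%:R * ((-1) ^+ (~~ ib) * v (inl k)))) => [|k _]; last by rewrite mulrCA mulrA.
  rewrite sum_delta; case: ib => /=; ring.
- rewrite big1 ?add0r ?subr0 => [|k _]; last by rewrite mul0r.
  by rewrite sum_delta max_r.
Qed.

(** [W3] and [W4] realize a minimum of nonnegative numbers: first [z = max(0, m - V)], then
    [max(0, m - z) = min(m, V)], where [m] is the running minimum and [V] the total violation. *)
Let W3 (t : state + unit) (u : constr + state) : R :=
  match t, u with
  | inl s, inr s' => (s == s')%:R
  | inr _, inl _ => -1
  | inr _, inr s => (inr tt == s)%:R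
  | _, _ => 0
  end.

Let layer3 h v : (forall s, 0 <= v s) ->
  layer W3 (fun=> 0) (sumf h v) =
  sumf v (fun=> Num.max 0 (v (inr tt) - \sum_i h i)).
Proof.
move=> v0; apply/funext => -[s|[]]; rewrite /layer sum_sumType /= subr0 sum_delta.
  rewrite big1 ?add0r => [|k _]; last by rewrite mul0r.
  by rewrite max_r.
rewrite addrC; congr (Num.max 0 (_ + _)).
by rewrite -sumrN; apply: eq_bigr => i _; rewrite mulN1r.
Qed.

Let W4 (t : state) (u : state + unit) : R :=
  match t, u with
  | t, inl t' => (t == t')%:R
  | inr _, inr _ => -1
  | _, _ => 0
  end.

Let layer4 v z :  (forall s, 0 <= v s) ->
  layer W4 (fun=> 0) (sumf v z) =
  sumf (fun i => v (inl i)) (fun=> Num.max 0 (v (inr tt) - z tt)).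
Proof.
move=> v0; apply/funext => -[i|[]]; rewrite /layer sum_sumType /= subr0 sum_delta sum_unit.
  by rewrite mul0r addr0 max_r.
by rewrite mulN1r.
Qed.

Definition stage_cost : nat :=
  (#|{: 'I_d.-1 + state}| * #|{: state}| + #|{: 'I_d.-1 + state}| +
   (#|{: constr + state}| * #|{: state}| + #|{: constr + state}|) +
   (#|{: state + unit}| * #|{: constr + state}| + #|{: state + unit}|) +
   (#|{: state}| * #|{: state + unit}| + #|{: state}|))%N.

(** The factor 2 on [sparsity Phi] appears because the output matrix of [Phi] is paid for again
    inside [W2]. The term [nlayers Phi * d.+1] is the price of carrying the state past [Phi]. *)
Lemma computable_stage L s phi : computable L s phi ->
  computable (L + nlayers Phi + 4)
    (s + (2 * sparsity Phi + nlayers Phi * d.+1 + stage_cost))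
    (fun v : state -> R => phi (sumf (fun i => v (inl i))
       (fun=> Num.min (v (inr tt)) (violation (fun i => v (inl i)))))).
Proof.
have [m [W [h [hE gW nW hC]]]] := computable_net state gPhi.
have g0 J (t : J) : grid ((fun=> 0) t) by exact: weight_grid0.
have gb' (x : bool) : grid x%:R by exact: weight_grid_bool.
have gW4 t u : grid (W4 t u).
  by case: t u => [i|[]] [t'|[]] //=; [exact: weight_grid0|apply: weight_gridN; exact: weight_grid1].
have gW3 t u : grid (W3 t u).
  by case: t u => [i|[]] [t'|t'] //=; [exact: weight_grid0|apply: weight_gridN; exact: weight_grid1].
have gW1 t u : grid (W1 t u) by case: t => [k|t] /=.
move=> /(computable_layer gW4 (g0 _)) /(computable_layer gW3 (g0 _)).
move=> /(computable_layer (gW2 gW) gb2) /hC /(computable_layer gW1 (g0 _)).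
apply: computable_ext.
- by lia.
- have := nnzf_W2 W; have := nnzf_le W1; have := nnzf_le W3; have := nnzf_le W4.
  rewrite (_ : (nlayers Phi * #|{: state}|)%N = (nlayers Phi * d.+1)%N); last first.
    by rewrite card_sum card_ord card_unit addn1.
  rewrite /stage_cost; move: nW.
  move: (nnzf W1) (nnzf (W2 W)) (nnzf W3) (nnzf W4) => n1 n2 n3 n4.
  move: (_ * _)%N (_ * _)%N (_ * _)%N (_ * _)%N => k1 k2 k3 k4.
  move: (nlayers Phi * d.+1)%N (#|_|) (#|_|) (#|_|) (#|_|) => k5 k6 k7 k8 k9.
  move: (nnz W) (sparsity Phi) => n5 n6.
  clear; lia.
move=> v v0; rewrite /= layer1 //= layer2 // layer3 // layer4 //; congr phi.
congr sumf; apply/funext => -[].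
rewrite sum_sumType sum_unit /=.
set E := (X in _ - Num.max 0 (_ - X)).
have -> : E = violation (fun i => v (inl i)).
  by rewrite /violation hE mxE.
have := violation_ge0 (fun i => v (inl i)); have := v0 (inr tt).
case: (lerP (v (inr tt)) (violation (fun i => v (inl i)))) => h1 h2 h3.
  by rewrite [X in _ - X]max_l ?subr_le0 // subr0 max_r.
by rewrite [X in _ - X]max_r ?subKr ?max_r // subr_ge0 ltW.
Qed.

End stage.

Lemma nnz_le (R : realType) m n (A : 'M[R]_(m, n)) : (nnz A <= m * n)%N.
Proof.
rewrite nnzE (leq_trans (max_card _)) // card_prod !card_ord //.
Qed.

Section union_net.
Variables (R : realType) (c d : nat) (T : finType).
Local Notation grid := (@weight_grid R c).
Local Notation state := ('I_d + unit)%type.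
Variables (j : T -> 'I_d) (Phi : T -> relu_net R 1 d.-1) (w q : T -> R)
  (a b : T -> 'I_d -> R) (L0 s0 : nat).
Hypotheses (gPhi : forall t, weights_in grid (Phi t)) (gw : forall t, grid (w t))
  (gq : forall t, grid (q t)) (ga : forall t i, grid (a t i))
  (gb : forall t i, grid (b t i))
  (lPhi : forall t, (nlayers (Phi t) <= L0)%N)
  (sPhi : forall t, (sparsity (Phi t) <= s0)%N).

Let viol t := violation (j t) (Phi t) (w t) (q t) (a t) (b t).

Let union_out (s : seq T) : (state -> R) -> R :=
  foldr (fun t phi v => phi (sumf (fun i => v (inl i))
      (fun=> Num.min (v (inr tt)) (viol t (fun i => v (inl i))))))
    (fun v => Num.max 0 (1 - v (inr tt))) s.

Let union_out1 s v : (forall t, 0 <= v t) ->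
  union_out s v = 1 <->
  v (inr tt) = 0 \/ exists2 t, t \in s & viol t (fun i => v (inl i)) = 0.
Proof.
elim: s v => [|t s IH] v v0 /=.
  split=> [|[->|[]//]]; last by rewrite subr0 max_r.
  by have := v0 (inr tt); case: (lerP (1 - v (inr tt)) 0) => ? ? h; left; lra.
have viol0 := violation_ge0 (j t) (Phi t) (w t) (q t) (a t) (b t) (fun i => v (inl i)).
rewrite IH /=; last first.
  by move=> [i|[]] /=; rewrite ?v0 // le_min v0.
split.
  case=> [|[t' t's h]]; last by right; exists t' => //; rewrite inE t's orbT.
  by case: lerP => _ h; [left|right; exists t; rewrite ?mem_head].
have h0 := v0 (inr tt).
case=> [->|[t']]; first by left; rewrite min_l.
rewrite inE => /predU1P[->|t's] h; last by right; exists t'.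
by left; rewrite [X in Num.min _ X]h min_r.
Qed.

Definition union_cost : nat :=
  (#|{: state}| * d + #|{: state}| + #|{: unit}| * #|{: state}| + #|{: unit}| + #|{: unit}|)%N.

Let computable_out : @computable R c state 1
  (#|{: unit}| * #|{: state}| + #|{: unit}| + #|{: unit}|) (union_out [::]).
Proof.
pose W (t : unit) (s : state) : R := if s is inr _ then -1 else 0.
have gW t s : grid (W t s).
  by case: s => /= _; [exact: weight_grid0|apply: weight_gridN; exact: weight_grid1].
have gm1 (t : unit) : grid (- 1) by apply: weight_gridN; exact: weight_grid1.
have : @computable R c unit 0 #|{: unit}| (fun x => x tt).
  exists (ReluOut (const_mx 1)); split => //=.
  - by rewrite (leq_trans (nnz_le _)) ?mul1n.
  - by move=> i k; rewrite mxE; exact: weight_grid1.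
  - move=> x _; rewrite mxE (eq_bigr (fun i => x (enum_val i))) => [|i _]; last first.
      by rewrite !mxE mul1r.
    by rewrite -(big_enum_val (A := {: unit}) x) /= sum_unit.
move=> /(computable_layer gW gm1); apply: computable_ext => //.
  by rewrite !leq_add2r nnzf_le.
move=> x _ /=; rewrite /layer sum_sumType sum_unit /= big1 ?add0r => [|i _]; last first.
  by rewrite mul0r.
by rewrite mulN1r opprK addrC.
Qed.

Let computable_union s : @computable R c state (size s * (L0 + 4) + 1)
  (size s * (2 * s0 + L0 * d.+1 + stage_cost d) +
   (#|{: unit}| * #|{: state}| + #|{: unit}| + #|{: unit}|)) (union_out s).
Proof.
elim: s => [|t s IH] /=.
  by rewrite !mul0n !add0n; exact: computable_out.
have := computable_stage (j t) (gPhi t) (gw t) (gq t) (ga t) (gb t) IH.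
apply: computable_ext => //.
  by rewrite mulSn; have := lPhi t; move: (size s * _)%N (nlayers _) => k1 k2; clear; lia.
have h : (2 * sparsity (Phi t) + nlayers (Phi t) * d.+1 + stage_cost d <=
    2 * s0 + L0 * d.+1 + stage_cost d)%N.
  by rewrite leq_add2r leq_add // leq_mul.
apply: leq_trans (leq_add (leqnn _) h) _.
by rewrite mulSn addnC addnA.
Qed.

Lemma union_net : exists Psi : relu_net R 1 d,
  [/\ (nlayers Psi <= #|T| * (L0 + 4) + 2)%N,
      (sparsity Psi <= #|T| * (2 * s0 + L0 * d.+1 + stage_cost d) + union_cost)%N,
      weights_in grid Psi &
      forall x, cube x -> realization Psi x 0 0 = 1 <->
        exists t, box (a t) (b t) x /\
          w t * x (j t) 0 + q t <= realization (Phi t) (row' (j t) x) 0 0].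
Proof.
pose W (t : state) (i : 'I_d) : R := if t is inl k then (k == i)%:R else 0.
(* The running minimum starts at 1, produced by the subtracted bias [-1]. With no pieces the output
   is [max(0, 1 - 1) = 0], so the empty union is rendered correctly. *)
pose b0 (t : state) : R := if t is inr _ then -1 else 0.
have [Psi [lP sP gP Pe]] := computable_union (enum T).
exists (ReluLayer (\matrix_(t < #|{: state}|, i < d) W (enum_val t) i) (vec b0) Psi).
split => /=.
- by rewrite [X in (_ <= X)%N]addnS ltnS cardE.
- rewrite /union_cost.
  have n1 : (nnz (\matrix_(t < #|{: state}|, i < d) W (enum_val t) i) <= #|{: state}| * d)%N.
    exact: nnz_le.
  have n2 := nnz_vec b0.
  apply: leq_trans (leq_add (leq_add n1 n2) sP) _.
  by rewrite -cardE addnCA leq_add2l !addnA.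
- split => // i k; rewrite mxE.
    by case: (enum_val i) => k' /=; [exact: weight_grid_bool|exact: weight_grid0].
  case: (enum_val i) => k' /=; first exact: weight_grid0.
  by apply: weight_gridN; exact: weight_grid1.
move=> x cx.
pose v : state -> R := sumf (fun i => x i 0) (fun=> 1).
have v0 t : 0 <= v t.
  by case: t => [i|t] /=; [have /andP[] := cx i|exact: ler01].
have -> : map_mx (Num.max 0) ((\matrix_(t < #|{: state}|, i < d) W (enum_val t) i) *m x - vec b0) = vec v.
  apply/matrixP => t k; rewrite !mxE ord1.
  rewrite (eq_bigr (fun i => W (enum_val t) i * x i 0)) => [|i _]; last by rewrite mxE.
  case: (enum_val t) => [i|[]] /=.
    by rewrite sum_delta subr0 max_r //; have /andP[] := cx i.
  by rewrite big1 ?sub0r ?opprK ?max_r // => i _; rewrite mul0r.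
rewrite Pe // union_out1 //.
have vE t : viol t (fun i => v (inl i)) = 0 <-> box (a t) (b t) x /\
    w t * x (j t) 0 + q t <= realization (Phi t) (row' (j t) x) 0 0.
  have -> : row' (j t) x = \col_k v (inl (lift (j t) k)).
    by apply/matrixP => k l; rewrite !mxE ord1.
  split=> [/eqP|[/= h1 h2]].
    by rewrite violation_eq0 => /andP[h1 /forallP h2].
  by apply/eqP; rewrite violation_eq0 h2; apply/forallP.
split=> [[/=/eqP|[t _ /vE]]|[t /vE h]]; first by rewrite oner_eq0.
  by exists t.
by right; exists t => //; rewrite mem_enum.
Qed.

End union_net.

(** * Taylor bound at a zero of full order *)

Lemma within_nbhsE (T : Type) (F : set_system T) (D : set T) :
  Filter F -> F D -> within D F = F.
Proof.
move=> FF FD; rewrite predeqE => P; rewrite /within /=; split => h.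
  by apply: filterS2 FD h => x Dx; exact.
by apply: filterS h.
Qed.

Section taylor.
Variable R : realType.
Local Notation cst1 := (fun t : R => (const_mx t : 'cV[R]_1)).

Lemma cube_const (t : R) : 0 <= t <= 1 -> cube (cst1 t).
Proof. by move=> t01 i; rewrite mxE. Qed.

Lemma normr_const_mx (t : R) : `|cst1 t| <= `|t|.
Proof.
rewrite [leLHS]mx_normrE; apply: bigmax_le => // -[i j] _.
by rewrite mxE.
Qed.

(** At an interior point small increments stay in the cube, so the restricted difference quotient
    has the ordinary limit. This opens the way to the mean value theorem. *)
Lemma pderiv_is_derive (g : 'cV[R]_1 -> R) (t : R) : 0 < t < 1 ->
  cvg (pdiffq 0 g (cst1 t)) ->
  is_derive t (1 : R) (g \o cst1) (pderiv 0 g (cst1 t)).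
Proof.
move=> /andP[t0 t1] cg.
have eqF : pdiffq 0 g (cst1 t) =
    (fun h : R => h^-1 *: (((g \o cst1) \o shift t) (h *: (1 : R)) - (g \o cst1) t)) @ 0^'.
  rewrite /pdiffq within_nbhsE.
    rewrite (_ : (fun h : R => h^-1 * (g (cst1 t + h *: delta_mx 0 0) - g (cst1 t))) =
      (fun h : R => h^-1 *: (((g \o cst1) \o shift t) (h *: (1 : R)) - (g \o cst1) t))) //.
    apply/funext => h; rewrite /=; congr (_ * (g _ - _)).
    by apply/matrixP => i j; rewrite !mxE !ord1 /= ?eqxx ?mulr1 addrC -[h *: 1]/(h * 1) mulr1.
  pose e := Num.min t (1 - t).
  have e0 : 0 < e by rewrite lt_min t0 subr_gt0.
  near=> h => i; rewrite !mxE !ord1 /= ?eqxx ?mulr1.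
  have : `|h| < e by near: h; apply: dnbhs0_lt.
  by rewrite lt_min !ltr_norml => /andP[/andP[? ?] /andP[? ?]]; apply/andP; split; lra.
by split; [rewrite /derivable -eqF|rewrite /derive -eqF].
Unshelve. all: by end_near. Qed.

Lemma within_const_mx (g : 'cV[R]_1 -> R) (t : R) : t <= 1 ->
  {within @cube R 1, continuous g} ->
  {within `[0, t], continuous (g \o cst1)}.
Proof.
move=> t1 /subspace_continuousP gc; apply/subspace_continuousP => s /= s0t.
have sc : 0 <= s <= 1.
  by move: s0t; rewrite in_itv /= => /andP[-> /le_trans->].
move=> U /= gU.
have : nbhs (cst1 s) [set y | cube y -> U (g y)] by exact: (gc _ (cube_const sc) U gU).
move=> /nbhs_ballP[e /= e0 he].
suff : nbhs s [set y | y \in `[0, t] -> U (g (cst1 y))] by [].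
apply/nbhs_ballP; exists e => //= y sy /=; rewrite in_itv /= => /andP[y0 yt].
apply: he; last by apply: cube_const; rewrite y0 (le_trans yt).
by split => // i j; rewrite !mxE.
Qed.

Lemma holder_order_itv (beta : R) : 0 < beta ->
  (holder_order beta)%:R < beta <= (holder_order beta).+1%:R.
Proof.
move=> b0; rewrite /holder_order.
have c0 : 0 < Num.ceil beta by rewrite ceil_gt0.
have /andP[h1 h2] := ceil_itv beta.
have e : (`|Num.ceil beta|%N.-1.+1)%:R = (Num.ceil beta)%:~R :> R.
  by rewrite prednK ?absz_gt0 ?gt_eqF // -[in RHS](gez0_abs (ltW c0)).
rewrite e h2 andbT; move: h1; rewrite intrD -e -natr1; lra.
Qed.

Lemma sup_norm_ge0 s (g : 'cV[R]_s -> R) : (0 <= sup_norm g)%E.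
Proof.
apply: le_trans (ereal_sup_ubound _); last first.
  by exists 0 => //= i; rewrite mxE lexx ler01.
by rewrite lee_fin.
Qed.

Lemma holder_seminorm_ge0 s om (g : 'cV[R]_s.+1 -> R) : (0 <= holder_seminorm om g)%E.
Proof.
apply: le_trans (ereal_sup_ubound _); last first.
  exists (const_mx 1, const_mx 0) => //=; split.
  - by move=> i; rewrite mxE ler01 lexx.
  - by move=> i; rewrite mxE ler01 lexx.
  - by apply/eqP => /matrixP/(_ 0 0); rewrite !mxE => /eqP; rewrite oner_eq0.
by rewrite lee_fin divr_ge0 // powR_ge0.
Qed.

Lemma holder_norm_seminorm (beta B : R) (g : 'cV[R]_1 -> R) (m := holder_order beta) :
  (holder_norm beta g <= B%:E)%E ->
  (holder_seminorm (beta - m%:R)%R (iter m (pderiv 0%R) g) <= B%:E)%E.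
Proof.
apply: le_trans; rewrite /holder_norm -/m.
pose al : {ffun 'I_1 -> 'I_m.+1} := [ffun=> ord_max].
rewrite (bigD1 al _ (P := fun a : {ffun 'I_1 -> 'I_m.+1} => (\sum_i a i == m)%N)) /=; last first.
  by rewrite big_ord1 ffunE.
have -> : multi_deriv (fun i => al i) g = iter m (pderiv 0) g.
  by rewrite /multi_deriv enum_ordSl (_ : enum 'I_0 = [::]) ?enum_ord0 //= ffunE.
rewrite addeCA leeDl // adde_ge0 // sume_ge0 // => a _.
  exact: sup_norm_ge0.
exact: holder_seminorm_ge0.
Qed.

Lemma foldr_nseq (g : 'cV[R]_1 -> R) k :
  foldr (@pderiv R 1) g (nseq k 0) = iter k (pderiv 0) g.
Proof. by elim: k => //= k ->. Qed.

(** Descent through the derivatives. The one of order [m] vanishes at 0 and is Hölder, hence at most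
    [B t^(beta - m)]. Each lower derivative also vanishes at 0, so the mean value theorem gains a
    factor [t] and keeps the constant [B]. *)
Lemma holder_class0_bound (beta B : R) (g : 'cV[R]_1 -> R) (t : R) :
  0 < beta -> 0 <= B -> holder_class0 beta B g -> 0 <= t <= 1 ->
  `|g (cst1 t)| <= B * t `^ beta.
Proof.
move=> b0 B0 [[smg /holder_norm_seminorm]]; set m := holder_order beta => semi g0.
have /andP[mb _] : m%:R < beta <= m.+1%:R := holder_order_itv b0.
pose F k (t : R) := iter k (pderiv 0) g (cst1 t).
have F0 k : (k <= m)%N -> F k 0 = 0.
  move=> km; have c0 : cst1 0 = 0 by apply/matrixP => i j; rewrite !mxE.
  by rewrite /F c0 g0 // (le_lt_trans _ mb) // ler_nat.
have om0 : 0 < beta - m%:R by rewrite subr_gt0.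
suff H k : (k <= m)%N -> forall t, 0 <= t <= 1 ->
    `|F (m - k)%N t| <= B * t `^ (beta - m%:R + k%:R).
  move=> t01; have := H m (leqnn _) t t01.
  by rewrite subnn /F /= subrK.
elim: k => [_ {}t /andP[t0 t1]|k IH km {}t /andP[t0 t1]].
  have [->|tn0] := eqVneq t 0.
    by rewrite subn0 F0 // normr0 mulr_ge0 // powR_ge0.
  have tp : 0 < t by rewrite lt_neqAle eq_sym tn0.
  rewrite subn0 addr0 -[F m t]subr0 -(F0 m (leqnn _)).
  have nt : `|cst1 t - cst1 0| <= t.
    have -> : cst1 t - cst1 0 = cst1 t by apply/matrixP => i j; rewrite !mxE subr0.
    by rewrite (le_trans (normr_const_mx t)) // ger0_norm.
  have np : 0 < `|cst1 t - cst1 0|.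
    rewrite normr_gt0 subr_eq0; apply/eqP => /matrixP/(_ 0 0).
    by rewrite !mxE => /eqP; rewrite (negbTE tn0).
  have : ((`|F m t - F m 0| / `|cst1 t - cst1 0| `^ (beta - m%:R))%R%:E <= B%:E)%E.
    apply: le_trans semi; apply: ereal_sup_ubound; exists (cst1 t, cst1 0) => //=.
    split.
    - by apply: cube_const; rewrite t0.
    - by apply: cube_const; rewrite lexx ler01.
    - by rewrite -subr_eq0 -normr_gt0.
  rewrite lee_fin ler_pdivrMr ?powR_gt0 // => /le_trans; apply.
  by rewrite ler_wpM2l // ge0_ler_powR ?nnegrE // ltW.
have [->|tn0] := eqVneq t 0.
  by rewrite F0 ?leq_subr // normr0 mulr_ge0 // powR_ge0.
have tp : 0 < t by rewrite lt_neqAle eq_sym tn0.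
set l := (m - k.+1)%N.
have lm : (l < m)%N by rewrite /l; lia.
have [smc _] := smg (nseq l 0); have [_ smd] := smg (nseq l 0).
rewrite size_nseq foldr_nseq in smc smd.
have ml : (m - k)%N = l.+1 by rewrite /l; lia.
have Fd x : x \in `]0, t[ -> is_derive x 1 (F l) (F l.+1 x).
  rewrite in_itv /= => /andP[x0 xt].
  apply: pderiv_is_derive; first by rewrite x0 (lt_le_trans xt).
  by apply: smd => //; apply: cube_const; rewrite !ltW // (lt_le_trans xt).
have [xi xit E] := MVT tp Fd (within_const_mx t1 (smc (ltnW lm))).
move: xit; rewrite in_itv /= => /andP[xi0 xit].
rewrite F0 ?subr0 in E; last exact: ltnW.
rewrite E normrM (ger0_norm t0).
have := IH (ltnW km) xi; rewrite ml => /(_ _) h.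
apply: (@le_trans _ _ (B * xi `^ (beta - m%:R + k%:R) * t)).
  by rewrite ler_wpM2r // h // ltW //= (le_trans (ltW xit)).
rewrite -mulrA ler_wpM2l // -natr1 addrA [t `^ _]powRD; last by rewrite tn0 implybT.
have omk : 0 <= beta - m%:R + k%:R by rewrite addr_ge0 // ltW.
by rewrite powRr1 // ler_wpM2r // ge0_ler_powR ?nnegrE // ltW.
Qed.

End taylor.

(** * Approximation of the Bayes rule *)

Lemma weight_grid_floor (R : realType) c (y : R) : -1 <= y <= 1 ->
  exists2 g, weight_grid c g & g <= y <= g + 2 ^- c.
Proof.
move=> /andP[y1 y2].
have p2 : 0 < 2 ^+ c :> R by rewrite exprn_gt0.
have /andP[f1 f2] := floor_itv (y * 2 ^+ c).
exists ((Num.floor (y * 2 ^+ c))%:~R / 2 ^+ c).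
  exists (Num.floor (y * 2 ^+ c)) => //.
  have e : ((2 ^+ c : int)%:~R = 2 ^+ c :> R) by rewrite rmorphXn.
  rewrite ler_norml; apply/andP; split.
    by rewrite floor_ge_int_tmp intrN e; nra.
  rewrite -(ler_int R) e (le_trans f1) //; nra.
rewrite ler_pdivrMr // f1 /=.
rewrite (_ : _ / _ + _ = ((Num.floor (y * 2 ^+ c))%:~R + 1) / 2 ^+ c); last first.
  by rewrite mulrDl mul1r.
rewrite ler_pdivlMr //.
by move: f2; rewrite intrD => /ltW.
Qed.

(* Nothing is known about the margin near the end points of [[a, b]].  Since
   [t |-> (1 - et) * t + q] moves both end points inwards by at least [e], the
   two tests can only disagree when the true threshold lies in the interior. *)
Lemma threshold_mismatch (R : realType) (i a b t g g' e et w q : R) :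
  i = 1 \/ i = -1 -> a < t < b -> 0 <= et < 1 -> `|g' - g| <= e ->
  a + e <= (1 - et) * a + q -> (1 - et) * b + q <= b - e ->
  `|q - et * t| + e <= w ->
  (i * t <= g) != (i * ((1 - et) * t + q) <= g') ->
  [/\ a < i * g, i * g < b & `|t - i * g| <= w].
Proof.
move=> i1 /andP[at_ tb] /andP[et0 et1] gg' ha hb hw.
have : (1 - et) * a < (1 - et) * t by rewrite ltr_pM2l ?subr_gt0.
have : (1 - et) * t < (1 - et) * b by rewrite ltr_pM2l ?subr_gt0.
move: gg' hw; rewrite ler_norml => /andP[g1 g2].
have n1 := ler_norm (q - et * t); have n2 := ler_norm (- (q - et * t)).
rewrite normrN in n2 => hw.
have -> : (1 - et) * t = t - et * t by ring.
case: i1 => ->; rewrite !(mul1r, mulN1r).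
  case: (lerP t g); case: (lerP (t - et * t + q) g') => // h1 h2 h3 h4 _.
    by split; try lra; rewrite ler_norml; apply/andP; split; lra.
  by split; try lra; rewrite ler_norml; apply/andP; split; lra.
case: (lerP (- t) g); case: (lerP (- (t - et * t + q)) g') => // h1 h2 h3 h4 _.
  by split; try lra; rewrite ler_norml; apply/andP; split; lra.
by split; try lra; rewrite ler_norml; apply/andP; split; lra.
Qed.

Section coord.
Variables (R : realType) (d : nat).
Local Notation point := 'cV[R]_d.
Implicit Types (x y : point) (j : 'I_d).

Lemma set_coordE j x t : set_coord j x t j 0 = t.
Proof. by rewrite mxE eqxx. Qed.

Lemma set_coord_id j x : set_coord j x (x j 0) = x.
Proof. by apply/matrixP => i k; rewrite mxE ord1; case: eqP => [->|]. Qed.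

Lemma set_coord_set j x t s : set_coord j (set_coord j x t) s = set_coord j x s.
Proof. by apply/matrixP => i k; rewrite !mxE; case: eqP. Qed.

Lemma row'_set_coord j x t : row' j (set_coord j x t) = row' j x.
Proof. by apply/matrixP => i k; rewrite !mxE eq_sym (negbTE (neq_lift _ _)) ord1. Qed.

Lemma measurable_set_coord j x : measurable_fun setT (fun t : measurableTypeR R => set_coord j x t).
Proof.
apply: measurable_fun_cVP => i.
have [->|ij] := eqVneq i j.
  by under eq_fun do rewrite mxE eqxx; exact: measurable_id.
by under eq_fun do rewrite mxE (negbTE ij); exact: measurable_cst.
Qed.

Lemma lebesgue_cV_graph_le j (A : set point) (c : point -> R) (w : R) :
  measurable A -> A `<=` @cube R d -> 0 <= w ->
  (forall x t, c (set_coord j x t) = c x) ->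
  (forall x, A x -> `|x j 0 - c x| <= w) ->
  (lebesgue_cV R d A <= (2 * w)%:E)%E.
Proof.
move=> mA Ac w0 cc Aw; apply: (lebesgue_cV_fibre_le (j := j)) => // y.
apply: (@le_trans _ _ (lebesgue_measure (`[c y - w, c y + w]%classic : set R))).
  apply: le_measure; rewrite ?inE //.
    have := measurable_set_coord j y; move=> /(_ measurableT A mA).
    by rewrite setTI.
  move=> t /= /Aw; rewrite set_coordE cc in_itv /= ler_norml => /andP[h1 h2].
  by apply/andP; split; lra.
rewrite lebesgue_measure_itv /= lte_fin; case: ifPn => _; rewrite lee_fin; lra.
Qed.

Definition obox (a b : 'I_d -> R) : set point :=
  [set x | forall i, a i < x i 0 < b i].

Lemma measurable_obox (a b : 'I_d -> R) : measurable (obox a b).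
Proof.
rewrite (_ : obox a b = \bigcap_(i in [set: 'I_d])
    ((fun x : point => x i 0 : measurableTypeR R) @^-1` `]a i, b i[)).
  apply: fin_bigcap_measurable => // i _.
  by rewrite -[X in measurable X]setTI; exact: measurable_coord.
apply/seteqP; split => [x h i _|x h i] /=; first by rewrite in_itv; exact: h.
by have := h i I; rewrite /= in_itv.
Qed.

End coord.

(** A common point would give the intersection positive side lengths in every direction, hence
    positive volume. *)
Lemma box_disjoint (R : realType) d (a1 b1 a2 b2 : 'I_d -> R) (x : 'cV[R]_d) :
  (forall i, a2 i < b2 i) ->
  lebesgue_cV R d (box a1 b1 `&` box a2 b2) = 0%E ->
  obox a1 b1 x -> ~ box a2 b2 x.
Proof.
move=> ab2 l0 xin xb.
have e : box a1 b1 `&` box a2 b2 =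
    [set x | forall i, Num.max (a1 i) (a2 i) <= x i 0 <= Num.min (b1 i) (b2 i)].
  apply/seteqP; split => [y [y1 y2] i|y h].
    by have /andP[? ?] := y1 i; have /andP[? ?] := y2 i; rewrite ge_max le_min; apply/andP; split; apply/andP.
  by split => i; have := h i; rewrite ge_max le_min => /andP[/andP[? ?] /andP[? ?]]; apply/andP.
have lt i : Num.max (a1 i) (a2 i) < Num.min (b1 i) (b2 i).
  have /andP[? ?] := xin i; have /andP[? ?] := xb i; have ? := ab2 i.
  by rewrite gt_max !lt_min; apply/andP; split; apply/andP; split => //; lra.
move: l0; rewrite e lebesgue_cV_box; last by move=> i; exact: ltW.
move=> [] /eqP; rewrite prodf_seq_eq0 => /hasP[i _ /=].
by rewrite subr_eq0 gt_eqF.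
Qed.

Section marginal_bounds.
Variables (R : realType) (d : nat) (Q : probability ('cV[R]_d * bool)%type R) (f : 'cV[R]_d -> R).
Hypothesis fQ : is_regression Q f.
Let mu := marginalX Q.

Lemma marginal_le (M l : R) A : density_bounded Q M -> measurable A ->
  (lebesgue_cV R d A <= l%:E)%E -> fine (mu A) <= M * l.
Proof.
move=> [h [mh hM hE]] mA lA.
have M0 : 0 <= M by have /andP[h1 h2] := hM 0; exact: le_trans h2.
rewrite -lee_fin fineK ?fin_num_measure //.
rewrite -[(mu A)%E]/(marginalX Q A) hE //.
apply: (@le_trans _ _ (\int[lebesgue_cV R d]_(x in A) (cst M%:E x))%E).
  apply: ge0_le_integral => //.
  - by move=> x _; rewrite lee_fin; have /andP[] := hM x.
  - by apply/measurable_EFinP; apply: measurable_funTS.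
  - by move=> x _; rewrite lee_fin; have /andP[] := hM x.
rewrite integral_cst // EFinM; apply: lee_wpmul2l => //.
Qed.

Let g x := `|2 * f x - 1|.

Lemma integrable_margin A : measurable A -> mu.-integrable A (EFin \o g).
Proof.
move=> mA; have [fi _] := fQ.
have : mu.-integrable setT (EFin \o (fun x => 2 * f x - 1)).
  have -> : EFin \o (fun x => 2 * f x - 1) = (fun x => (2%:E * (EFin \o f) x - (cst 1%:E) x)%E) by [].
  apply: integrableB => //; first exact: (integrableZl measurableT _ fi).
  exact: finite_measure_integrable_cst measurableT.
move=> /(integrable_norm) h; exact: (integrableS measurableT).
Qed.

Lemma Rintegral_margin_subset A B : measurable A -> measurable B -> A `<=` B ->
  \int[mu]_(x in A) g x <= \int[mu]_(x in B) g x.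
Proof.
move=> mA mB AB.
have E : B = A `|` (B `\` A) by rewrite setDUK.
have mD : measurable (B `\` A) by exact: measurableD.
rewrite [in leRHS]E Rintegral_setU //; last 2 first.
- by rewrite -E; exact: integrable_margin.
- by apply/disj_setPS => x [Ax [_ nAx]].
by rewrite lerDl Rintegral_abs_ge0.
Qed.

Lemma Rintegral_margin_cover (I : Type) (s : seq I) (A : I -> set 'cV[R]_d) Z :
  (forall i, measurable (A i)) -> measurable Z ->
  Z `<=` \big[setU/set0]_(i <- s) A i ->
  \int[mu]_(x in Z) g x <= \sum_(i <- s) \int[mu]_(x in A i) g x.
Proof.
move=> mA; elim: s Z => [|i s IH] Z mZ.
  by rewrite !big_nil subset0 => ->; rewrite Rintegral_set0.
rewrite !big_cons => ZA.
have E : Z = (Z `&` A i) `|` (Z `\` A i) by rewrite setUIDK.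
have mI : measurable (Z `&` A i) by exact: measurableI.
have mD : measurable (Z `\` A i) by exact: measurableD.
rewrite E Rintegral_setU //; last 2 first.
- by rewrite -E; exact: integrable_margin.
- by apply/disj_setPS => x [[_ ?] [_ ?]].
apply: lerD; first exact: Rintegral_margin_subset.
apply: IH => // x [Zx nAx].
by have [] := ZA _ Zx.
Qed.

Lemma Rintegral_margin_le A (K : R) : measurable A -> (forall x, A x -> g x <= K) ->
  \int[mu]_(x in A) g x <= K * fine (mu A).
Proof.
move=> mA AK; rewrite -Rintegral_cst //; apply: le_Rintegral => //.
  exact: integrable_margin.
exact: finite_measure_integrable_cst.
Qed.

End marginal_bounds.

Lemma closure_cube_set_coord (R : realType) d (A : set 'cV[R]_d) (j : 'I_d) (x : 'cV[R]_d) (c : R) :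
  (forall e, 0 < e -> exists2 t, `|t - c| < e & A (set_coord j x t)) ->
  closure A (set_coord j x c).
Proof.
move=> h B /nbhs_ballP[e /= e0 he]; have [t tc At] := h e e0.
exists (set_coord j x t); split => //; apply: he; split => // i k.
by rewrite !mxE /ball /= distrC; case: eqP => // _; rewrite subrr normr0.
Qed.

Definition piece (R : realType) d (j : 'I_d) (iota : R) (gamma : 'cV[R]_d.-1 -> R)
    (a b : 'I_d -> R) : set 'cV[R]_d :=
  box a b `&` [set x | cube x /\ iota * x j 0 <= gamma (row' j x)].

Section piecewise.
Variables (R : realType) (d : nat) (u : nat).
Variables (j : 'I_u -> 'I_d) (iota : 'I_u -> R) (gamma : 'I_u -> 'cV[R]_d.-1 -> R)
  (a b : 'I_u -> 'I_d -> R).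
Hypothesis iota1 : forall nu, iota nu = 1 \/ iota nu = -1.
Hypothesis ab : forall nu i, [/\ 0 <= a nu i, a nu i < b nu i & b nu i <= 1].
Hypothesis disj : forall nu1 nu2, nu1 != nu2 ->
  lebesgue_cV R d (box (a nu1) (b nu1) `&` box (a nu2) (b nu2)) = 0%E.

Let H := \bigcup_nu piece (j nu) (iota nu) (gamma nu) (a nu) (b nu).

Lemma obox_cube nu x : obox (a nu) (b nu) x -> cube x.
Proof.
move=> h i; have /andP[h1 h2] := h i; have [h3 _ h4] := ab nu i.
by apply/andP; split; apply: ltW; [exact: le_lt_trans h1|exact: lt_le_trans h4].
Qed.

Lemma obox_box nu x : obox (a nu) (b nu) x -> box (a nu) (b nu) x.
Proof. by move=> h i; have /andP[h1 h2] := h i; rewrite !ltW. Qed.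

Lemma obox_unique nu nu' x : obox (a nu) (b nu) x -> box (a nu') (b nu') x -> nu' = nu.
Proof.
move=> xin xb; apply/eqP; apply: contraT => ne; exfalso.
apply: (@box_disjoint R d (a nu) (b nu) (a nu') (b nu') x) => //.
  by move=> i; have [] := ab nu' i.
by apply: disj; rewrite eq_sym.
Qed.

(** Inside an open box no other piece interferes, so membership in the union is a single threshold
    test. *)
Lemma obox_mem nu x : obox (a nu) (b nu) x ->
  H x <-> iota nu * x (j nu) 0 <= gamma nu (row' (j nu) x).
Proof.
move=> xin; split=> [[nu' _ [xb [_ h]]]|h].
  by rewrite -(obox_unique xin xb).
by exists nu => //; split; [exact: obox_box|split => //; exact: obox_cube xin].
Qed.

Lemma obox_set_coord nu x t : obox (a nu) (b nu) x -> a nu (j nu) < t < b nu (j nu) ->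
  obox (a nu) (b nu) (set_coord (j nu) x t).
Proof. by move=> xin tab i; rewrite mxE; case: eqP => [->|]. Qed.

(** The threshold point passes the test with equality, and points slightly beyond it in direction
    [iota] are still in the open box but fail. Only the coordinate [j nu] moves, so the value of
    [gamma] is constant along the approach. *)
Lemma obox_boundary nu x (c := iota nu * gamma nu (row' (j nu) x)) :
  obox (a nu) (b nu) x -> a nu (j nu) < c < b nu (j nu) ->
  cube_boundary H (set_coord (j nu) x c).
Proof.
move=> xin cab; have pin := obox_set_coord xin cab.
have ic : iota nu * c = gamma nu (row' (j nu) x).
  by rewrite /c mulrA; case: (iota1 nu) => ->; rewrite ?mulrNN ?mul1r.
split; [split|]; first exact: obox_cube pin.
  apply: subset_closure; split; first exact: obox_cube pin.
  by apply/(obox_mem pin); rewrite row'_set_coord set_coordE ic.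
move: cab => /andP[ac cb].
apply: closure_cube_set_coord => e e0.
pose s := Num.min (e / 2) (Num.min ((c - a nu (j nu)) / 2) ((b nu (j nu) - c) / 2)).
have s0 : 0 < s by rewrite !lt_min !divr_gt0 ?subr_gt0.
have [se sa sb] : [/\ s <= e / 2, s <= (c - a nu (j nu)) / 2 & s <= (b nu (j nu) - c) / 2].
  by rewrite /s !ge_min !lexx ?orbT.
have tin : a nu (j nu) < c + iota nu * s < b nu (j nu).
  by case: (iota1 nu) => ->; apply/andP; split; lra.
exists (c + iota nu * s).
  rewrite addrC addKr normrM (gtr0_norm s0).
  by case: (iota1 nu) => ->; rewrite ?normrN normr1 mul1r; lra.
have qin := obox_set_coord xin tin.
split; first exact: obox_cube qin.
move/(obox_mem qin); rewrite row'_set_coord set_coordE mulrDr ic mulrA.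
have -> : iota nu * iota nu = 1 by case: (iota1 nu) => ->; rewrite ?mulrNN ?mul1r.
by rewrite mul1r; apply/negP; rewrite -ltNge ltrDl.
Qed.

End piecewise.

Lemma sum_pieces_le (R : realType) (u r d : nat) (X Y : R) :
  (u <= r)%N -> 0 <= X -> 0 <= Y ->
  \sum_(k : 'I_u * 'I_d * bool) X + \sum_(nu < u) Y <= 2 * (r * d)%:R * X + r%:R * Y.
Proof.
move=> ur X0 Y0; rewrite !sumr_const !card_prod !card_ord card_bool.
rewrite -[X *+ _]mulr_natl -[Y *+ _]mulr_natl.
apply: lerD; apply: ler_wpM2r => //; last by rewrite ler_nat.
by rewrite -natrM ler_nat mulnC !leq_mul.
Qed.

Definition strip (R : realType) d (j : 'I_d) (y w : R) : set 'cV[R]_d :=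
  @cube R d `&` [set x | `|x j 0 - y| <= w].

Lemma measurable_strip (R : realType) d (j : 'I_d) (y w : R) : measurable (strip j y w).
Proof.
have E : strip j y w = @cube R d `&`
    (fun x : 'cV[R]_d => x j 0 : measurableTypeR R) @^-1` `[y - w, y + w].
  by apply/seteqP; split => x [cx] /= h; split; move: h => //=; rewrite in_itv /= ler_distl.
rewrite E; apply: measurableI; first exact: measurable_cube.
by rewrite -[X in measurable X]setTI; exact: measurable_coord.
Qed.

Lemma box_strip_cover (R : realType) d (T : Type) (a b : T -> 'I_d -> R) (w : R)
    (x : 'cV[R]_d) :
  0 <= w -> cube x -> (exists nu, box (a nu) (b nu) x) ->
  (exists nu i, strip i (a nu i) w x \/ strip i (b nu i) w x) \/
  exists nu, obox (fun i => a nu i + w) (fun i => b nu i - w) x.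
Proof.
move=> w0 cx [nu xb]; apply: contrapT => /not_orP[nstrip nin].
apply: nin; exists nu => i; have /andP[h1 h2] := xb i.
have /not_orP[sa sb] : ~ (strip i (a nu i) w x \/ strip i (b nu i) w x).
  by move=> h; apply: nstrip; exists nu, i.
apply/andP; split; rewrite ltNge; apply/negP => h.
  by apply: sa; split => //=; rewrite ler_distl; apply/andP; split; lra.
by apply: sb; split => //=; rewrite ler_distl; apply/andP; split; lra.
Qed.

(** Corners are rounded inwards, the lower one by negating the floor of [- a], so the rounded box
    stays within the original. *)
Lemma grid_box (R : realType) c (a b : R) : 0 <= a -> a < b -> b <= 1 ->
  exists ab : R * R, [/\ weight_grid c ab.1, weight_grid c ab.2,
    a <= ab.1 <= a + 2 ^- c & b - 2 ^- c <= ab.2 <= b].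
Proof.
move=> a0 ab b1.
have [|g gg /andP[g1 g2]] := @weight_grid_floor R c (- a); first by apply/andP; split; lra.
have [|h gh /andP[h1 h2]] := @weight_grid_floor R c b; first by apply/andP; split; lra.
exists (- g, h); split => //=; first exact: weight_gridN.
  by apply/andP; split; lra.
by apply/andP; split; lra.
Qed.

(** Contraction about the midpoint with ratio [1 - et] and [et] about [4 e / h] moves each end point
    inwards by at least [2 e]; rounding [q] costs at most [e] of this. In [4 / h + 3] the 3 collects
    the roundings of [et] and [q] and one further [e] for the error of the boundary network. *)
Lemma grid_contraction (R : realType) c (e h : R) :
  0 < e -> 0 < h -> 2 ^- c <= e -> (4 / h + 3) * e < 1 ->
  exists et, [/\ weight_grid c (1 - et), 0 <= et < 1 &
    forall a b, 0 <= a -> b <= 1 -> h <= b - a -> exists q, [/\ weight_grid c q,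
      a + e <= (1 - et) * a + q, (1 - et) * b + q <= b - e &
      forall t, 0 <= t <= 1 -> `|q - et * t| + e <= (4 / h + 3) * e]].
Proof.
move=> e0 h0 ce We.
have he0 : 0 <= 4 * e / h by rewrite divr_ge0 ?mulr_ge0 ?ltW.
have eW : (4 / h + 3) * e = 4 * e / h + 3 * e by rewrite mulrDl mulrAC.
have p0 : 0 <= 2 ^- c :> R by rewrite invr_ge0 exprn_ge0.
move: (2 ^- c) (@weight_grid_floor R c) ce p0 => dl gfl ce p0.
have [|zt gzt /andP[zt1 zt2]] := gfl (1 - 4 * e / h); first by apply/andP; split; lra.
have ztE : 1 - (1 - zt) = zt by ring.
have et0 : 0 <= 1 - zt by lra.
have et1 : 1 - zt < 1 by lra.
exists (1 - zt); rewrite ztE; split => // [|a b a0 b1 hab]; first by rewrite et0.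
have [|q gq /andP[q1 q2]] := gfl ((1 - zt) * ((a + b) / 2)).
  by apply/andP; split; nra.
have ete : 4 * e <= (1 - zt) * (b - a).
  have : 4 * e / h * h <= (1 - zt) * (b - a) by apply: ler_pM => //; lra.
  by rewrite divfK // gt_eqF.
exists q; split => // [||t /andP[t0 t1]]; try lra.
have : `|q - (1 - zt) * t| <= 1 - zt + dl; last lra.
by rewrite ler_norml; apply/andP; split; nra.
Qed.

Section margin_integrals.
Variables (R : realType) (d : nat) (Q : probability ('cV[R]_d * bool)%type R)
  (f : 'cV[R]_d -> R) (M : R).
Hypotheses (fQ : is_regression Q f) (dQ : density_bounded Q M).

(** Near a face the margin is unknown and the whole mass of the strip is paid. This is why
    [approx_bayes] asks for a grid of mesh [e^kappa] rather than [e]. *)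
Lemma strip_margin_le (j : 'I_d) (y w : R) : 0 <= w ->
  \int[marginalX Q]_(x in strip j y w) `|2 * f x - 1| <= 2 * M * w.
Proof.
move=> w0; have mS := measurable_strip j y w.
apply: le_trans (Rintegral_abs_le fQ mS) _; rewrite mulrAC mulrC.
apply: (marginal_le dQ mS); apply: (@lebesgue_cV_graph_le R d j _ (fun=> y)) => //.
  by move=> x [].
by move=> x [].
Qed.

(** The factor [1 + B] serves two cases: for [beta = 0] there is no margin condition and the mass
    alone is used; for [beta > 0] the mass is multiplied by the margin [B w^beta]. *)
Lemma graph_margin_le (j : 'I_d) (A : set 'cV[R]_d) (c : 'cV[R]_d -> R) (beta B w : R) :
  measurable A -> A `<=` @cube R d -> 0 < w -> 0 <= beta -> 0 <= B ->
  (forall x t, c (set_coord j x t) = c x) ->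
  (forall x, A x -> `|x j 0 - c x| <= w) ->
  (0 < beta -> forall x, A x -> `|2 * f x - 1| <= B * w `^ beta) ->
  \int[marginalX Q]_(x in A) `|2 * f x - 1| <= 2 * M * (1 + B) * w `^ (1 + beta).
Proof.
move=> mA Ac w0 beta0 B0 cc Aw Af.
have muA : fine (marginalX Q A) <= M * (2 * w).
  by apply: (marginal_le dQ mA); apply: (lebesgue_cV_graph_le mA Ac _ cc Aw); exact: ltW.
have muA0 : 0 <= fine (marginalX Q A) by rewrite fine_ge0.
have wb0 : 0 <= w `^ beta by exact: powR_ge0.
have -> : 2 * M * (1 + B) * w `^ (1 + beta) = (1 + B) * w `^ beta * (M * (2 * w)).
  rewrite powRD ?powRr1 ?(ltW w0) //; first ring.
  by rewrite (gt_eqF w0) implybT.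
apply: (@le_trans _ _ ((1 + B) * w `^ beta * fine (marginalX Q A))); last first.
  by apply: ler_wpM2l => //; rewrite mulr_ge0 // addr_ge0.
have [beta00|betan0] := eqVneq beta 0.
  apply: le_trans (Rintegral_abs_le fQ mA) _.
  by rewrite beta00 powRr0 mulr1 ler_peMl // lerDl.
apply: (Rintegral_margin_le fQ mA) => x Ax.
apply: le_trans (Af _ _ Ax) _; first by rewrite lt_neqAle eq_sym betan0.
by apply: ler_wpM2r => //; rewrite lerDr.
Qed.

End margin_integrals.

(** The margin condition is invoked at the boundary point on the line through [x] in direction [j],
    and evaluated at [x] itself. The bound [w < 1] keeps the distance in the domain of [g]. *)
Lemma margin_pointwise (R : realType) d (j : 'I_d) (f : 'cV[R]_d -> R) (beta B eps c w : R)
    (g : 'cV[R]_1 -> R) (x : 'cV[R]_d) :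
  0 < beta -> 0 <= B -> cube x -> `|x j 0 - c| <= w -> w <= eps -> w < 1 ->
  holder_class0 beta B g ->
  (forall t : R, Num.max 0 (set_coord j x c j 0 - eps) <= t
      <= Num.min 1 (set_coord j x c j 0 + eps) ->
    `|2 * f (set_coord j (set_coord j x c) t) - 1| <= g (const_mx `|t - set_coord j x c j 0|)) ->
  `|2 * f x - 1| <= B * w `^ beta.
Proof.
move=> b0 B0 cx xc we w1 gH h.
have := h (x j 0); rewrite set_coord_set set_coord_id set_coordE.
have /andP[x0 x1] := cx j.
move: (xc); rewrite ler_norml => /andP[xc1 xc2].
move=> /(_ _) hx; apply: le_trans (hx _) _.
  by rewrite ge_max le_min x0 x1 /=; apply/andP; split; lra.
apply: le_trans (ler_norm _) _.
have xc01 : 0 <= `|x j 0 - c| <= 1 by rewrite normr_ge0 /= (le_trans xc) // ltW.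
apply: le_trans (holder_class0_bound b0 B0 gH xc01) _.
apply: ler_wpM2l => //; rewrite ge0_ler_powR ?nnegrE ?(ltW b0) //.
exact: le_trans xc.
Qed.

(** In [K], the first term counts at most [2 r d] face strips at [2 M e^kappa] each, the second at
    most [r] graph neighbourhoods of half-width [(4 / eps2 + 3) e]. *)
Lemma approx_bayes (R : realType) (d : nat) (Q : probability ('cV[R]_d * bool)%type R)
    (f : 'cV[R]_d -> R) (beta B eps1 eps2 M : R) (r : nat)
    (F : set ('cV[R]_d.-1 -> R)) (kappa : R := 1 + beta)
    (e : R) (c c0 L s : nat)
    (K := (4 * (r * d)%:R * M + 2 * r%:R * M * (1 + B) * (4 / eps2 + 3) `^ kappa)) :
  is_regression Q f -> 0 < M -> density_bounded Q M -> 0 <= beta -> 0 <= B ->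
  0 < eps1 -> 0 < eps2 ->
  piecewise_class f beta B eps1 eps2 r F (bayes_rule f) ->
  0 < e -> (4 / eps2 + 3) * e <= eps1 -> (4 / eps2 + 3) * e < 1 ->
  2 ^- c <= e `^ kappa -> (c0 <= c)%N ->
  (forall gamma, F gamma -> exists Phi : relu_net R 1 d.-1,
     [/\ (nlayers Phi <= L)%N, (sparsity Phi <= s)%N, weights_in (weight_grid c0) Phi &
         forall x, cube x -> `|realization Phi x 0 0 - gamma x| <= e]) ->
  exists Psi : relu_net R 1 d,
    [/\ (nlayers Psi <= r * (L + 4) + 2)%N,
        (sparsity Psi <= r * (2 * s + L * d.+1 + stage_cost d) + union_cost d)%N,
        weights_in (weight_grid c) Psi &
        let G := [set x | cube x /\ realization Psi x 0 0 = 1] in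
        measurable G -> d_f Q f G (bayes_rule f) <= K * e `^ kappa].
Proof.
move=> fQ M0 dQ b0 B0 e10 e20 [u [j [iota [gamma [a [b [Hnu [ur hnu Heq [HnuE disj bd bj]]]]]]]]].
move=> e0 We1 W1 ce cc happ.
have iota1 nu : iota nu = 1 \/ iota nu = -1 by have [] := hnu nu.
have ab nu i : [/\ 0 <= a nu i, a nu i < b nu i & b nu i <= 1] by have [_ _] := hnu nu.
have dl0 : 0 < 2 ^- c :> R by rewrite invr_gt0 exprn_gt0.
have W0 : 0 < 4 / eps2 + 3 by rewrite addr_gt0 // divr_gt0.
have We0 : 0 < (4 / eps2 + 3) * e by rewrite mulr_gt0.
have dle : 2 ^- c <= e.
  have e1 : e <= 1.
    apply: le_trans (ltW W1); rewrite ler_peMl ?(ltW e0) //.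
    have h4 : 0 < 4 / eps2 by rewrite divr_gt0.
    lra.
  by apply: le_trans ce _; rewrite ge1r_powR ?e0 // lerDl.
have [Phi PhiP] : {Phi : 'I_u -> relu_net R 1 d.-1 & forall nu,
     [/\ (nlayers (Phi nu) <= L)%N, (sparsity (Phi nu) <= s)%N, weights_in (weight_grid c0) (Phi nu) &
         forall x, cube x -> `|realization (Phi nu) x 0 0 - gamma nu x| <= e]}.
  apply: (@choice _ _ (fun nu Phi => [/\ (nlayers Phi <= L)%N, (sparsity Phi <= s)%N,
     weights_in (weight_grid c0) Phi & forall x, cube x -> `|realization Phi x 0 0 - gamma nu x| <= e])) => nu.
  by apply: happ; have [] := hnu nu.
have [et [get et01 etP]] := grid_contraction e0 e20 dle W1.
have [q qP] : {q : 'I_u -> R & forall nu, [/\ weight_grid c (q nu),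
     a nu (j nu) + e <= (1 - et) * a nu (j nu) + q nu,
     (1 - et) * b nu (j nu) + q nu <= b nu (j nu) - e &
     forall t, 0 <= t <= 1 -> `|q nu - et * t| + e <= (4 / eps2 + 3) * e]}.
  apply: (@choice _ _ (fun nu q => [/\ weight_grid c q,
     a nu (j nu) + e <= (1 - et) * a nu (j nu) + q,
     (1 - et) * b nu (j nu) + q <= b nu (j nu) - e &
     forall t, 0 <= t <= 1 -> `|q - et * t| + e <= (4 / eps2 + 3) * e])) => nu.
  by have [a0 _ b1] := ab nu (j nu); exact: etP (bj nu).
have [gab gabP] : {ab' : 'I_u * 'I_d -> R * R & forall k, [/\ weight_grid c (ab' k).1,
    weight_grid c (ab' k).2, a k.1 k.2 <= (ab' k).1 <= a k.1 k.2 + 2 ^- c &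
    b k.1 k.2 - 2 ^- c <= (ab' k).2 <= b k.1 k.2]}.
  apply: (@choice _ _ (fun (k : 'I_u * 'I_d) (ab' : R * R) => [/\ weight_grid c ab'.1,
    weight_grid c ab'.2, a k.1 k.2 <= ab'.1 <= a k.1 k.2 + 2 ^- c &
    b k.1 k.2 - 2 ^- c <= ab'.2 <= b k.1 k.2])) => -[nu i] /=.
  by have [? ? ?] := ab nu i; exact: grid_box.
pose a' nu i := (gab (nu, i)).1; pose b' nu i := (gab (nu, i)).2.
have ga nu i : weight_grid c (a' nu i) by have [] := gabP (nu, i).
have gb nu i : weight_grid c (b' nu i) by have [] := gabP (nu, i).
have box_sub nu x : box (a' nu) (b' nu) x -> box (a nu) (b nu) x.
  move=> h i; have /andP[h1 h2] := h i; have [_ _ /andP[h3 _] /andP[_ h4]] := gabP (nu, i).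
  by rewrite (le_trans h3 h1) (le_trans h2 h4).
have giota nu g : weight_grid c g -> weight_grid c (iota nu * g).
  by case: (iota1 nu) => ->; rewrite ?mul1r ?mulN1r //; exact: weight_gridN.
have gPhi nu : weights_in (weight_grid c) (Phi nu).
  have [_ _ + _] := PhiP nu; apply: weights_in_sub => w; exact: weight_grid_le.
have gq nu : weight_grid c (q nu) by have [] := qP nu.
have lPhi nu : (nlayers (Phi nu) <= L)%N by have [] := PhiP nu.
have sPhi nu : (sparsity (Phi nu) <= s)%N by have [] := PhiP nu.
have [Psi [lP sP gP PsiE]] := union_net j gPhi (fun nu => giota nu _ get)
  (fun nu => giota nu _ (gq nu)) ga gb lPhi sPhi.
rewrite card_ord in lP sP.
exists Psi; split => //.
- by apply: leq_trans lP _; rewrite leq_add2r leq_mul2r ur orbT.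
- by apply: leq_trans sP _; rewrite leq_add2r leq_mul2r ur orbT.
move=> G mG.
have GE x : cube x -> G x <-> exists nu, box (a' nu) (b' nu) x /\
    iota nu * ((1 - et) * x (j nu) 0 + q nu) <= realization (Phi nu) (row' (j nu) x) 0 0.
  move=> cx; rewrite /G /= PsiE //; split=> [[_ [nu [h1 h2]]]|[nu [h1 h2]]].
    by exists nu; split=> //; rewrite mulrDr mulrA.
  by split => //; exists nu; split=> //; rewrite -mulrA -mulrDr.
have mH := measurable_bayes_rule fQ.
have HE : bayes_rule f = \bigcup_nu piece (j nu) (iota nu) (gamma nu) (a nu) (b nu).
  by rewrite Heq; apply: eq_bigcupr => nu _; rewrite HnuE.
pose Z := G `+` bayes_rule f.
have mZ : measurable Z by apply: measurableU; exact: measurableD.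
have Zc : Z `<=` @cube R d by move=> x [[[]]|[[]]].
have Zbox x : Z x -> exists nu, box (a nu) (b nu) x.
  move=> Zx; case: (Zx) => -[+ _].
    by move=> /(GE _ (Zc _ Zx))[nu [/box_sub]]; exists nu.
  by rewrite HE => -[nu _ []]; exists nu.
(* On [ins nu] the point lies in both the true and the rounded box, and in no other box. A point of
   [Z] there makes the two threshold tests disagree, which is the situation of
   [threshold_mismatch]. *)
pose ins nu : set 'cV[R]_d := obox (fun i => a nu i + 2 ^- c) (fun i => b nu i - 2 ^- c).
pose A (k : ('I_u * 'I_d * bool) + 'I_u) : set 'cV[R]_d :=
  match k with
  | inl k => strip k.1.2 (if k.2 then b k.1.1 k.1.2 else a k.1.1 k.1.2) (2 ^- c)
  | inr nu => Z `&` ins nu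
  end.
have mA k : measurable (A k).
  case: k => [k|nu] /=; first exact: measurable_strip.
  by apply: measurableI => //; exact: measurable_obox.
have ZA : Z `<=` \big[setU/set0]_(k : ('I_u * 'I_d * bool) + 'I_u) A k.
  move=> x Zx; rewrite -bigcup_seq.
  have [[nu [i [sx|sx]]]|[nu xin]] := box_strip_cover (ltW dl0) (Zc _ Zx) (Zbox _ Zx).
  - by exists (inl (nu, i, false)) => //=; rewrite mem_index_enum.
  - by exists (inl (nu, i, true)) => //=; rewrite mem_index_enum.
  - by exists (inr nu) => //=; rewrite mem_index_enum.
have ins_box nu x : ins nu x -> box (a' nu) (b' nu) x.
  move=> xin i; have /andP[h1 h2] := xin i.
  have [_ _ /andP[_ h3] /andP[h4 _]] := gabP (nu, i).
  by rewrite (le_trans h3 (ltW h1)) (le_trans (ltW h2) h4).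
have ins_obox nu x : ins nu x -> obox (a nu) (b nu) x.
  move=> xin i; have /andP[h1 h2] := xin i.
  by rewrite (le_lt_trans _ h1) ?lerDl ?(ltW dl0) // (lt_le_trans h2) // gerBl ltW.
have Zin nu x : (Z `&` ins nu) x ->
    let c := iota nu * gamma nu (row' (j nu) x) in
    a nu (j nu) < c < b nu (j nu) /\ `|x (j nu) 0 - c| <= (4 / eps2 + 3) * e.
  move=> [Zx xin] cc'.
  have xi := ins_obox _ _ xin; have cx := Zc x Zx.
  have crow : cube (row' (j nu) x) by move=> i; rewrite mxE; exact: cx.
  have [_ _ _ Pe] := PhiP nu; have [_ qa qb qt] := qP nu.
  have Hx : bayes_rule f x <-> iota nu * x (j nu) 0 <= gamma nu (row' (j nu) x).
    by rewrite HE; exact: (obox_mem j iota gamma ab disj xi).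
  have Gx : G x <-> iota nu * ((1 - et) * x (j nu) 0 + q nu) <= realization (Phi nu) (row' (j nu) x) 0 0.
    rewrite (GE _ cx); split=> [[nu' [/box_sub xb' h]]|h].
      by rewrite -(obox_unique ab disj xi xb').
    by exists nu; split => //; exact: ins_box.
  have ne : (iota nu * x (j nu) 0 <= gamma nu (row' (j nu) x)) !=
      (iota nu * ((1 - et) * x (j nu) 0 + q nu) <= realization (Phi nu) (row' (j nu) x) 0 0).
    apply/eqP => E; case: Zx => -[].
      by move=> /Gx; rewrite -E => /Hx.
    by move=> /Hx; rewrite E => /Gx.
  have [h1 h2 h3] :=
    threshold_mismatch (iota1 nu) (xi (j nu)) et01 (Pe _ crow) qa qb (qt _ (cx (j nu))) ne.
  by rewrite h1.
rewrite /d_f -/Z.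
apply: le_trans (Rintegral_margin_cover fQ mA mZ ZA) _; rewrite big_sumType /=.
have ek0 : 0 <= e `^ kappa by exact: powR_ge0.
apply: (@le_trans _ _ (\sum_(k : 'I_u * 'I_d * bool) 2 * M * e `^ kappa +
   \sum_(nu < u) 2 * M * (1 + B) * ((4 / eps2 + 3) * e) `^ kappa)).
  apply: lerD; apply: ler_sum => k _.
    apply: le_trans (strip_margin_le fQ dQ _ _ (ltW dl0)) _.
    by apply: ler_wpM2l => //; rewrite mulr_ge0 // ltW.
  apply: (graph_margin_le fQ dQ (j := j k) (c := fun x => iota k * gamma k (row' (j k) x))) => //.
  - exact: (mA (inr k)).
  - by move=> x [/Zc].
  - by move=> x t; rewrite row'_set_coord.
  - by move=> x /Zin[].
  - move=> bp x Zx; have [cab xc] := Zin k x Zx.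
    have xi := ins_obox _ _ Zx.2.
    have [|g gH gE] := bd bp k (set_coord (j k) x (iota k * gamma k (row' (j k) x))).
      split; first exact: (obox_box (obox_set_coord xi cab)).
      by rewrite HE; exact: obox_boundary.
    exact: (margin_pointwise bp B0 (Zc _ Zx.1) xc We1 W1 gH gE).
rewrite powRM ?(ltW W0) ?(ltW e0) //.
apply: le_trans (sum_pieces_le d ur _ _) _; rewrite ?mulr_ge0 ?powR_ge0 ?addr_ge0 ?(ltW M0) //.
by rewrite /K le_eqVlt; apply/orP; left; apply/eqP; ring.
Qed.

(** * Empirical risk minimization over a finite class *)

Lemma limn_esup_lty (R : realType) (u : (\bar R)^nat) (C : R) :
  (\forall n \near \oo, u n <= C%:E)%E -> (limn_esup u < +oo)%E.
Proof.
move=> uC; apply: le_lt_trans (ltry C).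
apply: le_trans (ereal_inf_lbound _) _; first by exists [set n | (u n <= C%:E)%E].
by apply: ge_ereal_sup => _ [n nC <-].
Qed.

Lemma measurable_realization (R : realType) k m (Phi : relu_net R k m) :
  measurable_fun setT (realization Phi).
Proof.
have mlin p q (W : 'M[R]_(p, q)) (i : 'I_p) :
    measurable_fun setT (fun x : 'cV[R]_q => (W *m x) i 0 : measurableTypeR R).
  under eq_fun do rewrite mxE.
  apply: measurable_sum => j; apply: measurable_funM => //; exact: measurable_coord.
elim: Phi => [m' W|m' m1 W b Psi IH] /=.
  by apply: measurable_fun_cVP => i; exact: mlin.
apply: (measurableT_comp IH); apply: measurable_fun_cVP => i.
under eq_fun do rewrite mxE.
apply: measurable_maxr => //.
under eq_fun do rewrite mxE.
by apply: measurable_funD => //; exact: mlin.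
Qed.

Lemma net_sets_sub_cube (R : realType) d (L s : R) c G :
  net_sets L s c G -> G `<=` @cube R d.
Proof. by move=> [Phi [_ _ _ ->]] x []. Qed.

Lemma measurable_net_sets (R : realType) d (L s : R) c (G : set 'cV[R]_d) :
  net_sets L s c G -> measurable G.
Proof.
move=> [Phi [_ _ _ ->]]; apply: measurableI; first exact: measurable_cube.
have mPhi : measurable_fun setT (fun x => realization Phi x 0 0 : measurableTypeR R).
  exact: (measurableT_comp (measurable_coord 0) (measurable_realization Phi)).
have := mPhi measurableT [set 1] (measurable_set1 1).
by rewrite setTI.
Qed.

Section erm_expectation.
Variables (R : realType) (d : nat) (Q : probability ('cV[R]_d * bool)%type R) (f : 'cV[R]_d -> R).
Hypothesis fQ : is_regression Q f.
Local Notation obs := ('cV[R]_d * bool)%type.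
Let df G := d_f Q f G (bayes_rule f).

Lemma measurable_empirical_risk n G : measurable G ->
  measurable_fun setT (fun z : n.-tuple obs => empirical_risk z G).
Proof.
move=> mG; apply: measurable_funM => //.
apply: (@measurable_sum _ _ _ _ _ _ (fun i z => loss G (tnth z i))) => i.
exact: (measurableT_comp (measurable_loss mG) (measurable_tnth i)).
Qed.

(* [X] need not be measurable in the sample, [Ghat] being an arbitrary selection of minimizers. *)
Lemma erm_expectation_le n (NN : set (set 'cV[R]_d)) (Ghat : n.-tuple obs -> set 'cV[R]_d)
    (I : finType) (F : I -> set 'cV[R]_d) (G' : set 'cV[R]_d) (t q Kv kappa C al : R)
    (X : n.-tuple obs -> R) :
  (forall z, is_argmin NN (empirical_risk z) (Ghat z)) ->
  (forall G, NN G -> measurable G /\ G `<=` @cube R d) ->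
  (forall G, NN G -> exists i, G = F i) ->
  NN G' -> df G' <= t / 2 -> 0 < t -> 0 <= q -> 0 <= C -> 1 <= Kv -> 1 <= kappa ->
  (forall G, NN G -> t <= df G -> d_Delta Q G' G <= Kv * df G `^ kappa^-1) ->
  (forall G, NN G -> t <= df G -> al <= df G ^+ 2 / (32 * (Kv * df G `^ kappa^-1))) ->
  (forall z, 0 <= X z <= C * df (Ghat z) `^ q) ->
  ('E_(iid Q n)[X] <= (C * (t `^ q + #|I|%:R * expR (- (n%:R * al))))%R%:E)%E.
Proof.
move=> argm mNN cov G'N G't t0 q0 C0 Kv1 kap1 Dl al_le XE.
have mB := measurable_bayes_rule fQ.
(* The cover may contain sets outside the class. These, and the sets of excess risk below [t], are
   given the empty event. *)
pose S i := `[< NN (F i) /\ t <= df (F i) >].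
pose B i : set (n.-tuple obs) :=
  if S i then [set z | empirical_risk z (F i) <= empirical_risk z G'] else set0.
have [mG' G'c] := mNN _ G'N.
have mBi i : measurable (B i).
  rewrite /B; case: ifPn => // /asboolP[/mNN[mF _] _].
  rewrite (_ : [set z | _] = (fun z => empirical_risk z G' - empirical_risk z (F i)) @^-1` `[0, +oo[).
    rewrite -[X in measurable X]setTI.
    by apply: measurable_funB => //; exact: measurable_empirical_risk.
  by apply/seteqP; split => z /=; rewrite in_itv /= andbT subr_ge0.
have PB i : (iid Q n (B i) <= (expR (- (n%:R * al)))%:E)%E.
  rewrite /B; case: ifPn => [/asboolP[Fi tF]|_]; last by rewrite measure0 lee_fin expR_ge0.
  have [mF Fc] := mNN _ Fi.
  have D0 : 0 < df (F i) by exact: lt_le_trans tF.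
  have D1 : df (F i) <= 1 by exact: d_f_le1.
  (* With [1 <= Kv] this yields the side condition [D <= 4 * V] of the Chernoff bound. *)
  have DD : df (F i) <= df (F i) `^ kappa^-1.
    by rewrite ger1_powR ?D0 // invf_le1 // (lt_le_trans ltr01).
  have Dp0 : 0 < df (F i) `^ kappa^-1 by exact: powR_gt0.
  apply: le_trans (@empirical_risk_le_prob R d Q f fQ n (F i) G' (Kv * df (F i) `^ kappa^-1) mF mG' Fc G'c _ _ _) _.
  - by rewrite -/(df G') -/(df (F i)); lra.
  - exact: Dl.
  - by rewrite -/(df (F i)) D0 /=; nra.
  - by rewrite lee_fin ler_expR lerN2 ler_wpM2l // al_le.
(* A measurable majorant of [X]: either the excess risk of the minimizer is below [t], or an event
   [B i] occurs and contributes 1, which suffices because excess risks are at most 1. *)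
pose Y z : \bar R := (C%:E * ((t `^ q)%:E + \sum_(i <- index_enum I) (\1_(B i) z)%:E))%E.
rewrite unlock; apply: (@le_trans _ _ (\int[iid Q n]_z Y z)%E).
  apply: ge0_le_integral_nomeas => z; first by rewrite lee_fin; have /andP[] := XE z.
  have /andP[_ Xz] := XE z; rewrite /Y sumEFin -EFinD -EFinM lee_fin.
  apply: le_trans Xz _; rewrite ler_wpM2l //.
  have [GN Gmin] := argm z.
  have [mG Gc] := mNN _ GN.
  have s0 : 0 <= \sum_(i <- index_enum I) \1_(B i) z :> R.
    by apply: sumr_ge0 => i _; rewrite indicE.
  have df0 : 0 <= df (Ghat z) by exact: Rintegral_abs_ge0.
  have [tG|Gt] := leP t (df (Ghat z)); last first.
    by rewrite ler_wpDr // ge0_ler_powR ?nnegrE // ltW.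
  have [i Fi] := cov _ GN.
  have Si : S i by apply/asboolP; rewrite -Fi.
  apply: (@le_trans _ _ 1).
    rewrite -[leRHS](powRr0 (df (Ghat z))) ger_powR // (lt_le_trans t0 tG).
    exact: d_f_le1.
  rewrite ler_wpDl ?powR_ge0 // (bigD1 i) //= indicE mem_set; last first.
    by rewrite /B Si /= -Fi; exact: Gmin.
  by rewrite lerDl; apply: sumr_ge0 => k _; rewrite indicE.
have mY1 i : measurable_fun setT (fun z => (\1_(B i) z)%:E : \bar R).
  by apply/measurable_EFinP; exact: measurable_indic.
have mYs : measurable_fun setT (fun z => \sum_(i <- index_enum I) (\1_(B i) z)%:E : \bar R)%E.
  exact: emeasurable_sum.
have Ys0 z : (0 <= \sum_(i <- index_enum I) (\1_(B i) z)%:E :> \bar R)%E.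
  by apply: sume_ge0 => i _; rewrite lee_fin indicE.
rewrite /Y ge0_integralZl //; last 2 first.
- by apply: emeasurable_funD.
- by move=> z _; rewrite adde_ge0 // lee_fin powR_ge0.
rewrite ge0_integralD //; last first.
  by move=> z _; rewrite lee_fin powR_ge0.
rewrite integral_cst // ge0_integral_sum //.
rewrite EFinM; apply: lee_wpmul2l; first by rewrite lee_fin.
rewrite EFinD; apply: leeD.
  rewrite [X in (_ * X)%E](_ : _ = 1%E) ?mule1 //; exact: probability_setT.
rewrite mulr_natl -sumr_const.
apply: (@le_trans _ _ (\sum_(i <- index_enum I) (expR (- (n%:R * al)))%:E)%E).
  by apply: lee_sum => i _; rewrite integral_indic // setIT; exact: PB.
by rewrite sumEFin.
Qed.

End erm_expectation.

(** * Asymptotics of the rate *)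

Lemma near_powR_ge (R : realType) (A a : R) : 0 < a ->
  \forall n \near \oo, A <= n%:R `^ a.
Proof.
move=> a0; near=> n.
have nA : (Num.truncn (Num.max A 0 `^ a^-1)).+1%:R <= n%:R :> R.
  by rewrite ler_nat; near: n; exact: nbhs_infty_ge.
apply: (@le_trans _ _ (Num.max A 0)); first by rewrite le_max lexx.
have -> : Num.max A 0 = (Num.max A 0 `^ a^-1) `^ a.
  by rewrite -powRrM mulVf ?gt_eqF // powRr1 // le_max lexx orbT.
rewrite ge0_ler_powR ?nnegrE ?powR_ge0 ?(ltW a0) //.
by apply: le_trans nA; exact: ltW (truncnS_gt _).
Unshelve. all: by end_near. Qed.

Lemma near_ln_ge (R : realType) (A : R) : \forall n \near \oo, A <= ln n%:R.
Proof.
near=> n.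
have nA : expR A <= n%:R.
  by rewrite -[n%:R]powRr1 //; near: n; exact: near_powR_ge.
by rewrite -[A]expRK ler_ln ?posrE ?expR_gt0 // (lt_le_trans (expR_gt0 A)).
Unshelve. all: by end_near. Qed.

(** For an integer [k > b], one has [x^b <= x^k <= k! e^x] by one term of the exponential series. *)
Lemma powR_expRN_bounded (R : realType) (b : R) : 0 <= b ->
  exists2 C : R, 0 <= C & forall x, 1 <= x -> x `^ b * expR (- x) <= C.
Proof.
move=> b0; pose k := (Num.truncn b).+1; exists k`!%:R => // x x1.
have x0 : 0 < x by exact: lt_le_trans x1.
have xk : x `^ b <= x ^+ k.
  by rewrite -powR_mulrn ?(ltW x0) // ler_powR // ltW // truncnS_gt.
have kx : x ^+ k <= k`!%:R * expR x.
  have f0 : 0 < k`!%:R :> R by rewrite ltr0n fact_gt0.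
  rewrite mulrC -ler_pdivrMr //.
  by apply: le_trans (expR_ge1Dxn (Num.truncn b) (ltW x0)); rewrite lerDr.
by rewrite expRN ler_pdivrMr ?expR_gt0 // (le_trans xk).
Qed.

Section tau_asymptotics.
Variables (R : realType) (kappa rho : R).
Hypotheses (kappa1 : 1 <= kappa) (rho0 : 0 < rho).
Let theta := (2 * kappa + rho - 1)^-1.
Let den0 : 0 < 2 * kappa + rho - 1. Proof. by move: kappa1 rho0; lra. Qed.
Let theta0 : 0 < theta. Proof. by rewrite invr_gt0. Qed.
Let theta1 : theta <= 1. Proof. by rewrite invf_le1 //; move: kappa1 rho0; lra. Qed.
Let thetarho1 : theta * rho <= 1.
Proof. by rewrite mulrC ler_pdivrMr //; move: kappa1; lra. Qed.

Lemma near_tau_ge A : \forall n \near \oo, A <= tau kappa rho n.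
Proof.
(* Chosen so that [(n^a)^(2 / rho) = n^(theta / 2)]: the logarithm in [tau] then consumes only half
   of the power of [n]. *)
pose a := theta * rho / 4.
have a0 : 0 < a by rewrite divr_gt0 // mulr_gt0.
have b0 : 0 < 2 / rho by rewrite divr_gt0.
near=> n.
have n1 : 1 <= ln n%:R :> R by near: n; exact: near_ln_ge.
have n0 : 0 < n%:R :> R.
  by rewrite ltNge; apply/negP => /ln0 n0; move: n1; rewrite n0; lra.
have la : a * ln n%:R <= n%:R `^ a.
  rewrite /powR gt_eqF //; apply: le_trans (expR_ge1Dx _); lra.
have lp : (ln n%:R) `^ (2 / rho) <= n%:R `^ (theta / 2) * a `^ (- (2 / rho)).
  have -> : n%:R `^ (theta / 2) = (n%:R `^ a) `^ (2 / rho).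
    by rewrite -powRrM; congr (_ `^ _); rewrite /a; field; rewrite gt_eqF.
  rewrite powRN ler_pdivlMr ?powR_gt0 // -powRM; [|lra|lra].
  rewrite ge0_ler_powR ?nnegrE ?powR_ge0 ?(ltW b0) //; last by rewrite mulrC.
  by rewrite mulr_ge0 //; lra.
have An : A * a `^ (- (2 / rho)) <= n%:R `^ (theta / 2).
  by near: n; apply: near_powR_ge; rewrite divr_gt0.
rewrite /tau ler_pdivlMr ?powR_gt0 //; last by lra.
have l0 : 0 < (ln n%:R : R) `^ (2 / rho) by apply: powR_gt0; lra.
have [A0|A0] := leP A 0.
  by apply: le_trans (powR_ge0 _ _); rewrite mulr_le0_ge0 // ltW.
apply: (@le_trans _ _ (A * (n%:R `^ (theta / 2) * a `^ (- (2 / rho))))).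
  by rewrite ler_wpM2l // ltW.
rewrite mulrCA.
have -> : n%:R `^ (2 * kappa + rho - 1)^-1 = n%:R `^ (theta / 2) * n%:R `^ (theta / 2).
  rewrite -powRD; first by congr (_ `^ _); rewrite -/theta; field.
  by rewrite (gt_eqF n0) implybT.
by rewrite ler_wpM2l // powR_ge0.
Unshelve. all: by end_near. Qed.

Section fixed_n.
Variable n : nat.
Hypothesis n1 : 1 <= ln n%:R :> R.
Let m : R := ln n%:R.
Let t := tau kappa rho n.

Lemma tau_n0 : 0 < n%:R :> R.
Proof. by rewrite ltNge; apply/negP => /ln0 n0; move: n1; rewrite n0; lra. Qed.
Let n0 := tau_n0.

Let n1' : 1 <= n%:R :> R.
Proof. by rewrite ler1n -(ltr0n R). Qed.

Lemma tau_gt0 : 0 < t.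
Proof. by rewrite divr_gt0 // powR_gt0 //; move: n1; lra. Qed.

Lemma tau_le : t <= n%:R `^ theta.
Proof.
have m0 : 0 < m by rewrite /m; move: n1; lra.
rewrite /t /tau ler_pdivrMr ?powR_gt0 //.
rewrite -[leLHS]mulr1 ler_wpM2l ?powR_ge0 //.
by rewrite -[leLHS](powRr0 m) ler_powR // divr_ge0 // ltW.
Qed.

Lemma ln_tau_le : ln t <= m.
Proof.
apply: (@le_trans _ _ (ln (n%:R `^ theta))).
  by rewrite ler_ln ?posrE ?tau_gt0 ?powR_gt0 // tau_le.
by rewrite ln_powR ler_piMl //; rewrite /m; move: n1; lra.
Qed.

(** The exponent [2 / rho] in [tau] is made for this: it absorbs two logarithms, one from the length
    of a program and one from the size of its alphabet. *)
Lemma tau_powR_rho : t `^ rho * m ^+ 2 = n%:R `^ (theta * rho).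
Proof.
have m0 : 0 <= m by rewrite /m; move: n1; lra.
rewrite /t /tau powRM ?powR_ge0 ?invr_ge0 ?powR_ge0 //.
rewrite -[(m `^ (2 / rho))^-1]powRN -powRrM -powRrM -/theta -mulrA.
have -> : - (2 / rho) * rho = - 2%:R by field; rewrite gt_eqF.
by rewrite powR_invn // mulVf ?mulr1 // expf_neq0 // gt_eqF // /m; move: n1; lra.
Qed.

Lemma powR_rho_le_n : n%:R `^ (theta * rho) <= n%:R :> R.
Proof. by rewrite -[leRHS]powRr1 // ler_powR. Qed.

(** The balance that determines [theta]: by [tau_le] it reduces to
    [theta * (rho + 2 * kappa - 1) = 1]. *)
Lemma powR_rho_le : n%:R `^ (theta * rho) <= n%:R * t^-1 `^ (2 * kappa - 1).
Proof.
have t0 := tau_gt0.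
have -> : t^-1 `^ (2 * kappa - 1) = (t `^ (2 * kappa - 1))^-1.
  by rewrite -[t^-1]powR_inv1 ?(ltW t0) // -powRrM mulN1r powRN.
rewrite ler_pdivlMr ?powR_gt0 //.
apply: (@le_trans _ _ (n%:R `^ (theta * rho) * n%:R `^ (theta * (2 * kappa - 1)))).
  rewrite ler_wpM2l ?powR_ge0 // powRrM ge0_ler_powR ?nnegrE ?(ltW t0) ?powR_ge0 ?tau_le //; move: kappa1; lra.
rewrite -powRD; last by rewrite (gt_eqF n0) implybT.
rewrite -mulrDr (_ : theta * _ = 1) ?powRr1 //.
by rewrite /theta; field; rewrite gt_eqF.
Qed.

End fixed_n.

(** Put [x = n^(theta rho)]; then [tau^q <= n^(theta q) = x^(q / rho)], and the exponential decay in
    [x] wins. *)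
Lemma tau_expR_bounded (q : R) : 0 <= q ->
  exists2 C : R, 0 <= C & forall n, 1 <= ln n%:R :> R ->
    tau kappa rho n `^ q * expR (- (n%:R `^ (theta * rho))) <= C.
Proof.
move=> q0; have [|C C0 CP] := @powR_expRN_bounded R (q / rho); first by rewrite divr_ge0 // ltW.
exists C => // n n1; have n0 := tau_n0 n1.
have n1' : 1 <= n%:R :> R by rewrite ler1n -(ltr0n R).
apply: le_trans (CP (n%:R `^ (theta * rho)) _); last first.
  by rewrite -[leLHS](powRr0 n%:R) ler_powR // mulr_ge0 // ltW.
rewrite ler_wpM2r ?expR_ge0 // -powRrM.
have -> : theta * rho * (q / rho) = theta * q by field; rewrite gt_eqF.
rewrite powRrM ge0_ler_powR ?nnegrE ?powR_ge0 // ?tau_le //.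
by rewrite ltW // tau_gt0.
Qed.

End tau_asymptotics.

Lemma log_alphabet_size_le (R : realType) (D m c K : R) : 1 <= m -> 0 <= D -> c <= K * m ->
  D + m + (D + m) + (c + 2) <= (2 * D + 2 + K + 2) * m.
Proof. by move=> m1 D0 cK; have : D <= D * m by [exact: ler_peMr]; lra. Qed.

Lemma alphabet_size_le (N k : nat) : (0 < k)%N ->
  ((N.+1 * N.+2 * (k * 2).+1).+1 <= N.+2 * N.+2 * (2 * (2 * k)))%N.
Proof.
move=> k0; have h : ((k * 2).+1 <= 2 * (2 * k))%N by lia.
apply: (@leq_trans (N.+2 * N.+2 * (k * 2).+1)); last by rewrite leq_mul2l h orbT.
by rewrite -!mulnA [X in (_ <= X)%N]mulSn addnC -addn1 leq_add2l muln_gt0.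
Qed.

Section schedule.
Variables (R : realType) (kappa rho a1 a2 C1 C2 : R) (a3 a4 C3 n : nat).
Hypotheses (kappa1 : 1 <= kappa) (rho0 : 0 < rho) (a10 : 0 < a1) (a20 : 0 < a2)
  (C10 : 0 < C1) (C20 : 0 < C2).
Let t := tau kappa rho n.
Let m : R := ln n%:R.
Let x : R := ln t.
Hypotheses (n1 : 1 <= m) (x1 : 1 <= x).

Let t0 : 0 < t. Proof. exact: tau_gt0. Qed.

Let xm : x <= m. Proof. exact: ln_tau_le. Qed.

Lemma tau_ge1 : 1 <= t.
Proof.
by rewrite -(ler_ln (x := 1)) ?posrE // ln1; move: x1; rewrite /x; lra.
Qed.

Let P1 : 1 <= t `^ rho.
Proof. by rewrite -[leLHS](powRr0 t) ler_powR ?tau_ge1 // ltW. Qed.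

Lemma ceil_ln_tau : x <= (Num.ceil (ln t^-1^-1))%:~R <= 2 * x.
Proof.
rewrite invrK -/x ceil_ge /=.
have := ceilB1_lt x; rewrite intrB.
by move: x1; lra.
Qed.

Lemma absz_ceil_ln_tau : `|Num.ceil (ln t^-1^-1)|%N%:R = (Num.ceil (ln t^-1^-1))%:~R :> R.
Proof.
rewrite -[in RHS](gez0_abs (m := Num.ceil _)) // -(ler0z R).
by have /andP[h _] := ceil_ln_tau; apply: le_trans h; move: x1; lra.
Qed.

Lemma L0_tau : a1 <= L0 a1 t^-1 <= 2 * a1 * x.
Proof.
rewrite /L0; have /andP[h1 h2] := ceil_ln_tau; apply/andP; split.
  by rewrite ler_peMr ?(ltW a10) // (le_trans x1).
by rewrite -mulrA mulrCA ler_wpM2l // ltW.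
Qed.

Lemma s0_tau : s0 a2 rho t^-1 = a2 * t `^ rho * x.
Proof.
rewrite /s0 invrK -/x; congr (_ * _ * _).
by rewrite -[t^-1]powR_inv1 ?(ltW t0) // -powRrM mulrNN mul1r.
Qed.

Lemma s0_tau_ge : a2 * x <= s0 a2 rho t^-1.
Proof.
rewrite s0_tau ler_wpM2r //; first by move: x1; lra.
by rewrite ler_peMr // ltW.
Qed.

Lemma c0_tau : (0 < a4)%N -> x <= (c0 a3 a4 t^-1)%:R <= (a3 + 2 * a4)%:R * x.
Proof.
move=> a40; rewrite /c0 natrD natrM absz_ceil_ln_tau.
have /andP[h1 h2] := ceil_ln_tau.
have a41 : 1 <= a4%:R :> R by rewrite ler1n.
have a30 : 0 <= a3%:R :> R by [].
move: (Num.ceil _)%:~R h1 h2 => k h1 h2.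
rewrite natrD natrM; apply/andP; split; first by move: x1; nra.
have : a3%:R <= a3%:R * x by rewrite ler_peMr.
have : a4%:R * k <= a4%:R * (2 * x) by rewrite ler_wpM2l.
lra.
Qed.

Lemma expR_half_le2 : expR (2^-1) <= 2 :> R.
Proof. by apply: le_trans (expR_le_quad (lexx _)) _; lra. Qed.

(** Since [2 >= e^(1/2)] and [c0 >= ln t], the power [2^(C3 c0)] is at least [e^(C3 ln t / 2)];
    hence the factor 2 in the condition on [C3]. *)
Lemma grid_accuracy : (0 < a4)%N -> 2 * kappa <= C3%:R ->
  2 ^- (C3 * c0 a3 a4 t^-1) <= t^-1 `^ kappa.
Proof.
move=> a40 C3k.
have -> : t^-1 `^ kappa = (t `^ kappa)^-1.
  by rewrite -[t^-1]powR_inv1 ?(ltW t0) // -powRrM mulN1r powRN.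
rewrite lef_pV2 ?posrE ?powR_gt0 ?exprn_gt0 //.
rewrite /powR gt_eqF // -/x.
apply: (@le_trans _ _ (expR ((C3 * c0 a3 a4 t^-1)%:R * 2^-1))); last first.
  by rewrite expRM_natl lerXn2r ?nnegrE ?expR_ge0 // expR_half_le2.
rewrite ler_expR natrM.
have /andP[h _] := c0_tau a40.
have : C3%:R * x <= C3%:R * (c0 a3 a4 t^-1)%:R by rewrite ler_wpM2l.
have : 2 * kappa * x <= C3%:R * x by rewrite ler_wpM2r // (le_trans ler01).
lra.
Qed.

(** The word length [T] is [O(t^rho m)] and the logarithm of the alphabet size is [O(m)]; their
    product is rewritten by [tau_powR_rho]. *)
Lemma word_count_le (d : nat) (s := C2 * s0 a2 rho t^-1) (L := C1 * L0 a1 t^-1)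
    (c := (C3 * c0 a3 a4 t^-1)%N)
    (N := maxn d (Num.truncn s)) (T := (Num.truncn s + Num.truncn L)%N) :
  (0 < a4)%N ->
  ((((N.+1 * N.+2) * (2 ^ c * 2).+1).+1 ^ T)%:R <=
   expR ((2 * (d%:R + 2 + C2 * a2) + 2 + C3%:R * (a3 + 2 * a4)%:R + 2) *
     (C2 * a2 + 2 * C1 * a1) * n%:R `^ ((2 * kappa + rho - 1)^-1 * rho)) :> R).
Proof.
move=> a40.
have n0 := tau_n0 n1.
have n1' : 1 <= n%:R :> R by rewrite ler1n -(ltr0n R).
have x0 : 0 <= x by rewrite (le_trans ler01).
have m0 : 0 <= m by rewrite (le_trans ler01).
have PE : t `^ rho * m ^+ 2 = n%:R `^ ((2 * kappa + rho - 1)^-1 * rho) := tau_powR_rho kappa rho0 n1.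
have Nn : n%:R `^ ((2 * kappa + rho - 1)^-1 * rho) <= n%:R := powR_rho_le_n kappa1 rho0 n1.
rewrite -PE; rewrite -PE in Nn.
set P := t `^ rho in PE Nn *.
have P1' : 1 <= P := P1.
have P0 : 0 <= P by rewrite (le_trans ler01).
have CA0 : 0 <= C2 * a2 by rewrite mulr_ge0 // ltW.
have CB0 : 0 <= C1 * a1 by rewrite mulr_ge0 // ltW.
have sE : s = C2 * a2 * P * x by rewrite /s s0_tau !mulrA.
have s0' : 0 <= s by rewrite sE mulr_ge0 // mulr_ge0.
have /andP[Ll Lu] := L0_tau.
have L0' : 0 <= L by rewrite /L mulr_ge0 ?(ltW C10) // (le_trans (ltW a10)).
have TP : T%:R <= (C2 * a2 + 2 * C1 * a1) * P * m.
  rewrite natrD mulrDl mulrDl; apply: lerD.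
    rewrite (le_trans (_ : _ <= s)) ?truncn_le // sE ler_wpM2l // mulr_ge0 //.
  rewrite (le_trans (_ : _ <= L)) ?truncn_le //.
  apply: (@le_trans _ _ (C1 * (2 * a1 * x))); first by rewrite ler_wpM2l // ltW.
  have -> : C1 * (2 * a1 * x) = 2 * (C1 * a1) * (1 * x) by ring.
  have -> : 2 * C1 * a1 * P * m = 2 * (C1 * a1) * (P * m) by ring.
  by apply: ler_wpM2l; [rewrite mulr_ge0|apply: ler_pM].
(* The number of registers is at most linear in [n], so naming one costs [O(log n)]. This comes from
   [t^rho m^2 <= n]. *)
have NP : N.+2%:R <= (d%:R + 2 + C2 * a2) * n%:R.
  have : N%:R <= d%:R + s.
    apply: (@le_trans _ _ (d + Num.truncn s)%:R).
      by rewrite ler_nat geq_max leq_addr leq_addl.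
    by rewrite natrD lerD2l truncn_le.
  have sn : s <= C2 * a2 * n%:R.
    rewrite sE -mulrA ler_wpM2l //; apply: le_trans Nn.
    apply: ler_wpM2l => //; apply: (le_trans xm).
  by rewrite expr2; apply: ler_peMr.
  have dn : d%:R + 2 <= (d%:R + 2) * n%:R :> R by apply: ler_peMr; rewrite // addr_ge0.
  rewrite mulrDl -[N.+2]addn2 natrD; lra.
have nE : n%:R = expR m by rewrite lnK.
set D := d%:R + 2 + C2 * a2 in NP *.
have NP' : N.+2%:R <= expR (D + m).
  rewrite expRD -nE (le_trans NP) // ler_wpM2r //.
  by apply: le_trans (expR_ge1Dx D); lra.
have two_le : 2 <= expR 1 :> R by apply: le_trans (expR_ge1Dx 1); lra.
have cE : (2 ^ c.+2)%:R <= expR (c%:R + 2) :> R.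
  have -> : c%:R + 2 = c.+2%:R * 1 :> R by rewrite mulr1 -[c.+2]addn2 natrD.
  by rewrite natrX expRM_natl lerXn2r // nnegrE ?expR_ge0.
have /andP[_ cu] := c0_tau a40.
have cm : c%:R <= C3%:R * (a3 + 2 * a4)%:R * m.
  by rewrite /c natrM -mulrA ler_wpM2l // (le_trans cu) // ler_wpM2l.
have AE : ((N.+1 * N.+2 * (2 ^ c * 2).+1).+1%:R <=
    expR ((2 * D + 2 + C3%:R * (a3 + 2 * a4)%:R + 2) * m) :> R).
  apply: (@le_trans _ _ ((N.+2 * N.+2 * 2 ^ c.+2)%:R)).
    by rewrite ler_nat !expnS alphabet_size_le // expn_gt0.
  rewrite (natrM _ (N.+2 * N.+2)) (natrM _ N.+2).
  apply: (@le_trans _ _ (expR (D + m) * expR (D + m) * expR (c%:R + 2))).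
    by apply: ler_pM => //; apply: ler_pM.
  rewrite -!expRD ler_expR.
  have D0 : 0 <= D by rewrite !addr_ge0.
  exact: log_alphabet_size_le n1 D0 cm.
rewrite natrX; apply: (@le_trans _ _ (expR ((2 * D + 2 + C3%:R * (a3 + 2 * a4)%:R + 2) * m) ^+ T)).
  by apply: lerXn2r => //; rewrite nnegrE ?expR_ge0.
rewrite -expRM_natl ler_expR.
set CD := _ + 2.
have CD0 : 0 <= CD by rewrite !addr_ge0 // mulr_ge0 // !addr_ge0.
apply: (@le_trans _ _ ((C2 * a2 + 2 * C1 * a1) * P * m * (CD * m))).
  by rewrite ler_wpM2r // mulr_ge0.
by rewrite le_eqVlt; apply/orP; left; apply/eqP; ring.
Qed.

End schedule.

(** * The rate of convergence *)

(** Places every candidate in the diagonal family for which hypothesis (c) is stated. *)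
Lemma net_sets_diag (R : realType) d (L s : R) c (G : set 'cV[R]_d) :
  net_sets L s c G -> exists N, net_sets N%:R N%:R N G.
Proof.
move=> [Phi [lP sP wP ->]]; pose N := maxn c (maxn (nlayers Phi) (sparsity Phi)).
exists N, Phi; split => //.
- by rewrite ler_nat /N !leq_max leqnn orbT.
- by rewrite ler_nat /N !leq_max leqnn !orbT.
- by apply: weights_in_sub wP => w; apply: weight_grid_le; rewrite /N leq_maxl.
Qed.

Lemma layers_budget (R : realType) (r l nl : nat) (a L : R) :
  0 < a -> a <= L -> l%:R <= L -> (nl <= r * (l + 4) + 2)%N ->
  nl%:R <= (r%:R + (4 * r%:R + 2) / a) * L.
Proof.
move=> a0 aL lL; rewrite -(ler_nat R) natrD natrM natrD => h; apply: le_trans h _.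
have r0 : 0 <= r%:R :> R by [].
have h1 : r%:R * l%:R <= r%:R * L by rewrite ler_wpM2l.
have h2 : 4 * r%:R + 2 <= (4 * r%:R + 2) / a * L.
  by rewrite mulrAC ler_pdivlMr // ler_wpM2l //; lra.
by rewrite mulrDl; lra.
Qed.

(** The wiring term, of order [x], and the additive constants are absorbed through
    [1 <= x <= S / a2]. The [+ 1] makes positivity of the factor immediate. *)
Lemma sparsity_budget (R : realType) (r l s ns d sc uc : nat) (a1 a2 x L S : R) :
  0 < a1 -> 0 < a2 -> 1 <= x -> L <= 2 * a1 * x -> a2 * x <= S ->
  l%:R <= L -> s%:R <= S -> (ns <= r * (2 * s + l * d + sc) + uc)%N ->
  ns%:R <= (2 * r%:R + r%:R * d%:R * (2 * a1) / a2 + (r%:R * sc%:R + uc%:R + 1) / a2) * S.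
Proof.
move=> a10 a20 x1 Lx xS lL sS; rewrite -(ler_nat R) => h.
apply: le_trans h _.
have r0 : 0 <= r%:R :> R by [].
have d0 : 0 <= d%:R :> R by [].
have sc0 : 0 <= sc%:R :> R by [].
have uc0 : 0 <= uc%:R :> R by [].
have h1 : r%:R * s%:R <= r%:R * S by rewrite ler_wpM2l.
have xS' : x <= S / a2 by rewrite ler_pdivlMr // mulrC.
have h2 : r%:R * d%:R * l%:R <= r%:R * d%:R * (2 * a1 * (S / a2)).
  apply: ler_wpM2l; first by rewrite mulr_ge0.
  apply: (le_trans lL); apply: (le_trans Lx); apply: ler_wpM2l => //; lra.
have h3 : (r%:R * sc%:R + uc%:R + 1) <= (r%:R * sc%:R + uc%:R + 1) * (S / a2).
  apply: ler_peMr; last exact: le_trans xS'.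
  by rewrite !addr_ge0 // mulr_ge0.
have -> : (r * (2 * s + l * d + sc) + uc)%:R =
   2 * (r%:R * s%:R) + r%:R * d%:R * l%:R + (r%:R * sc%:R + uc%:R) :> R.
  by rewrite !(natrD, natrM); ring.
have -> : (2 * r%:R + r%:R * d%:R * (2 * a1) / a2 + (r%:R * sc%:R + uc%:R + 1) / a2) * S =
  2 * (r%:R * S) + r%:R * d%:R * (2 * a1 * (S / a2)) + (r%:R * sc%:R + uc%:R + 1) * (S / a2).
  by ring.
lra.
Qed.

(** The right side grows like [D^(2 - 1/kappa)], so the smallest admissible [D] decides, and
    [kappa (2 - 1/kappa) = 2 kappa - 1]. The power of [K] is at least [K] because [K >= 1] and its
    exponent is at least 1. *)
Lemma rate_exponent (R : realType) (kappa K e D Kv : R) :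
  1 <= kappa -> 1 <= K -> 0 < e -> 0 < Kv -> K * e `^ kappa <= D ->
  K * e `^ (2 * kappa - 1) / (32 * Kv) <= D ^+ 2 / (32 * (Kv * D `^ kappa^-1)).
Proof.
move=> k1 K1 e0 Kv0 tD.
have K0 : 0 < K by lra.
have t0 : 0 < K * e `^ kappa by rewrite mulr_gt0 // powR_gt0.
have D0 : 0 < D by exact: lt_le_trans tD.
have k0 : 0 < kappa by lra.
have ki : kappa^-1 <= 1 by rewrite invf_le1.
have ex0 : 0 <= 2 - kappa^-1 by lra.
have -> : D ^+ 2 / (32 * (Kv * D `^ kappa^-1)) = D `^ (2 - kappa^-1) / (32 * Kv).
  rewrite powRB; last by rewrite (gt_eqF D0) implybT.
  rewrite [D `^ 2]powR_mulrn ?(ltW D0) //; field.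
  by rewrite !gt_eqF // powR_gt0.
rewrite ler_pM2r ?invr_gt0 ?mulr_gt0 //.
apply: (@le_trans _ _ ((K * e `^ kappa) `^ (2 - kappa^-1))); last first.
  by rewrite ge0_ler_powR ?nnegrE ?(ltW t0) ?(ltW D0).
rewrite powRM ?powR_ge0 ?(ltW K0) // -powRrM.
have -> : kappa * (2 - kappa^-1) = 2 * kappa - 1 by field; rewrite gt_eqF.
rewrite ler_wpM2r ?powR_ge0 // -[leLHS]powRr1 ?(ltW K0) // ler_powR //; lra.
Qed.

(** [K] is large enough for the deviation exponent to reach [(Cc + 1) N]: [Cc N] pays for the
    cardinality and one [N] is left over. *)
Lemma tail_le (R : realType) (Cc K Kv N n E : R) (I : nat) :
  0 < Kv -> 0 <= N -> 0 <= Cc -> 32 * Kv * (Cc + 1) <= K -> N <= n * E ->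
  I%:R <= expR (Cc * N) ->
  I%:R * expR (- (n * (K * E / (32 * Kv)))) <= expR (- N).
Proof.
move=> Kv0 N0 Cc0 CK NE IN.
apply: (@le_trans _ _ (expR (Cc * N) * expR (- (n * (K * E / (32 * Kv)))))).
  by rewrite ler_wpM2r // expR_ge0.
rewrite -expRD ler_expR.
have h1 : Cc + 1 <= K / (32 * Kv) by rewrite ler_pdivlMr ?mulr_gt0 // mulrC.
have -> : n * (K * E / (32 * Kv)) = K / (32 * Kv) * (n * E).
  by field; rewrite gt_eqF.
have h2 : (Cc + 1) * N <= K / (32 * Kv) * (n * E) by apply: ler_pM => //; lra.
lra.
Qed.

Theorem corollary3p7 (R : realType) (beta1 B1 beta2 B2 : R) (d : nat)
    (hbeta1 : 0 <= beta1) (hB1 : 0 < B1) (hbeta2 : 0 < beta2) (hB2 : 0 < B2)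
    (hd : (2 <= d)%N)
    (rho : R := (d%:R - 1) / beta2) (kappa : R := 1 + beta1)
    (F := @holder_class R d.-1 beta2 B2)
    (QQ : set (probability ('cV[R]_d * bool)%type R))
    (f : probability ('cV[R]_d * bool)%type R -> 'cV[R]_d -> R)
    (hsupp : forall Q, QQ Q -> Q (@cube R d `*` [set: bool]) = 1%E)
    (hf : forall Q, QQ Q -> is_regression Q (f Q))
    (M : R) (hM : 1 < M)
    (ha : forall Q, QQ Q -> density_bounded Q M)
    (r : nat) (eps1 eps2 : R) (heps1 : 0 < eps1) (heps2 : 0 < eps2)
    (hb : forall Q, QQ Q ->
      piecewise_class (f Q) beta1 B1 eps1 eps2 r F (bayes_rule (f Q)))
    (c1 : R) (hc1 : 0 < c1)
    (hc : forall Q, QQ Q -> forall (n : nat) (G : set 'cV[R]_d),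
      net_sets n%:R n%:R n G ->
      c1 * d_Delta Q G (bayes_rule (f Q)) `^ kappa
        <= d_f Q (f Q) G (bayes_rule (f Q)))
    (a1 a2 : R) (a3 a4 : nat)
    (ha1 : 0 < a1) (ha2 : 0 < a2) (ha3 : (0 < a3)%N) (ha4 : (0 < a4)%N)
    (happrox : exists2 eps0 : R, 0 < eps0 &
      forall gamma, F gamma -> forall eps : R, 0 < eps < eps0 ->
      exists Phi : relu_net R 1 d.-1,
        [/\ (nlayers Phi)%:R <= L0 a1 eps, (sparsity Phi)%:R <= s0 a2 rho eps,
            weights_in (@weight_grid R (c0 a3 a4 eps)) Phi &
            forall x, cube x -> `|realization Phi x 0 0 - gamma x| <= eps]) :
  exists (C1 C2 : R) (C3 : nat), [/\ 0 < C1, 0 < C2, (0 < C3)%N &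
    let NN n : set (set 'cV[R]_d) :=
      let eps := (tau kappa rho n)^-1 in
      net_sets (C1 * L0 a1 eps) (C2 * s0 a2 rho eps) (C3 * c0 a3 a4 eps)%N in
    forall Ghat : forall n, n.-tuple ('cV[R]_d * bool) -> set 'cV[R]_d,
    (\forall n \near \oo, forall z : n.-tuple ('cV[R]_d * bool),
      is_argmin (NN n) (empirical_risk z) (Ghat n z)) ->
    forall p : R, 1 <= p ->
    (limn_esup (fun n => ereal_sup
      [set (tau kappa rho n `^ (p * kappa))%:E *
           'E_(iid Q n)[(fun z => d_f Q (f Q) (Ghat n z) (bayes_rule (f Q)) `^ p)%R]
         | Q in QQ]) < +oo)%E /\
    (limn_esup (fun n => ereal_sup
      [set (tau kappa rho n `^ p)%:E *
           'E_(iid Q n)[(fun z => d_Delta Q (Ghat n z) (bayes_rule (f Q)) `^ p)%R]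
         | Q in QQ]) < +oo)%E].
Proof.
have kappa1 : 1 <= kappa by rewrite /kappa lerDl.
have kappa0 : 0 < kappa by exact: lt_le_trans kappa1.
have rho0 : 0 < rho by rewrite divr_gt0 // subr_gt0 ltr1n.
have M0 : 0 < M by exact: lt_trans hM.
have r0 : 0 <= r%:R :> R by [].
pose C1 : R := r%:R + (4 * r%:R + 2) / a1.
pose C2 : R := 2 * r%:R + r%:R * d.+1%:R * (2 * a1) / a2 +
  (r%:R * (stage_cost d)%:R + (union_cost d)%:R + 1) / a2.
pose C3 := (Num.truncn (2 * kappa)).+1.
have C10 : 0 < C1.
  by rewrite ltr_wpDl // divr_gt0 // ltr_wpDl // mulr_ge0.
have C20 : 0 < C2.
  rewrite ltr_wpDl //; last by rewrite divr_gt0 // ltr_wpDl // addr_ge0 // mulr_ge0.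
  by rewrite addr_ge0 ?mulr_ge0 // ?invr_ge0 ltW.
have C3k : 2 * kappa <= C3%:R by exact: ltW (truncnS_gt _).
exists C1, C2, C3; split => // NN Ghat argm p p1.
pose K0 : R := 4 * (r * d)%:R * M + 2 * r%:R * M * (1 + B1) * (4 / eps2 + 3) `^ kappa.
(* The 2 comes from the triangle inequality through the Bayes rule, each leg being bounded by (c);
   the 1 ensures [1 <= Kv]. *)
pose Kv : R := 1 + 2 * c1^-1 `^ kappa^-1.
pose Cc : R := (2 * (d%:R + 2 + C2 * a2) + 2 + C3%:R * (a3 + 2 * a4)%:R + 2) *
     (C2 * a2 + 2 * C1 * a1).
(* The three summands give [1 <= K], an approximation error at most half the threshold
   [K eps^kappa], and the domination required by [tail_le]. *)
pose K : R := 1 + 2 * K0 + 32 * Kv * (Cc + 1).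
have K00 : 0 <= K0.
  by rewrite addr_ge0 // ?mulr_ge0 ?powR_ge0 ?addr_ge0 ?(ltW M0) ?(ltW hB1).
have Kv1 : 1 <= Kv by rewrite lerDl mulr_ge0 // powR_ge0.
have Kv0 : 0 < Kv by exact: lt_le_trans Kv1.
have Cc0 : 0 <= Cc.
  have h2 : 0 <= C2 * a2 by rewrite mulr_ge0 // ltW.
  have h1 : 0 <= 2 * C1 * a1 by rewrite mulr_ge0 ?(ltW ha1) // mulr_ge0 // ltW.
  rewrite /Cc; apply: mulr_ge0; last exact: addr_ge0.
  by do 3![apply: addr_ge0 => //]; rewrite mulr_ge0 // !addr_ge0.
have CcK : 0 <= 32 * Kv * (Cc + 1) by rewrite mulr_ge0 ?addr_ge0 // mulr_ge0 // ltW.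
have K1 : 1 <= K by rewrite /K; lra.
have K2 : 2 * K0 <= K by rewrite /K; lra.
have K3 : 32 * Kv * (Cc + 1) <= K by rewrite /K; lra.
have df0 Q G : 0 <= d_f Q (f Q) G (bayes_rule (f Q)) by exact: Rintegral_abs_ge0.
have margin n Q G : QQ Q -> NN n G ->
    d_Delta Q G (bayes_rule (f Q)) <=
    c1^-1 `^ kappa^-1 * d_f Q (f Q) G (bayes_rule (f Q)) `^ kappa^-1.
  move=> QQQ /net_sets_diag[N /(hc _ QQQ) h].
  have dD0 : 0 <= d_Delta Q G (bayes_rule (f Q)) by rewrite fine_ge0.
  rewrite -powRM ?invr_ge0 ?(ltW hc1) //.
  rewrite -[leLHS]powRr1 // -(mulfV (lt0r_neq0 kappa0)) powRrM.
  rewrite ge0_ler_powR ?nnegrE ?powR_ge0 ?invr_ge0 ?mulr_ge0 ?(ltW kappa0) ?invr_ge0 ?(ltW hc1) //.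
  by rewrite mulrC ler_pdivlMr // mulrC.
(* One estimate for both claims: [q = p], [C = 1] for the excess risk, and [q = p / kappa] for the
   symmetric difference, which [margin] bounds by a power of the excess risk. *)
have key q C : 0 <= q -> 0 <= C -> exists2 B : R, 0 <= B &
    \forall n \near \oo, forall Q, QQ Q -> forall X : n.-tuple ('cV[R]_d * bool) -> R,
      (forall z, 0 <= X z <= C * d_f Q (f Q) (Ghat n z) (bayes_rule (f Q)) `^ q) ->
      ((tau kappa rho n `^ (q * kappa))%:E * 'E_(iid Q n)[X] <= B%:E)%E.
  move=> q0 C0.
  have qk0 : 0 <= q * kappa by rewrite mulr_ge0 // ltW.
  have [Cq Cq0 CqP] := tau_expR_bounded kappa1 rho0 qk0.
  exists (C * (K `^ q + Cq)); first by rewrite mulr_ge0 // addr_ge0 // powR_ge0.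
  have [eps0 eps00 happ] := happrox.
  pose W := 4 / eps2 + 3.
  have W0 : 0 < W by rewrite addr_gt0 // divr_gt0.
  near=> n => Q QQQ X XE.
  have n1 : 1 <= ln n%:R :> R by near: n; exact: near_ln_ge.
  (* This gives [1 <= ln t], the standing assumption on the schedule. The [+ 1] in two of the bounds
     below produces the strict inequalities [t^-1 < eps0] and [W * t^-1 < 1]. *)
  have te1 : expR 1 <= tau kappa rho n by near: n; exact: near_tau_ge.
  have te : eps0^-1 + 1 <= tau kappa rho n by near: n; exact: near_tau_ge.
  have tW1 : W / eps1 <= tau kappa rho n by near: n; exact: near_tau_ge.
  have tW : W + 1 <= tau kappa rho n by near: n; exact: near_tau_ge.
  set t := tau kappa rho n in te1 te tW1 tW *.
  have t0 : 0 < t by exact: tau_gt0.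
  have x1 : 1 <= ln t.
    by rewrite -[leLHS]expRK ler_ln ?posrE ?expR_gt0.
  have e0 : 0 < t^-1 by rewrite invr_gt0.
  have ee : t^-1 < eps0.
    by rewrite -[eps0]invrK ltf_pV2 ?posrE ?invr_gt0 //; lra.
  have We1 : W * t^-1 <= eps1.
    by rewrite ler_pdivrMr // mulrC -ler_pdivrMr.
  have We : W * t^-1 < 1 by rewrite ltr_pdivrMr // mul1r; lra.
  have argmn : forall z, is_argmin (NN n) (empirical_risk z) (Ghat n z).
    by near: n.
  have /andP[L0l L0u] := L0_tau ha1 x1.
  have s0l := s0_tau_ge rho0 ha2 n1 x1.
  have L00 : 0 <= L0 a1 t^-1 by apply: le_trans L0l; exact: ltW.
  have s00 : 0 <= s0 a2 rho t^-1.
    by apply: le_trans s0l; rewrite mulr_ge0 ?(ltW ha2) // (le_trans ler01).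
  have [|Psi [lPsi sPsi wPsi]] := approx_bayes (L := Num.truncn (L0 a1 t^-1))
      (s := Num.truncn (s0 a2 rho t^-1)) (hf _ QQQ) M0 (ha _ QQQ) hbeta1 (ltW hB1) heps1 heps2 (hb _ QQQ)
      e0 We1 We (grid_accuracy a3 n1 x1 ha4 C3k) (leq_pmull _ (ltn0Sn _)).
    move=> gamma Fg; have [|Phi [h1 h2 h3 h4]] := happ _ Fg t^-1; first by rewrite e0.
    by exists Phi; split => //; rewrite truncn_ge_nat.
  set G' := [set x | _] => dG'.
  have NG' : NN n G'.
    exists Psi; split => //.
      by apply: (layers_budget ha1 L0l _ lPsi); rewrite truncn_le.
    by apply: (sparsity_budget ha1 ha2 x1 L0u s0l _ _ sPsi); rewrite truncn_le.
  have mNN G : NN n G -> measurable G /\ G `<=` @cube R d.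
    by move=> NG; split; [exact: measurable_net_sets NG|exact: net_sets_sub_cube NG].
  have [I [FI [cardI cov]]] := @net_sets_cover R d (C1 * L0 a1 t^-1) (C2 * s0 a2 rho t^-1)
    (C3 * c0 a3 a4 t^-1).
  have tk0 : 0 < t^-1 `^ kappa by exact: powR_gt0.
  have K0' : 0 < K by exact: lt_le_trans K1.
  have td : 0 < K * t^-1 `^ kappa by rewrite mulr_gt0.
  have dG'2 : d_f Q (f Q) G' (bayes_rule (f Q)) <= K * t^-1 `^ kappa / 2.
    apply: le_trans (dG' (mNN _ NG').1) _; rewrite -/K0 mulrAC ler_wpM2r ?(ltW tk0) //.
    by rewrite ler_pdivlMr // mulrC.
  have Dl G : NN n G -> K * t^-1 `^ kappa <= d_f Q (f Q) G (bayes_rule (f Q)) ->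
      d_Delta Q G' G <= Kv * d_f Q (f Q) G (bayes_rule (f Q)) `^ kappa^-1.
    move=> NG tG.
    have mB := measurable_bayes_rule (hf _ QQQ).
    apply: le_trans (d_Delta_triangle Q (mNN _ NG').1 (mNN _ NG).1 mB) _.
    have h1 := margin _ _ _ QQQ NG'; have h2 := margin _ _ _ QQQ NG.
    have h3 : d_f Q (f Q) G' (bayes_rule (f Q)) `^ kappa^-1 <=
        d_f Q (f Q) G (bayes_rule (f Q)) `^ kappa^-1.
      rewrite ge0_ler_powR ?nnegrE ?invr_ge0 ?(ltW kappa0) //.
      apply: le_trans dG'2 _; apply: le_trans tG.
      by rewrite ler_pdivrMr // ler_peMr ?(ltW td) // ler1n.
    have c0' := powR_ge0 c1^-1 kappa^-1.
    have h4 := ler_wpM2l c0' h3.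
    have h5 := powR_ge0 (d_f Q (f Q) G (bayes_rule (f Q))) kappa^-1.
    apply: (le_trans (lerD (le_trans h1 h4) h2)).
    by rewrite /Kv mulrDl mul1r -mulrA mulr_natl mulr2n lerDr.
  have al_le G : NN n G -> K * t^-1 `^ kappa <= d_f Q (f Q) G (bayes_rule (f Q)) ->
      K * t^-1 `^ (2 * kappa - 1) / (32 * Kv) <=
      d_f Q (f Q) G (bayes_rule (f Q)) ^+ 2 /
        (32 * (Kv * d_f Q (f Q) G (bayes_rule (f Q)) `^ kappa^-1)).
    by move=> _; exact: rate_exponent.
  have E := erm_expectation_le (hf _ QQQ) argmn mNN cov NG' dG'2 td q0 C0 Kv1 kappa1 Dl al_le XE.
  apply: le_trans (lee_wpmul2l _ E) _; first by rewrite lee_fin powR_ge0.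
  rewrite -EFinM lee_fin mulrCA ler_wpM2l // mulrDr.
  apply: lerD.
    rewrite powRM ?(ltW K0') ?(ltW tk0) // mulrCA -powRrM [kappa * q]mulrC.
    rewrite -powRM ?invr_ge0 ?(ltW t0) // mulfV ?gt_eqF // powR1 mulr1 //.
  apply: le_trans (CqP n n1); rewrite -/t ler_wpM2l ?powR_ge0 //.
  apply: (tail_le Kv0 (powR_ge0 _ _) Cc0 K3 (powR_rho_le kappa1 rho0 n1)).
  rewrite cardI; exact: word_count_le.
split.
  have [|B B0 BP] := key p 1 _ ler01; first exact: le_trans p1.
  apply: (@limn_esup_lty _ _ B); apply: filterS BP => n h.
  apply: ge_ereal_sup => _ [Q QQQ <-].
  by apply: h => // z; rewrite powR_ge0 mul1r /=.
have pk0 : 0 <= p / kappa by rewrite divr_ge0 ?(ltW kappa0) // (le_trans ler01).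
have [B B0 BP] := key (p / kappa) ((c1^-1 `^ kappa^-1) `^ p) pk0 (powR_ge0 _ _).
apply: (@limn_esup_lty _ _ B).
have := argm; apply: filterS2 BP => n h argmn.
apply: ge_ereal_sup => _ [Q QQQ <-].
have := h Q QQQ (fun z => d_Delta Q (Ghat n z) (bayes_rule (f Q)) `^ p).
rewrite divfK ?gt_eqF //; apply => z; rewrite powR_ge0 /=.
have [NG _] := argmn z.
have -> : p / kappa = kappa^-1 * p by rewrite mulrC.
rewrite powRrM -powRM ?powR_ge0 // ge0_ler_powR ?nnegrE ?powR_ge0 ?mulr_ge0 ?fine_ge0 //.
- exact: le_trans p1.
- exact: powR_ge0.
- exact: powR_ge0.
- exact: (margin n Q _ QQQ NG).
Unshelve. all: by end_near. Qed.
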